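(* Let $\boldsymbol X$ be a stationary $\mathcal D$-valued process, regularly varying in $\mathcal D$ with tail index $\alpha>0$ and tail process $\boldsymbol Y$. Let $a,r$ be scaling functions such that $\lim_{T\to\infty}T\,\mathbb P(|\boldsymbol X_0|>a_T)=1$ and such that the following two conditions hold: (1) for all $x>0$, $\displaystyle\lim_{t\to\infty}\limsup_{T\to\infty}\mathbb P\Big(\sup_{t\le|s|\le r_T}|\boldsymbol X_s|>a_Tx\ \Big|\ |\boldsymbol X_0|>a_T\Big)=0$; (2) for all bounded continuous maps $f:\mathbb R_+\times(\widetilde{\mathcal D}_0\setminus\{\tilde{\boldsymbol 0}\})\to\mathbb R_+$ for which there exist $A,\epsilon>0$ such that $f(t,\boldsymbol y)=0$ whenever $|t|>A$ or $\boldsymbol y^*\le\epsilon$, $$\limsup_{T\to\infty}\left|\mathbb E\left[\mathrm e^{-N_T(f)}\right]-\prod_{i=1}^\infty\mathbb E\left[\mathrm e^{-f(ir_T/T,\boldsymbol X_{T,i})}\right]\right|=0,$$ where $\boldsymbol X_{T,i}=a_T^{-1}\boldsymbol X\mathbb 1_{[(i-1)r_T,ir_T)}$ and $N_T=\sum_{i\ge1}\delta_{(ir_T/T,\boldsymbol X_{T,i})}$. Then, with $\vartheta=\mathbb E[1/\mathcal E(\boldsymbol Y)]$, for every $x>0$, $$\lim_{T\to\infty}\mathbb P\left(\sup_{0\le s\le T}|\boldsymbol X_s|\le a_Tx\right)=\mathrm e^{-\vartheta x^{-\alpha}} .$$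
   Context: Fix $d\ge1$ and a norm $|\cdot|$ on $\mathbb R^d$. $\mathcal D=\mathcal D(\mathbb R,\mathbb R^d)$ is the space of càdlàg functions $\mathbb R\to\mathbb R^d$ with Skorohod's $J_1$ topology ($J_1$ convergence on compact intervals) and its Borel $\sigma$-field; $\boldsymbol 0$ is the null function; $B^tf=f(\cdot-t)$; $\boldsymbol y^*=\sup_t|\boldsymbol y_t|$; $\mathcal E(\boldsymbol y)=\int_{-\infty}^\infty\mathbb 1\{|\boldsymbol y_t|>1\}\mathrm dt$. $\mathcal B_0$ is the class of sets $A\subset\mathcal D$ with $\inf_{\boldsymbol y\in A}\sup_{a\le t\le b}|\boldsymbol y_t|>0$ for some $a\le b$; a Borel measure $\mu$ is $\mathcal B_0$-boundedly finite if $\mu(\{\boldsymbol 0\})=0$ and $\mu(A)<\infty$ for Borel $A\in\mathcal B_0$. A stationary $\mathcal D$-valued $\boldsymbol X$ is regularly varying in $\mathcal D$ if there is a non-zero $\mathcal B_0$-boundedly finite measure $\boldsymbol\nu$ such that $\mathbb P(\boldsymbol X\in xA)/\mathbb P(|\boldsymbol X_0|>x)\to\boldsymbol\nu(A)$ as $x\to\infty$ for all Borel $A\in\mathcal B_0$ with $\boldsymbol\nu(\partial A)=0$. Then $\boldsymbol\nu(tA)=t^{-\alpha}\boldsymbol\nu(A)$ for some $\alpha>0$ (the tail index) and $\boldsymbol\nu(\{|\boldsymbol y_0|>1\})=1$. The tail process $\boldsymbol Y$ has law $\boldsymbol\nu(\cdot\cap\{|\boldsymbol y_0|>1\})$. A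 scaling function is a non-decreasing unbounded function $[0,\infty)\to[0,\infty)$. $\mathcal D_0=\{\boldsymbol y\in\mathcal D:\lim_{|t|\to\infty}|\boldsymbol y_t|=0\}$ carries the metric $d_\infty(f,g)=\inf_u\max(\|f\circ u-g\|_\infty,\|u-\mathrm{Id}\|_\infty)$, $u$ ranging over strictly increasing continuous bijections of $\mathbb R$. $\widetilde{\mathcal D}_0$ is the quotient of $\mathcal D_0$ by the relation $f\sim g\iff f=B^tg$ for some $t$, with the metric $\tilde d_\infty(\tilde f,\tilde g)=\inf_{f\in\tilde f,g\in\tilde g}d_\infty(f,g)$; $\tilde{\boldsymbol 0}$ is the class of $\boldsymbol 0$; $\boldsymbol y^*$ is well defined on classes; elements of $\mathcal D_0$ are identified with their classes, and $f(t,\tilde{\boldsymbol 0})=0$ by convention. *)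

(* Defs.v *)
From HB Require Import structures.
From mathcomp Require Import all_boot all_order all_algebra.
From mathcomp Require Import all_classical all_reals all_analysis.

Set Implicit Arguments.
Unset Strict Implicit.
Unset Printing Implicit Defensive.

Import Order.TTheory GRing.Theory Num.Theory.
Import numFieldNormedType.Exports.

Local Open Scope classical_set_scope.
Local Open Scope ring_scope.

(* 'rV[R]_d carries its library topology, which is that of any norm on R^d;
   metric quantities use an arbitrary norm N. *)
Record is_norm (R : realType) (d : nat) (N : 'rV[R]_d -> R) : Prop := IsNorm {
  is_norm_eq0 : forall v, N v = 0 -> v = 0;
  is_normZ : forall (c : R) v, N (c *: v) = `|c| * N v;
  is_normD : forall v w, N (v + w) <= N v + N w }.

Definition cadlag (R : realType) (d : nat) (f : R -> 'rV[R]_d) : Prop :=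
  forall t, f x @[x --> t^'+] --> f t /\ cvg (f x @[x --> t^'-]).

Record skorokhod (R : realType) (d : nat) := Skorokhod {
  skorokhod_val :> R -> 'rV[R]_d;
  skorokhod_cadlag : cadlag skorokhod_val }.

HB.instance Definition _ (R : realType) (d : nat) :=
  gen_eqMixin (skorokhod R d).
HB.instance Definition _ (R : realType) (d : nat) :=
  gen_choiceMixin (skorokhod R d).

Section elements.
Context {R : realType} {d : nat}.
Implicit Types (f : R -> 'rV[R]_d) (y : skorokhod R d).

Lemma cadlag_zero : cadlag (fun _ : R => 0 : 'rV[R]_d).
Proof. by move=> t; split; [exact: cvg_cst|exact: is_cvg_cst]. Qed.

Definition skorokhod0fun : skorokhod R d := Skorokhod cadlag_zero.

Lemma cadlagZ (c : R) f : cadlag f -> cadlag (fun s => c *: f s).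
Proof.
move=> cf t; have [fr fl] := cf t; split; first exact: cvgZr.
exact: is_cvgZr.
Qed.

Definition scaleD (c : R) y : skorokhod R d :=
  Skorokhod (cadlagZ c (@skorokhod_cadlag _ _ y)).

Lemma cadlag_shift (t : R) f : cadlag f -> cadlag (fun s => f (s - t)).
Proof.
move=> cf s; have [fr /cvg_ex[l fl]] := cf (s - t); split.
  move=> A /fr[e /= e0 H]; exists e => //= z; rewrite /ball/= => zs sz.
  by apply: H; rewrite /= ?/ball/= ?ltrBlDr ?subrK // opprB addrA subrK.
apply/cvg_ex; exists l => A /fl[e /= e0 H]; exists e => //= z.
rewrite /ball/= => zs sz.
by apply: H; rewrite /= ?/ball/= ?ltrBlDr ?subrK // opprB addrA subrK.
Qed.

Definition backshift (t : R) y : skorokhod R d :=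
  Skorokhod (cadlag_shift t (@skorokhod_cadlag _ _ y)).

Lemma cadlag_restrict (u v : R) f :
  cadlag f -> cadlag (fun s => if u <= s < v then f s else 0).
Proof.
move=> cf t; have [fr fl] := cf t.
have nz (F : set_system R) (FF : ProperFilter F) :
    (\forall x \near F, ~~ (u <= x < v)) ->
  (if u <= x < v then f x else 0) @[x --> F] --> (0 : 'rV[R]_d).
  move=> H; apply: (@cvg_trans _ ((0 : 'rV[R]_d) @[x --> F])).
    by apply: near_eq_cvg; apply: filterS H => x /negbTE ->.
  exact: cvg_cst.
have nf (F : set_system R) (FF : ProperFilter F) (l : 'rV[R]_d) :
    (\forall x \near F, u <= x < v) -> f x @[x --> F] --> l ->
  (if u <= x < v then f x else 0) @[x --> F] --> l.
  move=> H; apply: cvg_trans.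
  by apply: near_eq_cvg; apply: filterS H => x ->.
split.
  have [/andP[ut tv]|] := boolP (u <= t < v).
    apply: nf => //; near=> x; apply/andP; split.
      by rewrite (le_trans ut)// ltW//; near: x; exact: nbhs_right_gt.
    by near: x; exact: nbhs_right_lt.
  rewrite negb_and -ltNge -leNgt => /orP[tu|vt]; apply: nz; near=> x.
    by rewrite negb_and -ltNge; apply/orP; left; near: x; exact: nbhs_right_lt.
  rewrite negb_and -leNgt; apply/orP; right.
  by rewrite (le_trans vt)// ltW//; near: x; exact: nbhs_right_gt.
have [/andP[ut tv]|] := boolP (u < t <= v).
  move/cvg_ex : fl => [l fl]; apply/cvg_ex; exists l.
  apply: nf => //; near=> x; apply/andP; split.
    by rewrite ltW//; near: x; exact: nbhs_left_gt.
  by rewrite (lt_le_trans _ tv)//; near: x; exact: nbhs_left_lt.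
rewrite negb_and -leNgt -ltNge => /orP[tu|vt];
    apply/cvg_ex; exists 0; apply: nz; near=> x.
  rewrite negb_and -ltNge; apply/orP; left.
  by rewrite (lt_le_trans _ tu)//; near: x; exact: nbhs_left_lt.
rewrite negb_and -leNgt; apply/orP; right.
by rewrite ltW//; near: x; exact: nbhs_left_gt.
Unshelve. all: by end_near. Qed.

Definition restrictD (u v : R) y : skorokhod R d :=
  Skorokhod (cadlag_restrict u v (@skorokhod_cadlag _ _ y)).

End elements.

Definition interval_homeo (R : realType) (a b : R) (u : R -> R) : Prop :=
  [/\ {in `[a, b] &, {homo u : x y / x < y}},
      set_bij `[a, b] `[a, b] u & {within `[a, b], continuous u}].

(* J1 convergence in D([a, b]) of the restrictions, for all a < b that are
   continuity points of the limit *)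
Definition J1_cvg (R : realType) (d : nat) (F : nat -> skorokhod R d)
    (f : skorokhod R d) : Prop :=
  forall a b : R, a < b -> {for a, continuous f} -> {for b, continuous f} ->
  exists u : nat -> R -> R,
    [/\ forall n, interval_homeo a b (u n),
        {uniform `[a, b], u @ \oo --> id} &
        {uniform `[a, b],
          (fun n => (F n : R -> 'rV[R]_d) \o u n) @ \oo -->
          (f : R -> 'rV[R]_d)}].

(* J1 is metrizable, hence determined by its convergent sequences *)
Definition J1_open (R : realType) (d : nat) (U : set (skorokhod R d)) : Prop :=
  forall F f, U f -> J1_cvg F f -> \forall n \near \oo, U (F n).

Section J1_topology.
Context {R : realType} {d : nat}.

Lemma J1_openT : J1_open [set: skorokhod R d].
Proof. by move=> F f _ _; exact: nearW. Qed.

Lemma J1_openI : setI_closed (@J1_open R d).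
Proof.
move=> U V oU oV F f [Uf Vf] Ff.
by apply: filterI; [exact: oU Ff|exact: oV Ff].
Qed.

Lemma J1_open_bigU (I : Type) (U : I -> set (skorokhod R d)) :
  (forall i, J1_open (U i)) -> J1_open (\bigcup_i U i).
Proof.
move=> oU F f [i _ Uif] Ff.
by apply: filterS (oU i F f Uif Ff) => n UiFn; exists i.
Qed.

HB.instance Definition _ := isOpenTopological.Build (skorokhod R d)
  J1_openT J1_openI J1_open_bigU.

HB.instance Definition _ := isPointed.Build (skorokhod R d) skorokhod0fun.

HB.instance Definition _ := Measurable.copy (skorokhod R d)
  (g_sigma_algebraType (@open (skorokhod R d))).

End J1_topology.

Definition frontier (T : topologicalType) (A : set T) : set T :=
  closure A `\` interior A.

Definition sup_on (R : realType) (d : nat) (N : 'rV[R]_d -> R)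
    (S : set R) (f : R -> 'rV[R]_d) : \bar R :=
  ereal_sup [set (N (f t))%:E | t in S].

Definition exceedance_time (R : realType) (d : nat) (N : 'rV[R]_d -> R)
    (y : skorokhod R d) : \bar R :=
  (\int[@lebesgue_measure R]_t (\1_[set s | (1 < N (y s))%R] t)%:E)%E.

Definition B0 (R : realType) (d : nat) (N : 'rV[R]_d -> R)
    (A : set (skorokhod R d)) : Prop :=
  exists a b : R, a <= b /\
    (0 < ereal_inf [set sup_on N `[a, b] (y : R -> 'rV[R]_d) | y in A])%E.

Definition B0_bounded (R : realType) (d : nat) (N : 'rV[R]_d -> R)
    (mu : {measure set (skorokhod R d) -> \bar R}) : Prop :=
  mu [set skorokhod0fun] = 0%E /\
  forall A, measurable A -> B0 N A -> (mu A < +oo)%E.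

Section probability.
Context {disp : measure_display} {T : measurableType disp} {R : realType}.
Context (P : probability T R) {d : nat} (N : 'rV[R]_d -> R).
Implicit Types X : {RV P >-> skorokhod R d}.

Definition stationary X : Prop :=
  forall (t : R) (A : set (skorokhod R d)), measurable A ->
  P ((backshift t \o X) @^-1` A) = P (X @^-1` A).

Definition tail_prob X (x : R) : \bar R := P [set w | x < N (X w 0)].

(* nu is the limiting (tail) measure of the regularly varying X *)
Definition regularly_varying X
    (nu : {measure set (skorokhod R d) -> \bar R}) : Prop :=
  [/\ nu [set: skorokhod R d] != 0%E, B0_bounded N nu &
    forall A, measurable A -> B0 N A -> nu (frontier A) = 0%E ->
      (P (X @^-1` (scaleD x @` A)) / tail_prob X x)%E
        @[x --> +oo] --> nu A].

Definition cond_prob (A B : set T) : \bar R := (P (A `&` B) / P B)%E.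

End probability.

Definition tail_index (R : realType) (d : nat)
    (nu : {measure set (skorokhod R d) -> \bar R}) (alpha : R) : Prop :=
  0 < alpha /\
  forall (t : R) A, 0 < t -> measurable A ->
    nu (scaleD t @` A) = ((t `^ (- alpha))%:E * nu A)%E.

Definition tail_process (R : realType) (d : nat) (N : 'rV[R]_d -> R)
    (nu : {measure set (skorokhod R d) -> \bar R})
    (disp : measure_display) (T : measurableType disp) (P : probability T R)
    (Y : {RV P >-> skorokhod R d}) : Prop :=
  forall A, measurable A ->
    distribution P Y A = nu (A `&` [set y | 1 < N (y 0)]).

Definition vanishing (R : realType) (d : nat) (f : R -> 'rV[R]_d) : Prop :=
  f t @[t --> +oo] --> (0 : 'rV[R]_d) /\ f t @[t --> -oo] --> (0 : 'rV[R]_d).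

Record skorokhod0 (R : realType) (d : nat) := Skorokhod0 {
  skorokhod0_val :> skorokhod R d;
  skorokhod0_vanishing : vanishing skorokhod0_val }.

HB.instance Definition _ (R : realType) (d : nat) :=
  gen_eqMixin (skorokhod0 R d).
HB.instance Definition _ (R : realType) (d : nat) :=
  gen_choiceMixin (skorokhod0 R d).

Section elements0.
Context {R : realType} {d : nat}.

Lemma vanishing0 : vanishing (@skorokhod0fun R d).
Proof. by split; exact: cvg_cst. Qed.

Definition D0zero : skorokhod0 R d := Skorokhod0 vanishing0.

Lemma vanishing_restrict (u v : R) (y : skorokhod R d) :
  vanishing (restrictD u v y).
Proof.
split.
- apply: (@cvg_trans _ ((0 : 'rV[R]_d) @[x --> +oo])); last exact: cvg_cst.
  apply: near_eq_cvg; near=> x => /=.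
  have vx : v <= x by near: x; apply: nbhs_pinfty_ge; rewrite num_real.
  by rewrite [x < v]ltNge vx andbF.
- apply: (@cvg_trans _ ((0 : 'rV[R]_d) @[x --> -oo])); last exact: cvg_cst.
  apply: near_eq_cvg; near=> x => /=.
  have xu : x < u by near: x; apply: nbhs_ninfty_lt; rewrite num_real.
  by rewrite leNgt xu.
Unshelve. all: by end_near. Qed.

Definition restrictD0 (u v : R) (y : skorokhod R d) : skorokhod0 R d :=
  Skorokhod0 (vanishing_restrict u v y).

Definition shift_rel (f g : skorokhod0 R d) : bool :=
  `[< exists t : R, f =1 backshift t g >].

Lemma shift_rel_refl : reflexive shift_rel.
Proof. by move=> f; apply/asboolP; exists 0 => s /=; rewrite subr0. Qed.

Lemma shift_rel_sym : symmetric shift_rel.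
Proof.
suff H f g : shift_rel f g -> shift_rel g f by move=> f g; apply/idP/idP; exact: H.
move=> /asboolP[t fg]; apply/asboolP; exists (- t) => s /=.
by rewrite fg /= opprK addrK.
Qed.

Lemma shift_rel_trans : transitive shift_rel.
Proof.
move=> g f h /asboolP[t fg] /asboolP[s gh]; apply/asboolP; exists (t + s) => x.
by rewrite fg /= gh /= opprD addrA.
Qed.

Canonical shift_equiv :=
  EquivRel shift_rel shift_rel_refl shift_rel_sym shift_rel_trans.

End elements0.

Definition time_change (R : realType) : set (R -> R) :=
  [set u | [/\ {homo u : x y / x < y}, continuous u & bijective u]].

Definition d_infty (R : realType) (d : nat) (N : 'rV[R]_d -> R)
    (f g : skorokhod0 R d) : \bar R :=
  ereal_inf [set maxe (sup_on N setT (fun t => f (u t) - g t))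
                      (ereal_sup [set `|u t - t|%:E | t in setT])
            | u in @time_change R].

(* N is a phantom parameter of the type, used by the topology below *)
Definition shiftD0 (R : realType) (d : nat) (N : 'rV[R]_d -> R) : Type :=
  {eq_quot @shift_rel R d}%qT.

Section shift_quotient.
Context {R : realType} {d : nat} (N : 'rV[R]_d -> R).

HB.instance Definition _ := Choice.on (shiftD0 N).
HB.instance Definition _ := EqQuotient.on (shiftD0 N).

Definition shift_class (f : skorokhod0 R d) : shiftD0 N :=
  (\pi_(shiftD0 N) f)%qT.

Definition shift_zero : shiftD0 N := shift_class D0zero.

Definition d_infty_tilde (p q : shiftD0 N) : \bar R :=
  ereal_inf [set d_infty N f g | f in [set f | shift_class f = p]
                               & g in [set g | shift_class g = q]].

(* independent of the representative: see sup_norm_class *)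
Definition sup_norm (q : shiftD0 N) : \bar R := sup_on N setT (repr q).

Lemma sup_norm_class (f : skorokhod0 R d) :
  sup_norm (shift_class f) = sup_on N setT f.
Proof.
rewrite /sup_norm /shift_class.
have /eqmodP/asboolP[t ft] := reprK ((\pi_(shiftD0 N) f)%qT).
rewrite /sup_on; congr ereal_sup; apply/seteqP; split => _ [s _ <-].
  by exists (s - t) => //; rewrite ft.
by exists (s + t) => //; rewrite ft /= addrK.
Qed.

Definition shiftD0_open (U : set (shiftD0 N)) : Prop :=
  forall p, U p -> exists2 e : R, 0 < e &
    forall q, (d_infty_tilde p q < e%:E)%E -> U q.

Lemma shiftD0_openT : shiftD0_open setT.
Proof. by move=> p _; exists 1. Qed.

Lemma shiftD0_openI : setI_closed shiftD0_open.
Proof.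
move=> U V oU oV p [/oU[e e0 eU] /oV[e' e'0 eV]].
exists (Num.min e e'); first by rewrite lt_min e0.
move=> q; rewrite EFin_min lt_min => /andP[qe qe'].
by split; [exact: eU|exact: eV].
Qed.

Lemma shiftD0_open_bigU (I : Type) (U : I -> set (shiftD0 N)) :
  (forall i, shiftD0_open (U i)) -> shiftD0_open (\bigcup_i U i).
Proof.
move=> oU p [i _ /oU[e e0 eU]]; exists e => // q /eU Uq.
by exists i.
Qed.

HB.instance Definition _ := isOpenTopological.Build (shiftD0 N)
  shiftD0_openT shiftD0_openI shiftD0_open_bigU.

Definition test_domain : set (R * shiftD0 N) :=
  [set p | 0 <= p.1 /\ p.2 != shift_zero].

(* f is only meaningful on test_domain; the last clause is the convention that
   empty blocks do not contribute to N_S(f) *)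
Definition test_function (f : R * shiftD0 N -> R) : Prop :=
  [/\ {within test_domain, continuous f},
      (forall p, test_domain p -> 0 <= f p),
      (exists M : R, forall p, test_domain p -> f p <= M),
      (exists A e : R, [/\ 0 < A, 0 < e &
         forall p, test_domain p ->
           A < `|p.1| \/ (sup_norm p.2 <= e%:E)%E -> f p = 0]) &
      forall t, f (t, shift_zero) = 0].

End shift_quotient.

Definition scaling_function (R : realType) (a : R -> R) : Prop :=
  [/\ forall t, 0 <= t -> 0 <= a t,
      forall s t, 0 <= s -> s <= t -> a s <= a t &
      forall M : R, exists2 t, 0 <= t & M < a t].

Section conditions.
Context {disp : measure_display} {T : measurableType disp} {R : realType}.
Context (P : probability T R) {d : nat} (N : 'rV[R]_d -> R).
Context (X : {RV P >-> skorokhod R d}) (a r : R -> R).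

Definition anticlustering : Prop :=
  forall x : R, 0 < x ->
    limf_esup (fun S : R =>
      cond_prob P
        [set w | ((a S * x)%:E <
                  sup_on N [set s | (t <= `|s| <= r S)%R] (X w))%E]
        [set w | a S < N (X w 0)]) +oo
    @[t --> +oo] --> 0%E.

(* X_{S,i} = a_S^{-1} X 1_{[(i-1) r_S, i r_S)} *)
Definition block (S : R) (i : nat) (w : T) : skorokhod0 R d :=
  restrictD0 ((i%:R - 1) * r S) (i%:R * r S) (scaleD (a S)^-1 (X w)).

Definition block_value (f : R * shiftD0 N -> R) (S : R) (i : nat) (w : T) : R :=
  f (i%:R * r S / S, shift_class N (block S i w)).

(* N_S(f), the integral of f against the point process of blocks; the sum has
   finitely many nonzero terms when f is a test function *)
Definition block_process (f : R * shiftD0 N -> R) (S : R) (w : T) : R :=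
  limn (fun n => \sum_(1 <= i < n) block_value f S i w).

Definition block_independence : Prop :=
  forall f : R * shiftD0 N -> R, test_function f ->
    limf_esup (fun S : R =>
      `| fine 'E_P[fun w => expR (- block_process f S w)]
         - limn (fun n => \prod_(1 <= i < n)
                   fine 'E_P[fun w => expR (- block_value f S i w)]) |%:E) +oo
    = 0%E.

End conditions.

(* Main.v *)
Require Import Defs.
From HB Require Import structures.
From mathcomp Require Import all_boot all_order all_algebra.
From mathcomp Require Import all_classical all_reals all_analysis.
From mathcomp Require Import measurable_realfun lra.

Set Implicit Arguments.
Unset Strict Implicit.
Unset Printing Implicit Defensive.

Import Order.TTheory GRing.Theory Num.Theory.
Import numFieldNormedType.Exports.

Local Open Scope classical_set_scope.
Local Open Scope ring_scope.

(** The tail measure nu inherits stationarity.  Integrating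
    1{N (y s) > 1} / (time spent by y above level 1 during [0, b]) over s and
    nu therefore gives
      nu(sup_[0,b] > 1) = int_0^b E[1 / (time spent by Y above 1 during [-s, b - s])] ds,
    which lies between theta b and theta b + o(b).  A block of length r_T is cut
    into pieces of fixed length b: subadditivity bounds the probability that it
    exceeds a_T x from above, and Bonferroni's inequality, with gaps between the
    pieces and anticlustering, bounds it from below (for x >= 1), so that this
    probability is equivalent to theta x^-alpha r_T P(|X_0| > a_T).

    Condition (2), for test functions k * cut(t) * ramp(y^* ), replaces the blocks
    by independent ones.  As r_T P(|X_0| > a_T) is only known to be bounded, the
    probability of a block exceeding a_T x need not be small.  The maximum over
    [0, T] is therefore read at the time scale S = T / A, on the window [0, A S]
    and at the high level a_S z, with A z^-alpha = x^-alpha: single blocks then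
    have small probability and A theta z^-alpha = theta x^-alpha is unaffected. *)

(** Regular variation yields limits only on sets whose J1 frontier is [nu]-null, and no exceedance
    event is known in advance to be one. Events are therefore embedded in families [U e] that shrink
    as [e] grows and are nested through J1 interiors and closures. As [nu (U e)] is monotone in [e],
    a Baire argument finds good parameters in every interval, and the value at a prescribed
    parameter is recovered by a sandwich. The value of a path at a fixed time is not J1-continuous
    either, so statements on X_0 are reached through short windows.

    Anticlustering conditions on |X_0| > a_T, so it is used for exceedances of a_T x with x >= 1
    only; passing to the level z = h^(-1/alpha) >= 1 also brings small x within reach. No regular
    variation of [a] is at hand: a_{AS} x and a_S z are compared through their tail probabilities.
    Boundedness of r_T P(|X_0| > a_T) comes from the lower Bonferroni bound, because a probability
    is at most 1. *)

Lemma natSinv_lt (R : realType) (e : R) : 0 < e -> exists n, n.+1%:R^-1 < e.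
Proof.
move=> e0; have [n _ /(_ n (leqnn _))] := near_infty_natSinv_lt (PosNum e0).
by exists n.
Qed.

(** Baire's theorem for the sets of points inside some interval with property [Q n]: each is open,
    and the hypothesis makes it dense. It serves twice, with small oscillation to find continuity
    points and with small drop of a monotone function to find parameters without a jump. *)
Lemma dense_nested_intervals (R : realType) (Q : nat -> R -> R -> Prop) :
  (forall n l r, l < r -> exists l' r', [/\ l <= l', l' < r', r' <= r & Q n l' r']) ->
  forall a b, a < b ->
    exists2 c, a < c < b & forall n, exists l r, l < c < r /\ Q n l r.
Proof.
move=> H a b ab.
pose U n : set R := [set c | exists l r, l < c < r /\ Q n l r].
have [c [/= cab cU]] : `]a, b[%classic `&` \bigcap_n U n !=set0.
  apply: (@Baire R R); last 2 first.
  - by exists ((a + b) / 2); rewrite /= in_itv/= !midf_lt.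
  - exact: interval_open.
  move=> n; split.
    have -> : U n = \bigcup_(p in [set p : R * R | Q n p.1 p.2]) `]p.1, p.2[%classic.
      apply/seteqP; split => x /=.
        by move=> [l [r [lxr qlr]]]; exists (l, r) => //=; rewrite in_itv.
      by move=> [[l r]] /= qlr; rewrite in_itv/= => lxr; exists l, r.
    by apply: bigcup_open => -[l r] _; exact: interval_open.
  move=> O [x Ox] oO.
  have [e/= e0 eO] : nbhs x O by apply: open_nbhs_nbhs.
  have [|l [r [xl lr rx qlr]]] := H n (x - e / 2) (x + e / 2); first by lra.
  exists ((l + r) / 2); split.
    apply: eO; rewrite /ball/= ltr_norml; apply/andP; split; lra.
  by exists l, r; split => //; lra.
exists c; first by move: cab; rewrite in_itv.
by move=> n; exact: cU.
Qed.

(** Right-continuity at [m] makes the oscillation small on an open interval just after [m], so every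
    interval contains intervals of small oscillation. A point interior to such intervals for all [n]
    is a continuity point. *)
Lemma right_continuous_dense_continuity (R : realType) (V : normedModType R)
    (f : R -> V) (a b : R) :
  (forall t, f x @[x --> t^'+] --> f t) -> a < b ->
  exists2 c, a < c < b & {for c, continuous f}.
Proof.
move=> fr ab.
pose Q n (l r : R) := forall s t, l < s < r -> l < t < r ->
  `|f s - f t| < n.+1%:R^-1.
have [|c cab cQ] := @dense_nested_intervals R Q _ _ _ ab.
  move=> n l r lr; set e : R := n.+1%:R^-1.
  have e0 : 0 < e by rewrite invr_gt0.
  pose m := (l + r) / 2.
  have [d /= d0 dH] : \forall x \near m^'+, `|f m - f x| < e / 2.
    by move/cvgrPdist_lt: (fr m); apply; rewrite divr_gt0.
  have H x : m < x < m + d -> `|f m - f x| < e / 2.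
    move=> /andP[mx xd]; apply: dH => //=; rewrite ltr_norml; apply/andP; split; lra.
  exists m, (Num.min r (m + d)); split; rewrite /m ?le_min ?lt_min ?ge_min ?lexx//.
  - lra.
  - by apply/andP; split; lra.
  move=> s t /andP[ms]; rewrite lt_min => /andP[sr sm] /andP[mt].
  rewrite lt_min => /andP[tr tm].
  have := H s; rewrite /m ms sm => /(_ isT) Hs.
  have := H t; rewrite /m mt tm => /(_ isT) Ht.
  rewrite -[ltRHS]/e (splitr e) (_ : f s - f t = (f m - f t) - (f m - f s)); last first.
    by rewrite opprB [RHS]addrC addrA subrK.
  by rewrite (le_lt_trans (ler_normB _ _))// ltrD.
exists c => //; apply/cvgrPdist_lt => e e0.
have [n _ /(_ n (leqnn _)) ne] := near_infty_natSinv_lt (PosNum e0).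
have [l [r [lcr qlr]]] := cQ n; near=> x.
apply: lt_trans ne => /=; apply: qlr => //; apply/andP; split.
- by near: x; apply: lt_nbhsr; case/andP: lcr.
- by near: x; apply: lt_nbhsl; case/andP: lcr.
Unshelve. all: by end_near. Qed.

(** * Norms and the J1 topology *)

Section norm.
Context {R : realType} {d : nat} (N : 'rV[R]_d -> R) (hN : is_norm N).

Lemma is_norm0 : N 0 = 0.
Proof. by rewrite -(scale0r (0 : 'rV_d)) (is_normZ hN) normr0 mul0r. Qed.

Lemma is_normN v : N (- v) = N v.
Proof. by rewrite -scaleN1r (is_normZ hN) normrN1 mul1r. Qed.

Lemma is_norm_ge0 v : 0 <= N v.
Proof.
have := is_normD hN v (- v); rewrite subrr is_norm0 is_normN; lra.
Qed.

Lemma is_norm_dist v w : `|N v - N w| <= N (v - w).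
Proof.
have := is_normD hN (v - w) w; have := is_normD hN (w - v) v.
rewrite !subrK -opprB is_normN => h1 h2.
by rewrite ler_norml; apply/andP; split; lra.
Qed.

Lemma is_norm_sum n (v : 'I_n -> 'rV[R]_d) :
  N (\sum_i v i) <= \sum_i N (v i).
Proof.
elim/big_ind2: _ => [|x1 x2 y1 y2 h1 h2|//]; first by rewrite is_norm0.
by rewrite (le_trans (is_normD hN _ _))// lerD.
Qed.

(** Expansion in the standard basis bounds [N] by a multiple of the maximum norm. The summand 1
    keeps the constant positive even without coordinates. *)
Lemma is_norm_lipschitz : exists2 C, 0 < C & forall v w, `|N v - N w| <= C * `|v - w|.
Proof.
exists (1 + \sum_i N (delta_mx 0 i)).
  by rewrite ltr_pwDl// sumr_ge0// => i _; exact: is_norm_ge0.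
move=> v w; apply: (le_trans (is_norm_dist _ _)); set u := v - w.
rewrite {1}(row_sum_delta u) mulrDl mul1r.
apply: (le_trans (is_norm_sum _)); rewrite ler_wpDl// mulr_suml ler_sum// => i _.
rewrite (is_normZ hN) mulrC ler_wpM2l ?is_norm_ge0//.
rewrite /Num.norm/= mx_normrE.
by apply: le_trans (le_bigmax _ _ (0, i)).
Qed.

Lemma is_norm_continuous : continuous N.
Proof.
have [C C0 HC] := is_norm_lipschitz.
move=> v; apply/(@cvgrPdist_lt R R _ (nbhs v) _ N (N v)) => e e0; near=> w.
rewrite (le_lt_trans (HC _ _))// mulrC -ltr_pdivlMr//.
near: w; have /(@cvgrPdist_lt R 'rV[R]_d _ (nbhs v) _ id v) : nbhs v --> v by [].
by apply; rewrite divr_gt0.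
Unshelve. all: by end_near. Qed.

End norm.

Section J1.
Context {R : realType} {d : nat} (N : 'rV[R]_d -> R) (hN : is_norm N).
Local Notation D := (skorokhod R d).

Lemma skorokhod_ext (y z : D) : y =1 z -> y = z.
Proof.
case: y z => [f cf] [g cg] /= /funext fg; move: cf; rewrite fg => cf.
by rewrite (Prop_irrelevance cf cg).
Qed.

Lemma scaleDK (c : R) : c != 0 -> cancel (@scaleD R d c) (scaleD c^-1).
Proof. by move=> c0 y; apply: skorokhod_ext => s /=; rewrite scalerA mulVf// scale1r. Qed.

Lemma scaleD_image (c : R) (A : set D) : c != 0 ->
  scaleD c @` A = scaleD c^-1 @^-1` A.
Proof.
move=> c0; apply/seteqP; split => y /=.
  by move=> [z Az <-]; rewrite scaleDK.
by move=> Ay; exists (scaleD c^-1 y) => //; rewrite -{1}(invrK c) scaleDK ?invr_neq0.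
Qed.

Lemma skorokhod_right (y : D) t : N (y x) @[x --> t^'+] --> N (y t).
Proof.
apply: continuous_cvg; first exact: (is_norm_continuous hN).
by have [] := skorokhod_cadlag y t.
Qed.

Lemma skorokhod_dense (y : D) (a b : R) : a < b ->
  exists2 c, a < c < b & {for c, continuous y}.
Proof.
move=> ab; apply: (@right_continuous_dense_continuity R 'rV[R]_d) => // t.
by have [] := skorokhod_cadlag y t.
Qed.

(** The form in which J1 convergence enters exceedance events: values are matched at nearby times,
    in both directions. The window is first enlarged to continuity points of [f], since [J1_cvg]
    speaks of such intervals only; surjectivity of the time change gives the first direction. *)
Lemma J1_cvg_near (F : nat -> D) (f : D) (a b e : R) :
  J1_cvg F f -> 0 < e -> \forall n \near \oo,
    (forall s, a <= s <= b ->
       exists2 t, `|t - s| < e & `|N (F n s) - N (f t)| < e) /\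
    (forall t, a <= t <= b ->
       exists2 s, `|s - t| < e & `|N (F n s) - N (f t)| < e).
Proof.
move=> Ff e0.
have [ab|ba] := leP a b; last first.
  by apply: nearW => n; split => s; lra.
have [a' /andP[_ a'a] ca] := @skorokhod_dense f (a - 1) a ltac:(lra).
have [b' /andP[bb' _] cb] := @skorokhod_dense f b (b + 1) ltac:(lra).
have a'b' : a' < b' by lra.
have [u [hu uid uF]] := Ff a' b' a'b' ca cb.
have [C C0 HC] := is_norm_lipschitz hN.
have h1 : \forall n \near \oo, forall y, a' <= y <= b' -> `|u n y - y| < e.
  have := uid [set h | forall y, `[a', b']%classic y -> ball y e (h y)].
  rewrite /fmap/=.
  case.
    apply/uniform_nbhs; exists [set p | ball p.1 e p.2]; split => //.
    exact: (entourage_ball _ (PosNum e0)).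
  by move=> n _ H; exists n => // m /H /= K y /K; rewrite /ball/= distrC.
have h2 : \forall n \near \oo, forall y, a' <= y <= b' ->
    `|F n (u n y) - f y| < e / C.
  have eC0 : 0 < e / C by rewrite divr_gt0.
  have := uF [set h | forall y, `[a', b']%classic y -> ball (f y) (e / C) (h y)].
  rewrite /fmap/=.
  case.
    apply/uniform_nbhs; exists [set p | ball p.1 (e / C) p.2]; split => //.
    exact: (entourage_ball _ (PosNum eC0)).
  move=> n _ H; exists n => // m /H /= K y /K.
  by rewrite -ball_normE/= distrC.
near=> n.
have hn1 : forall y, a' <= y <= b' -> `|u n y - y| < e by near: n.
have hn2 : forall y, a' <= y <= b' -> `|F n (u n y) - f y| < e / C by near: n.
have hn3 y : a' <= y <= b' -> `|N (F n (u n y)) - N (f y)| < e.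
  by move=> /hn2 h; rewrite (le_lt_trans (HC _ _))// mulrC -ltr_pdivlMr.
split=> [s sab|t tab].
  have [_ [_ _ surj] _] := hu n.
  have /= [|t + <-] := surj s; first by rewrite in_itv/=; lra.
  rewrite in_itv/= => ht; exists t; last exact: hn3.
  by rewrite distrC; exact: hn1.
exists (u n t); [apply: hn1|apply: hn3]; lra.
Unshelve. all: by end_near. Qed.

End J1.

(** * Exceedance events and J1-stable families *)

Section stable.
Context {R : realType} {d : nat} (N : 'rV[R]_d -> R) (hN : is_norm N).
Local Notation D := (skorokhod R d).

(** The open window and the strict inequality make this set J1-open, hence Borel. By
    right-continuity it is also the event of an exceedance during [a, b), see [exc_left]. *)
Definition exc (a b c : R) : set D :=
  [set y | exists2 s, a < s < b & c < N (y s)].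

Lemma J1_open_hit (a b : R) (O : set R) : open O ->
  open [set y : D | exists2 s, a < s < b & O (N (y s))].
Proof.
move=> oO; suff : J1_open [set y : D | exists2 s, a < s < b & O (N (y s))] by [].
move=> F f [s sab Os] Ff.
have [e /= e0 eO] : nbhs (N (f s)) O by apply: open_nbhs_nbhs.
pose h := Num.min e (Num.min (s - a) (b - s)).
have h0 : 0 < h by rewrite /h !lt_min e0; apply/andP; split; lra.
near=> n.
have : (forall t, s <= t <= s ->
    exists2 u, `|u - t| < h & `|N (F n u) - N (f t)| < h).
  by near: n; apply: filterS (J1_cvg_near hN s s Ff h0) => n [].
move=> /(_ s); rewrite lexx => /(_ isT)[u].
rewrite /h !lt_min => /andP[_ /andP[h1 h2]] /andP[h3 _].
exists u; first by move: h1 h2; rewrite !ltr_norml; lra.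
by apply: eO; rewrite /ball/= distrC.
Unshelve. all: by end_near. Qed.

Lemma open_measurable_skorokhod (A : set D) : open A -> measurable A.
Proof. by move=> oA; exact: sub_sigma_algebra. Qed.

Lemma open_exc a b c : open (exc a b c).
Proof. by have := @J1_open_hit a b _ (@open_gt R c). Qed.

Lemma measurable_exc a b c : measurable (exc a b c).
Proof. by apply: open_measurable_skorokhod; exact: open_exc. Qed.

(** By right-continuity an exceedance at [s] persists just after [s], with a margin. The margin
    1/(k+1) is essential: exceedances of [c] itself arbitrarily close to [s] would only give N (y s)
    >= c. Coordinate events are thus built from sets [exc], which matters again for the
    sigma-algebra that these generate. *)
Lemma coord_excE s c : [set y : D | c < N (y s)] =
  \bigcup_k \bigcap_n exc s (s + n.+1%:R^-1) (c + k.+1%:R^-1).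
Proof.
apply/seteqP; split => y /=.
  move=> cy; have y0 : 0 < N (y s) - c by lra.
  have [k _ /(_ k (leqnn _)) /= hk] := near_infty_natSinv_lt (PosNum y0).
  exists k => // n _.
  have h : \forall t \near s^'+, c + k.+1%:R^-1 < N (y t).
    have /cvgrPdist_lt := @skorokhod_right _ _ _ hN y s.
    have e0 : 0 < N (y s) - (c + k.+1%:R^-1) by rewrite opprD addrA subr_gt0.
    move=> /(_ _ e0); apply: filterS => t.
    by move: (k.+1%:R^-1) => q; rewrite ltr_norml; lra.
  near s^'+ => t; exists t; last by near: t.
  apply/andP; split; first by near: t; exact: nbhs_right_gt.
  by near: t; apply: nbhs_right_lt; rewrite ltrDl invr_gt0.
move=> [k _ H]; rewrite ltNge; apply/negP => yc.
have k0 : 0 < k.+1%:R^-1 :> R by rewrite invr_gt0.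
have /cvgrPdist_lt /(_ _ k0) [e /= e0 eH] := @skorokhod_right _ _ _ hN y s.
have [n _ /(_ n (leqnn _)) /= hn] := near_infty_natSinv_lt (PosNum e0).
have [t /andP[st tn] ct] := H n I.
have := eH t; rewrite /ball_/= => /(_ _ st).
have : `|s - t| < e.
  by move: hn tn; move: (n.+1%:R^-1) => q; rewrite ltr_norml; lra.
move=> /[swap] /[apply]; move: ct k0; move: (k.+1%:R^-1) => q.
by rewrite ltr_norml; lra.
Unshelve. all: by end_near. Qed.

Lemma measurable_coord s c : measurable [set y : D | c < N (y s)].
Proof.
rewrite coord_excE; apply: bigcupT_measurable => k.
by apply: bigcapT_measurable => n; exact: measurable_exc.
Qed.

Lemma exc_left (a b c : R) (y : D) :
  (exists2 s, a <= s < b & c < N (y s)) <-> exc a b c y.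
Proof.
split=> [[s /andP[sa sb] cs]|[s /andP[sa sb] cs]]; last first.
  by exists s => //; rewrite ltW.
have : [set y : D | c < N (y s)] y by [].
rewrite coord_excE => -[k _ H].
have e0 : 0 < b - s by lra.
have [n _ /(_ n (leqnn _)) /= hn] := near_infty_natSinv_lt (PosNum e0).
have [t ht ct] := H n I; exists t.
  by move: ht hn; move: (n.+1%:R^-1) => q; lra.
by apply: le_lt_trans ct; rewrite lerDl invr_ge0.
Qed.

(* A family of sets whose members, up to an arbitrarily small change of the
   parameter, are both open and closed for J1. *)
Definition J1_stable (U : R -> set D) : Prop :=
  (forall e e', 0 < e -> e < e' -> U e' `<=` U e) /\
  forall F f e e', J1_cvg F f -> 0 < e -> e < e' ->
    (U e' f -> \forall n \near \oo, U e (F n)) /\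
    (~ U e f -> \forall n \near \oo, ~ U e' (F n)).

(** The union of the [U x] with x > e is open: stability is applied between (e + x) / 2 and x, which
    leaves a parameter still above [e]. *)
Lemma stable_interior U e e' : J1_stable U -> 0 < e -> e < e' ->
  U e' `<=` interior (U e).
Proof.
move=> [aU sU] e0 ee' f Uf.
pose O := \bigcup_(x in [set x | e < x]) U x.
have oO : open O.
  move=> F g [x /= ex Ux] Fg.
  have exm : e < (e + x) / 2 by lra.
  have [H _] := sU F g ((e + x) / 2) x Fg ltac:(lra) ltac:(lra).
  by apply: filterS (H Ux) => n Un; exists ((e + x) / 2).
have : nbhs f O by apply: open_nbhs_nbhs; split => //; exists e'.
by apply: filterS => g [x /= ex]; exact: aU.
Qed.

(** The complements of the [U x] with 0 < x < e' have an open union that misses [U e'] and contains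
    every point outside [U e]. Together with [stable_interior] this confines the frontier of [U e]
    to [U l] minus [U r] for all l < e < r. *)
Lemma stable_closure U e e' : J1_stable U -> 0 < e -> e < e' ->
  closure (U e') `<=` U e.
Proof.
move=> [aU sU] e0 ee' f cf; apply: contrapT => Uf.
pose O := \bigcup_(x in [set x | 0 < x < e']) (~` U x).
have oO : open O.
  move=> F g [x /= /andP[x0 xe'] Ux] Fg.
  have [_ H] := sU F g x ((e' + x) / 2) Fg x0 ltac:(lra).
  by apply: filterS (H Ux) => n Un; exists ((e' + x) / 2) => //=; lra.
have : nbhs f O.
  by apply: open_nbhs_nbhs; split => //; exists e => //=; rewrite e0.
move=> /cf[g [Ug [x /= /andP[x0 xe'] ]]]; apply.
exact: aU Ug.
Qed.

Lemma stable_setI U V : J1_stable U -> J1_stable V ->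
  J1_stable (fun e => U e `&` V e).
Proof.
move=> [aU sU] [aV sV]; split=> [e e' e0 ee'|F f e e' Ff e0 ee'].
  by apply: setISS; [exact: aU|exact: aV].
have [U1 U2] := sU F f e e' Ff e0 ee'; have [V1 V2] := sV F f e e' Ff e0 ee'.
split=> [[/U1 Un /V1 Vn]|/not_andP[/U2|/V2]]; first exact: filterI.
- by apply: filterS => n h [].
- by apply: filterS => n h [].
Qed.

Lemma stable_setU U V : J1_stable U -> J1_stable V ->
  J1_stable (fun e => U e `|` V e).
Proof.
move=> [aU sU] [aV sV]; split=> [e e' e0 ee'|F f e e' Ff e0 ee'].
  by apply: setUSS; [exact: aU|exact: aV].
have [U1 U2] := sU F f e e' Ff e0 ee'; have [V1 V2] := sV F f e e' Ff e0 ee'.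
split=> [[/U1|/V1]|/not_orP[/U2 Un /V2 Vn]].
- by apply: filterS => n h; left.
- by apply: filterS => n h; right.
- by apply: filterS2 Un Vn => n h1 h2 [].
Qed.

Lemma stable_cst (A : Prop) : J1_stable (fun=> [set _ | A]).
Proof.
split=> [e e' _ _ y h|F f e e' _ _ _]; [exact: h|split=> h].
  by apply: nearW => n; exact: h.
by apply: nearW => n; exact: h.
Qed.

(** [p] holds the two window ends and the level. Increasing [e] shortens the window and raises the
    level together, which absorbs a small J1 perturbation in time and in space. *)
Definition exc_family (p : R * R * R) (e : R) : set D :=
  exc (p.1.1 + e) (p.1.2 - e) (p.2 + e).

Lemma stable_exc p : J1_stable (exc_family p).
Proof.
case: p => [[a b] c]; rewrite /exc_family/=.
split=> [e e' e0 ee' y [s sab cs]|F f e e' Ff e0 ee'].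
  by exists s; lra.
have h0 : 0 < e' - e by lra.
split=> [[s sab cs]|nU].
  near=> n.
  have : (forall t, s <= t <= s ->
      exists2 u, `|u - t| < e' - e & `|N (F n u) - N (f t)| < e' - e).
    by near: n; apply: filterS (J1_cvg_near hN s s Ff h0) => n [].
  move=> /(_ s); rewrite lexx => /(_ isT)[u].
  by rewrite !ltr_norml => h1 h2; exists u; lra.
apply: filterS (J1_cvg_near hN a b Ff h0) => n [H _] [s sab cs].
have [t] := H s ltac:(lra); rewrite !ltr_norml => h1 h2.
by apply: nU; exists t; lra.
Unshelve. all: by end_near. Qed.

(** Staying high on a whole neighbourhood is J1-stable, unlike an exceedance at a fixed time. Here
    increasing [e] widens the window and raises the bound. *)
Definition inf_family (a b c e : R) : set D :=
  [set y | forall s, a - e < s < b + e -> c + e <= N (y s)].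

Lemma stable_inf a b c : J1_stable (inf_family a b c).
Proof.
split=> [e e' e0 ee' y H s hs|F f e e' Ff e0 ee'].
  by have := H s; lra.
have h0 : 0 < e' - e by lra.
split=> [H|].
  apply: filterS (J1_cvg_near hN (a - e) (b + e) Ff h0) => n [K _] s hs.
  have [t] := K s ltac:(lra); rewrite !ltr_norml => h1 h2.
  by have := H t; lra.
move=> /existsNP[s /not_implyP[sab /negP]]; rewrite -ltNge => cs.
near=> n.
have : (forall t, s <= t <= s ->
    exists2 u, `|u - t| < e' - e & `|N (F n u) - N (f t)| < e' - e).
  by near: n; apply: filterS (J1_cvg_near hN s s Ff h0) => n [].
move=> /(_ s); rewrite lexx => /(_ isT)[u].
by rewrite !ltr_norml => h1 h2 /(_ u) h3; lra.
Unshelve. all: by end_near. Qed.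

(** The complement, the paths that dip below c + e inside the window, is J1-open. *)
Lemma measurable_inf_family a b c e : measurable (inf_family a b c e).
Proof.
have m : measurable (~` [set y : D |
    exists2 s, a - e < s < b + e & [set x | x < c + e] (N (y s))]).
  apply: measurableC; apply: open_measurable_skorokhod.
  exact: (@J1_open_hit (a - e) (b + e) _ (@open_lt R (c + e))).
congr (measurable _): m; apply/seteqP; split => y /=.
  move=> H s hs; rewrite leNgt; apply/negP => cs; apply: H.
  by exists s.
by move=> H [s /H]; lra.
Qed.

End stable.

Section scaling.
Context {R : realType} {d : nat}.
Local Notation D := (skorokhod R d).

(** For c != 0 the limit keeps its continuity points, so the same time changes serve; uniform
    distances are multiplied by |c|. *)
Lemma J1_cvg_scaleD (c : R) (F : nat -> D) (f : D) : c != 0 ->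
  J1_cvg F f -> J1_cvg (fun n => scaleD c (F n)) (scaleD c f).
Proof.
move=> c0 Ff a b ab ca cb.
have cts x : {for x, continuous (scaleD c f)} -> {for x, continuous f}.
  move=> h; have -> : (f : R -> 'rV[R]_d) = (fun s => c^-1 *: scaleD c f s).
    by apply/funext => s /=; rewrite scalerA mulVf// scale1r.
  exact: cvgZr.
have [u [hu uid uF]] := Ff a b ab (cts _ ca) (cts _ cb).
exists u; split => // A /uniform_nbhs[E [entE EA]].
apply: (uF [set h | A (fun s => c *: h s)]); apply/uniform_nbhs.
have [e /= e0 eE] : exists2 e : R, 0 < e & [set xy | ball xy.1 e xy.2] `<=` E.
  by move: entE; rewrite -entourage_ballE => -[e e0 eE]; exists e.
exists [set p | ball p.1 (e / `|c|) p.2]; split.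
  by apply: (entourage_ball _ (PosNum (divr_gt0 e0 _))); rewrite normr_gt0.
move=> h H; apply: EA => s /H; rewrite /= -!ball_normE/= => hs.
apply: eE; rewrite /= -ball_normE/= -scalerBr normrZ mulrC -ltr_pdivlMr ?normr_gt0//.
Qed.

Lemma measurable_scaleD (c : R) : c != 0 -> measurable_fun setT (@scaleD R d c).
Proof.
move=> c0; apply: (@measurability _ _ D D setT (scaleD c) (@open D) erefl).
move=> _ [A oA <-]; rewrite setTI; apply: open_measurable_skorokhod.
move=> F f /= Af Ff; apply: (oA (fun n => scaleD c (F n)) (scaleD c f)) => //.
exact: J1_cvg_scaleD.
Qed.

Lemma measurable_scaleD_image (c : R) (A : set D) : c != 0 -> measurable A ->
  measurable (scaleD c @` A).
Proof.
move=> c0 mA; rewrite scaleD_image// -[X in measurable X]setTI.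
by apply: measurable_scaleD => //; rewrite invr_eq0.
Qed.

End scaling.

(** Pigeonhole: with K + 1 equal pieces and (K + 1) * e > 1 + m l, a drop of at least [e] on each
    piece would add up to more than [m l]. *)
Lemma antitone_small_drop (R : realType) (m : R -> R) (l r e : R) :
  (forall x, 0 <= m x) -> (forall x y, x <= y -> m y <= m x) -> l < r -> 0 < e ->
  exists l' r', [/\ l <= l', l' < r', r' <= r & m l' - m r' < e].
Proof.
move=> m0 am lr e0.
have [K hK] := natSinv_lt (divr_gt0 e0 (ltr_pwDl ltr01 (m0 l))).
have K0 : 0 < K.+1%:R :> R by [].
pose t (k : nat) := l + (r - l) * (k%:R / K.+1%:R).
have tlt k : t k < t k.+1.
  rewrite /t ltrD2l ltr_pM2l ?subr_gt0// ltr_pM2r ?invr_gt0// ltr_nat.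
  exact: ltnSn.
apply: contrapT => H.
have {}H k : (k < K.+1)%N -> e <= m (t k) - m (t k.+1).
  move=> kK; rewrite leNgt; apply/negP => h; apply: H.
  exists (t k), (t k.+1); split => //.
    by rewrite /t lerDl mulr_ge0 ?divr_ge0 ?ler0n// subr_ge0 ltW.
  rewrite /t -lerBrDl -[leRHS]mulr1 ler_pM2l ?subr_gt0//.
  by rewrite ler_pdivrMr// mul1r ler_nat.
have : K.+1%:R * e <= m l.
  apply: (@le_trans _ _ (\sum_(0 <= k < K.+1) (m (t k) - m (t k.+1)))).
    rewrite mulr_natl -[X in _ *+ X]subn0 -sumr_const_nat.
    rewrite !big_seq; apply: ler_sum => i; rewrite mem_index_iota => /andP[_].
    exact: H.
  under eq_bigr do rewrite -opprB.
  rewrite sumrN telescope_sumr// opprB lerBlDr {1}/t mul0r mulr0 addr0.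
  by rewrite lerDl.
move: hK; rewrite ltr_pdivlMr ?ltr_pwDl//.
rewrite mulrC ltr_pdivrMr// mulrC; lra.
Qed.

Lemma ge0_cvg_fine (R : realType) (T : Type) (F : set_system T) (FF : Filter F)
    (f : T -> \bar R) (l : \bar R) :
  l \is a fin_num -> f x @[x --> F] --> l -> fine (f x) @[x --> F] --> fine l.
Proof. by move=> /fineK <- /fine_cvg. Qed.

Lemma fine_probM (R : realType) (d : measure_display) (T : measurableType d)
    (P : probability T R) (A : set T) (r : R) :
  measurable A -> fine (P A * r%:E)%E = fine (P A) * r.
Proof. by move=> mA; rewrite fineM//= fin_num_measure. Qed.

(** * Stationarity of the tail measure *)

Section tail_measure.
Context {R : realType} {d : nat} (N : 'rV[R]_d -> R) (hN : is_norm N).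
Local Notation D := (skorokhod R d).
Context (nu : {measure set D -> \bar R}).

Lemma B0_exc (a b c : R) (A : set D) : 0 < c -> A `<=` exc N a b c -> B0 N A.
Proof.
(* Ordering the ends covers b < a, where [exc] is empty but [B0] still asks for an interval. *)
move=> c0 Aabc; exists (Num.min a b), (Num.max a b); split.
  by rewrite ge_min le_max lexx.
apply: (@lt_le_trans _ _ c%:E); first by rewrite lte_fin.
apply: le_ereal_inf_tmp => _ [y Ay <-].
have [s sab cs] := Aabc _ Ay.
apply: (@le_trans _ _ (N (y s))%:E); first by rewrite lee_fin ltW.
apply: ereal_sup_ubound; exists s => //=; rewrite in_itv/= ge_min le_max.
by case/andP: sab => /ltW -> /ltW ->; rewrite orbT.
Qed.

Hypothesis hnu : B0_bounded N nu.

Lemma nu_exc_fin a b c : 0 < c -> (nu (exc N a b c) < +oo)%E.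
Proof.
by move=> c0; apply: hnu.2; [exact: (measurable_exc hN)|exact: (B0_exc c0 (@subset_refl _ _))].
Qed.

Lemma frontier_measurable (A : set D) : measurable (frontier A).
Proof.
rewrite /frontier; apply: measurableD.
  rewrite -[closure A]setCK; apply: measurableC.
  by apply: open_measurable_skorokhod; rewrite openC; exact: closed_closure.
by apply: open_measurable_skorokhod; exact: open_interior.
Qed.

(** At a parameter where the monotone function [nu (U e)] does not jump, the frontier lies in
    differences [U l] minus [U r] of measure below 1/(n+1) for every [n]. Baire's argument finds
    such parameters between [e1] and [e2]. *)
Lemma stable_null_frontier (U : R -> set D) : J1_stable U ->
  (forall e, 0 < e -> measurable (U e)) ->
  (forall e, 0 < e -> (nu (U e) < +oo)%E) ->
  forall e1 e2, 0 < e1 -> e1 < e2 ->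
    exists2 e, e1 < e < e2 & nu (frontier (U e)) = 0%E.
Proof.
move=> sU mU fU e1 e2 e10 e12.
(* Truncation at [e1] keeps the parameter positive, where [U] is measurable with finite measure,
   while [m] becomes defined on the whole line. *)
pose g e := Num.max e e1.
have g0 e : 0 < g e by rewrite /g lt_max e10 orbT.
have nufin e : nu (U (g e)) \is a fin_num by rewrite ge0_fin_numE ?fU.
pose m e := fine (nu (U (g e))).
have m0 e : 0 <= m e by exact/fine_ge0/measure_ge0.
have am x y : x <= y -> m y <= m x.
  move=> xy; apply: fine_le => //; apply: le_measure; rewrite ?inE//.
  - exact: mU.
  - exact: mU.
  have := g0 x; have : g x <= g y by rewrite /g ge_max !le_max xy lexx orbT.
  by rewrite le_eqVlt => /predU1P[-> _|h h0]; [exact: subset_refl|exact: (sU.1 _ _ h0 h)].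
have [n l r lr|e /andP[ee1 ee2] eP] := @dense_nested_intervals R
    (fun n l r => m l - m r < n.+1%:R^-1) _ e1 e2 e12.
  by apply: antitone_small_drop => //; rewrite invr_gt0.
exists e; first by rewrite ee1.
have frE n : (nu (frontier (U e)) <= n.+1%:R^-1%:E)%E.
  have [l [r [/andP[le er] /ltW lr]]] := eP n.
  have gr : g r = r by apply/max_idPl; lra.
  have ge : g l < e by rewrite /g gt_max le.
  have UrU : U r `<=` U (g l) by apply: (sU.1 (g l) r) => //; lra.
  have mUr : measurable (U r) by apply: mU; lra.
  apply: (@le_trans _ _ (nu (U (g l) `\` U r))).
    apply: le_measure; rewrite ?inE; first exact: frontier_measurable.
      by apply: measurableD => //; exact: mU.
    move=> y [cy iy]; split; first exact: (stable_closure sU (g0 l) ge).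
    by move=> Ur; apply: iy; apply: stable_interior Ur => //; lra.
  rewrite measureD ?setIidr//; [|exact: mU|exact: fU].
  rewrite /=; have -> : nu (U (g l)) = (m l)%:E by rewrite /m fineK.
  have -> : nu (U r) = (m r)%:E by rewrite /m gr fineK// -gr.
  by rewrite -EFinB lee_fin.
apply/eqP; rewrite eq_le measure_ge0 andbT; apply/lee_addgt0Pr => h h0.
have [n hn] := natSinv_lt h0.
by rewrite add0e (le_trans (frE n))// lee_fin ltW.
Qed.

End tail_measure.

(** * Limits along stable families and shift invariance of [nu] *)

Section regular_variation.
Context {R : realType} {d : nat} (N : 'rV[R]_d -> R) (hN : is_norm N).
Local Notation D := (skorokhod R d).
Context (nu : {measure set D -> \bar R}).
Context (disp : measure_display) (Omega : measurableType disp)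
  (P : probability Omega R) (X : {RV P >-> D}).
Hypotheses (hstat : stationary X) (hrv : regularly_varying N X nu).

Definition tailR x := fine (tail_prob N X x).
Definition probD (u : R) (A : set D) := fine (P (X @^-1` (scaleD u @` A))).

Hypothesis tail_gt0 : forall x, 0 < tailR x.

Let hnu : B0_bounded N nu. Proof. by case: hrv. Qed.

Lemma measurable_preimage (A : set D) : measurable A -> measurable (X @^-1` A).
Proof. by move=> mA; rewrite -[X in measurable X]setTI; apply: (@measurable_funPT _ _ _ _ X). Qed.

Lemma tail_probE x : tail_prob N X x = (tailR x)%:E.
Proof.
rewrite fineK// fin_num_measure//.
by have := measurable_preimage (measurable_coord hN 0 x).
Qed.

(** Regular variation is applied at a parameter with null frontier, available between any two
    positive ones. Inclusion in an [exc] of positive level is what bounds the sets away from the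
    null path. *)
Lemma stable_limit (U : R -> set D) (a b c : R) : J1_stable U -> 0 < c ->
  (forall e, 0 < e -> measurable (U e)) -> (forall e, 0 < e -> U e `<=` exc N a b c) ->
  forall e1 e2, 0 < e1 -> e1 < e2 ->
    exists2 e, e1 < e < e2 &
      probD u (U e) / tailR u @[u --> +oo] --> fine (nu (U e)).
Proof.
move=> sU c0 mU Uabc e1 e2 e10 e12.
have fU e : 0 < e -> (nu (U e) < +oo)%E.
  move=> e0; apply: le_lt_trans (nu_exc_fin hN hnu a b c0).
  by apply: le_measure; rewrite ?inE; [exact: mU|exact: (measurable_exc hN)|exact: Uabc].
have [e ee ve] := stable_null_frontier sU mU fU e10 e12.
have e0 : 0 < e by lra.
exists e => //.
have [_ _ /(_ (U e) (mU e e0) (B0_exc c0 (Uabc e e0)) ve)] := hrv.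
move=> /ge0_cvg_fine; rewrite ge0_fin_numE// fU// => /(_ isT).
apply: cvg_trans; apply: near_eq_cvg; near=> u.
have u0 : u != 0 by rewrite gt_eqF//; near: u; exact: nbhs_pinfty_gt.
rewrite tail_probE inver gt_eqF// fine_probM//.
by apply: measurable_preimage; apply: measurable_scaleD_image => //; exact: mU.
Unshelve. all: by end_near. Qed.

(** Finite intersections of exceedance events, perturbed together: at e = 0 they form a pi-system
    stable under time shifts. *)
Definition excs (l : seq (R * R * R)) (e : R) : set D :=
  foldr (fun p A => exc_family N p e `&` A) setT l.

Lemma excs_cat l l' e : excs (l ++ l') e = excs l e `&` excs l' e.
Proof.
elim: l => [|p l IH]; first by rewrite setTI.
by rewrite -setIA -IH.
Qed.

Lemma stable_excs l : J1_stable (excs l).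
Proof.
elim: l => [|p l IH]; first exact: (stable_cst True).
exact: (stable_setI (stable_exc hN p) IH).
Qed.

Lemma measurable_exc_family p e : measurable (exc_family N p e).
Proof. exact: (measurable_exc hN). Qed.

Lemma measurable_excs l e : measurable (excs l e).
Proof.
elim: l => [|p l IH]; first exact: measurableT.
exact: (measurableI _ _ (measurable_exc_family p e) IH).
Qed.

Lemma exc_family_anti p x y : x <= y -> exc_family N p y `<=` exc_family N p x.
Proof. by move=> xy z [s hs cs]; exists s; [move: hs|]; lra. Qed.

Lemma excs_anti l x y : x <= y -> excs l y `<=` excs l x.
Proof.
move=> xy; elim: l => [//|p l IH].
by apply: setISS => //; exact: exc_family_anti.
Qed.

(** The strict inequalities of finitely many exceedances leave a common positive slack. *)
Lemma excs0E l : excs l 0 = \bigcup_n excs l n.+1%:R^-1.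
Proof.
apply/seteqP; split => [|y [n _]]; last by apply: excs_anti; rewrite invr_ge0.
elim: l => [|[[a b] c] l IH] y; first by exists 0%N.
move=> [[s /= sab cs] /IH [n _ ny]].
have e0 : 0 < Num.min (Num.min (s - a) (b - s)) (Num.min (N (y s) - c) (n.+1%:R^-1)).
  by rewrite !lt_min invr_gt0 ltr0Sn andbT; apply/andP; split;[apply/andP; split|]; lra.
have [m] := natSinv_lt e0; rewrite !lt_min => /andP[/andP[ma mb] /andP[mc mn]].
exists m => //; split; last by apply: excs_anti ny; exact: ltW.
by exists s; move: ma mb mc; rewrite /=; move: (m.+1%:R^-1) => q; lra.
Qed.

Definition shift3 (t : R) (p : R * R * R) : R * R * R :=
  (p.1.1 - t, p.1.2 - t, p.2).

Lemma exc_backshift t a b c :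
  backshift t @^-1` (exc N a b c) = exc N (a - t) (b - t) c.
Proof.
apply/seteqP; split => y [s sab cs].
  by exists (s - t) => //; lra.
by exists (s + t); rewrite /= ?addrK//; lra.
Qed.

Lemma excs_backshift t l e :
  backshift t @^-1` (excs l e) = excs (map (shift3 t) l) e.
Proof.
elim: l => [|p l IH]; first by rewrite preimage_setT.
rewrite /= preimage_setI IH; congr (_ `&` _).
rewrite /exc_family exc_backshift; congr (exc _ _ _ _); rewrite /=; lra.
Qed.

Lemma scaleD_exc u a b c : 0 < u ->
  scaleD u @` exc N a b c = exc N a b (u * c).
Proof.
move=> u0; rewrite scaleD_image ?gt_eqF//.
apply/seteqP; split => y [s sab]; rewrite /= ?(is_normZ hN) ?gtr0_norm ?invr_gt0//.
  by rewrite mulrC ltr_pdivlMr// mulrC => cs; exists s.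
by move=> cs; exists s; rewrite //= (is_normZ hN) gtr0_norm ?invr_gt0// mulrC ltr_pdivlMr// mulrC.
Qed.

Lemma probD_shift t u A : 0 < u -> measurable (scaleD u @` A) ->
  probD u (backshift t @^-1` A) = probD u A.
Proof.
move=> u0 mA; rewrite /probD; congr fine; rewrite -(hstat t mA); congr (P _).
rewrite !scaleD_image ?gt_eqF//.
by apply/seteqP; split => w /=; congr (A _); exact: skorokhod_ext.
Qed.

(** Before the limit, stationarity of X equates the probabilities of an event and of its shift. The
    good parameters of the two families may differ, so one takes f2 < f1 and obtains an inequality
    only; monotone continuity then reaches e = 0. The head [p] of positive level keeps the sets
    within [B0]. Shifting back by [- t] gives the converse in [nu_excs_shift]. *)
Lemma nu_excs_le (t : R) (p : R * R * R) l : 0 < p.2 ->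
  (nu (excs (p :: l) 0) <= nu (excs (map (shift3 t) (p :: l)) 0))%E.
Proof.
move=> p0; set l1 := p :: l; set l2 := map _ _.
have fin (q : R * R * R) l' (e : R) : 0 < q.2 -> 0 <= e -> nu (excs (q :: l') e) \is a fin_num.
  move=> q0 e0; rewrite ge0_fin_numE//.
  apply: le_lt_trans (nu_exc_fin hN hnu (q.1.1 + e) (q.1.2 - e) (_ : 0 < q.2 + e)).
    apply: le_measure; rewrite ?inE; first exact: measurable_excs.
      exact: (measurable_exc hN).
    exact: subIsetl.
  lra.
have key (e : R) : 0 < e -> (nu (excs l1 e) <= nu (excs l2 0))%E.
  move=> e0.
  have H l' (q : R * R * R) : 0 < q.2 -> forall e1 e2, 0 < e1 -> e1 < e2 ->
    exists2 e, e1 < e < e2 & probD u (excs (q :: l') e) / tailR u @[u --> +oo] -->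
      fine (nu (excs (q :: l') e)).
    move=> q0; apply: (@stable_limit _ q.1.1 q.1.2 q.2) => //.
    - exact: stable_excs.
    - by move=> *; exact: measurable_excs.
    - move=> e' e'0 y [[s sab cs] _]; exists s; lra.
  have [f2 /andP[f20 f2e] h2] := H (map (shift3 t) l) (shift3 t p) p0 (e / 4) (e / 2) ltac:(lra) ltac:(lra).
  have [f1 /andP[f1e f1e'] h1] := H l p p0 f2 e ltac:(lra) ltac:(lra).
  apply: (@le_trans _ _ (nu (excs l1 f1))).
    apply: le_measure; rewrite ?inE; try exact: measurable_excs.
    by apply: excs_anti; lra.
  apply: (@le_trans _ _ (nu (excs l2 f2))); last first.
    apply: le_measure; rewrite ?inE; try exact: measurable_excs.
    by apply: excs_anti; lra.
  have F1 : nu (excs l1 f1) \is a fin_num by apply: fin => //; lra.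
  have F2 : nu (excs l2 f2) \is a fin_num by apply: (fin (shift3 t p)) => //; lra.
  rewrite -(fineK F1) -(fineK F2) lee_fin; apply: ler_cvg_to h1 h2 _; near=> u.
  have u0 : 0 < u by near: u; exact: nbhs_pinfty_gt.
  have mul l' f : measurable (scaleD u @` excs l' f).
    by apply: measurable_scaleD_image; rewrite ?gt_eqF//; exact: measurable_excs.
  rewrite ler_pM2r ?invr_gt0// -(@probD_shift t)// excs_backshift.
  apply: fine_le; rewrite ?fin_num_measure//; try exact: measurable_preimage.
  apply: le_measure; rewrite ?inE; try exact: measurable_preimage.
  by move=> w [y Ay yw]; exists y => //; apply: excs_anti Ay; lra.
rewrite excs0E.
have /cvg_lim <- // : (nu \o (fun n => excs l1 n.+1%:R^-1)) n @[n --> \oo] -->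
    nu (\bigcup_n excs l1 n.+1%:R^-1).
  apply: nondecreasing_cvg_mu.
  - by move=> n; exact: measurable_excs.
  - by apply: bigcupT_measurable => n; exact: measurable_excs.
  - move=> m n mn; apply/subsetPset/excs_anti.
    by rewrite lef_pV2 ?posrE// ler_nat.
apply: lime_le; last by apply: nearW => n; apply: key; rewrite invr_gt0.
apply: ereal_nondecreasing_is_cvgn => m n mn; apply: le_measure; rewrite ?inE; try exact: measurable_excs.
by apply: excs_anti; rewrite lef_pV2 ?posrE// ler_nat.
Unshelve. all: by end_near. Qed.

Lemma nu_excs_shift (t : R) (p : R * R * R) l : 0 < p.2 ->
  nu (backshift t @^-1` (excs (p :: l) 0)) = nu (excs (p :: l) 0).
Proof.
move=> p0; apply/eqP; rewrite eq_le excs_backshift nu_excs_le// andbT.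
apply: le_trans (nu_excs_le (- t) _ _) _ => //.
have sK : cancel (shift3 t) (shift3 (- t)).
  by move=> [[a b] c]; rewrite /shift3/= !opprK !subrK.
by rewrite map_cons sK (mapK sK).
Qed.

End regular_variation.

Lemma ge0_integral_full (d : measure_display) (T : measurableType d) (R : realType)
    (mu : {measure set T -> \bar R}) (A : set T) (f : T -> \bar R) :
  measurable A -> measurable_fun setT f -> (forall x, 0 <= f x)%E ->
  mu (~` A) = 0%E -> (\int[mu]_x f x = \int[mu]_(x in A) f x)%E.
Proof.
move=> mA mf f0 A0; have mAC := measurableC mA.
rewrite -(setUv A) ge0_integral_setU//.
- rewrite (null_set_integral mAC _ A0) ?adde0//; exact: measurable_funTS.
- by rewrite setUv.
- by apply/disj_setPS => x [].
Qed.

(** * From the tail measure to the tail process *)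

Section transfer.
Context {R : realType} {d : nat} (N : 'rV[R]_d -> R) (hN : is_norm N).
Local Notation D := (skorokhod R d).
Context (nu : {measure set D -> \bar R}).
Context (disp : measure_display) (Omega : measurableType disp)
  (P : probability Omega R) (X : {RV P >-> D}).
Hypotheses (hstat : stationary X) (hrv : regularly_varying N X nu).
Hypothesis tail_gt0 : forall x, 0 < tailR N X x.
Context (disp' : measure_display) (Omega' : measurableType disp')
  (P' : probability Omega' R) (Y : {RV P' >-> D}).
Hypothesis hY : tail_process N nu Y.

(** The pi-system on which shift invariance of [nu] is known. [DG] below is path space with the
    sigma-algebra that it generates, the one for which integrands against [nu] are shown
    measurable. *)
Definition exc_system : set (set D) := [set excs N l 0 | l in setT].

Local Notation DG := (g_sigma_algebraType exc_system).

Lemma exc_system_exc a b c : exc_system (exc N a b c).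
Proof.
by exists [:: (a, b, c)] => //; rewrite /= setIT /exc_family/= subr0 !addr0.
Qed.

Lemma exc_systemI : setI_closed exc_system.
Proof. by move=> _ _ [l _ <-] [l' _ <-]; exists (l ++ l') => //; exact: excs_cat. Qed.

Lemma measurable_exc_system : <<s exc_system >> `<=` @measurable _ D.
Proof.
apply: smallest_sub; first exact: sigma_algebra_measurable.
by move=> _ [l _ <-]; exact: measurable_excs.
Qed.

Lemma measurable_toDG d0 (T : measurableType d0) (Z : T -> D) :
  (forall a b c, measurable (Z @^-1` exc N a b c)) ->
  measurable_fun setT (Z : T -> DG).
Proof.
move=> mZ; apply: (@measurability _ _ _ DG setT Z exc_system erefl).
move=> _ [_ [l _ <-] <-]; rewrite setTI.
elim: l => [|p l IH]; first by rewrite preimage_setT; exact: measurableT.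
by rewrite /= preimage_setI; apply: measurableI => //; exact: mZ.
Qed.

Lemma measurable_id_toDG : measurable_fun setT (idfun : D -> DG).
Proof. by apply: measurable_toDG => a b c; exact: (measurable_exc hN). Qed.

Lemma measurable_backshift_toDG t : measurable_fun setT (backshift t : D -> DG).
Proof.
apply: measurable_toDG => a b c.
by rewrite exc_backshift; exact: (measurable_exc hN).
Qed.

Lemma measurable_coord_DG s c : <<s exc_system >> [set y : D | c < N (y s)].
Proof.
rewrite coord_excE//; apply: (@bigcupT_measurable _ DG) => k.
apply: (@bigcapT_measurable _ DG) => n.
by apply: sub_sigma_algebra; exact: exc_system_exc.
Qed.

(** Uniqueness of measures on a pi-system is applied to finite measures, so [nu] is restricted to
    [V] on one side and to the shift of [V] on the other. The window (-1, 1) and the level 1/2 make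
    [V] contain {N (y 0) > 1}. *)
Lemma nu_shift_invariant t A : <<s exc_system >> A -> A `<=` exc N (-1) 1 2^-1 ->
  nu (backshift t @^-1` A) = nu A.
Proof.
move=> sA AV.
have vE : exc N (-1) 1 2^-1 = excs N [:: (-1, 1, 2^-1)] 0.
  by rewrite /= setIT /exc_family/= subr0 !addr0.
set V := exc N (-1) 1 2^-1 in AV vE *.
have mV : measurable V by exact: (measurable_exc hN).
have mV' : measurable (backshift t @^-1` V).
  by rewrite exc_backshift; exact: (measurable_exc hN).
pose m1 := measure_function_pushforward__canonical__measure_function_Measure
  (mrestr nu mV) measurable_id_toDG.
pose m2 := measure_function_pushforward__canonical__measure_function_Measure
  (mrestr nu mV') (measurable_backshift_toDG t).
have half0 : 0 < 2^-1 :> R by rewrite invr_gt0.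
have : m1 A = m2 A.
  apply: (@g_sigma_algebra_measure_unique _ _ DG exc_system _ (fun=> setT)) => //.
  - by move=> B; exact: sub_sigma_algebra.
  - by move=> _; exists [::].
  - by rewrite bigcup_const.
  - exact: exc_systemI.
  - move=> _ [l _ <-]; rewrite -[LHS]/(nu (excs N l 0 `&` V)).
    rewrite -[RHS]/(nu (backshift t @^-1` (excs N l 0 `&` V))).
    (* Intersecting with [V] puts a positive level at the head of the list, as [nu_excs_shift]
       requires. *)
    have -> : excs N l 0 `&` V = excs N ((-1, 1, 2^-1) :: l) 0.
      by rewrite vE setIC -excs_cat.
    by rewrite (nu_excs_shift hN hstat hrv tail_gt0).
  - move=> _; rewrite /m1 /= /pushforward /mrestr preimage_setT setTI.
    by apply: nu_exc_fin => //; case: hrv.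
rewrite /m1 /m2 /= /pushforward /mrestr /= => mA.
rewrite setIidl// in mA; rewrite mA -preimage_setI.
by rewrite (setIidl AV).
Qed.

(** Shift invariance moves the exceedance from time [s] to time 0, where the restriction of [nu] is
    the law of Y. *)
Lemma nu_coord_shift s A : <<s exc_system >> A -> A `<=` [set y | 1 < N (y s)] ->
  nu A = P' [set w | A (backshift s (Y w))].
Proof.
move=> sA As.
pose B := [set y : D | A (backshift s y)].
have mB : <<s exc_system >> B.
  have mb : measurable_fun setT (backshift s : DG -> DG).
    apply: measurable_toDG => a b c; rewrite exc_backshift.
    by apply: sub_sigma_algebra; exact: exc_system_exc.
  by rewrite -[B]setTI; exact: mb.
have B0 : B `<=` [set y | 1 < N (y 0)].
  by move=> y /As; rewrite /= subrr.
have BV : B `<=` exc N (-1) 1 2^-1.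
  move=> y /B0 /= y0; exists 0; last by lra.
  by apply/andP; split; lra.
have -> : A = backshift (- s) @^-1` B.
  apply/seteqP; split => y; rewrite /B/=.
    by congr (A _); apply: skorokhod_ext => u /=; rewrite opprK subrK.
  by congr (A _); apply: skorokhod_ext => u /=; rewrite opprK subrK.
rewrite nu_shift_invariant//.
have := hY (measurable_exc_system mB); rewrite setIidl// => <-.
rewrite /distribution /pushforward; congr (P' _).
by apply/seteqP; split => w; rewrite /B/=; congr (A _);
  apply: skorokhod_ext => u /=; rewrite opprK subrK.
Qed.

Lemma nu_integral_shift s (h : DG -> \bar R) :
  measurable_fun setT h -> (forall y, 0 <= h y)%E ->
  (\int[nu]_(y in [set y | (1 < N (y s))%R]) h y =
   \int[P']_w h (backshift s (Y w)))%E.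
Proof.
move=> mh h0.
have mYs : measurable_fun setT ((fun w => backshift s (Y w)) : Omega' -> DG).
  apply: measurable_toDG => a b c.
  have := @measurable_preimage _ _ _ _ P' Y _ (measurable_exc hN (a - s) (b - s) c).
  by rewrite -exc_backshift.
have mC : @measurable _ DG [set y | 1 < N (y s)] by exact: measurable_coord_DG.
pose m1 := measure_function_pushforward__canonical__measure_function_Measure
  nu measurable_id_toDG.
pose m2 := measure_function_pushforward__canonical__measure_function_Measure
  P' mYs.
have H : (\int[m1]_(y in [set y | (1 < N (y s))%R]) h y =
          \int[m2]_(y in [set y | (1 < N (y s))%R]) h y)%E.
  by apply: eq_measure_integral => A mA As; exact: nu_coord_shift.
transitivity (\int[m1]_(y in [set y | (1 < N (y s))%R]) h y)%E.
  rewrite (ge0_integral_pushforward measurable_id_toDG)//.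
  exact: measurable_funTS.
rewrite H (ge0_integral_pushforward mYs)//; last exact: measurable_funTS.
have mC0 : measurable [set w | 1 < N (Y w 0)].
  exact: (@measurable_preimage _ _ _ _ P' Y _ (measurable_coord hN 0 1)).
rewrite [RHS](ge0_integral_full mC0)//=; last first.
- have := hY (measurableC (measurable_coord hN 0 1)).
  by rewrite /distribution /pushforward setICl measure0.
- exact: measurableT_comp mh mYs.
congr (integral _ _ _); apply/seteqP; split => w /=; by rewrite subrr.
Qed.

End transfer.

(** * Exceedance times and the extremal index *)

Section occupation.
Context {R : realType} {d : nat} (N : 'rV[R]_d -> R) (hN : is_norm N).
Local Notation D := (skorokhod R d).
Local Notation mu := (@lebesgue_measure R).

(** Right-continuity reduces the exceedance to countably many conditions at rational times. Each of
    them couples an event on the path with an interval of values of [s], which gives joint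
    measurability in path and time. *)
Lemma exceed_rationalE (y : D) s : 1 < N (y s) <->
  exists k n, forall q : rat, s < ratr q < s + n.+1%:R^-1 ->
    1 + k.+1%:R^-1 < N (y (ratr q)).
Proof.
split=> [ys|[k [n H]]].
  have [k hk] : exists k, k.+1%:R^-1 < N (y s) - 1 by apply: natSinv_lt; lra.
  have h : \forall t \near s^'+, 1 + k.+1%:R^-1 < N (y t).
    have /cvgrPdist_lt := @skorokhod_right _ _ _ hN y s.
    have e0 : 0 < N (y s) - (1 + k.+1%:R^-1) by rewrite opprD addrA subr_gt0.
    move=> /(_ _ e0); apply: filterS => t.
    by move: (k.+1%:R^-1) => q; rewrite ltr_norml; lra.
  have [e /= e0 eH] := h.
  have [n hn] := natSinv_lt e0.
  exists k, n => q /andP[sq qs]; apply: eH => //=.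
  by move: hn qs; move: (n.+1%:R^-1) => u; rewrite ltr_norml; lra.
have k0 : 0 < k.+1%:R^-1 :> R by rewrite invr_gt0.
rewrite ltNge; apply/negP => ys.
have /cvgrPdist_lt /(_ _ k0) [e /= e0 eH] := @skorokhod_right _ _ _ hN y s.
have n0 : 0 < Num.min n.+1%:R^-1 e by rewrite lt_min e0 invr_gt0 ltr0Sn.
have [q] : exists q, ratr q \in `]s, (s + Num.min n.+1%:R^-1 e)[.
  by apply: rat_in_itvoo; rewrite ltrDl.
rewrite in_itv/= => /andP[sq]; rewrite -ltrBlDl lt_min => /andP[qn qe].
have := H q; rewrite sq -ltrBlDl qn => /(_ isT).
have := eH (ratr q); rewrite /ball_/= => /(_ _ sq).
have -> : `|s - ratr q| < e by rewrite ltr_norml; lra.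
move=> /(_ isT); move: k0; move: (k.+1%:R^-1) => u; rewrite ltr_norml; lra.
Qed.

Definition occ (a b : R) (y : D) : \bar R :=
  mu ([set s | 1 < N (y s)] `&` `[a, b[%classic).

Section joint.
Context (disp : measure_display) (T : measurableType disp) (Z : T -> D).
Hypothesis mZ : forall s c, measurable [set w | c < N (Z w s)].

Lemma measurable_exceed :
  measurable [set p : T * measurableTypeR R | 1 < N (Z p.1 p.2)].
Proof.
have -> : [set p : T * measurableTypeR R | 1 < N (Z p.1 p.2)] =
  \bigcup_k \bigcup_n ~` \bigcup_(q : rat) (
    (~` [set w | 1 + k.+1%:R^-1 < N (Z w (ratr q))]) `*`
    [set s : R | s < ratr q < s + n.+1%:R^-1]).
  apply/seteqP; split => -[w s] /=.
    move=> /exceed_rationalE[k [n H]]; exists k => //; exists n => // -[q _] [/= h1 h2].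
    exact/h1/H.
  move=> [k _ [n _ H]]; apply/exceed_rationalE; exists k, n => q hq.
  by apply: contrapT => h; apply: H; exists q.
apply: bigcupT_measurable => k; apply: bigcupT_measurable => n.
apply: measurableC; apply: bigcupT_measurable_rat => q.
apply: measurableX; first exact/measurableC/mZ.
have -> : [set s : R | s < ratr q < s + n.+1%:R^-1] =
    `](ratr q - n.+1%:R^-1), (ratr q)[%classic.
  by apply/seteqP; split => s /=; rewrite in_itv/= ltrBlDr andbC.
exact: measurable_itv.
Qed.

Lemma measurable_exceed_itv a b :
  measurable ([set p : T * measurableTypeR R | 1 < N (Z p.1 p.2)] `&`
              (setT `*` `[a, b[%classic)).
Proof.
apply: measurableI; first exact: measurable_exceed.
by apply: measurableX => //; exact: measurable_itv.
Qed.

Lemma measurable_occ a b : measurable_fun setT (fun w => occ a b (Z w)).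
Proof.
have := @measurable_fun_xsection _ _ _ _ _ mu _ (measurable_exceed_itv a b).
congr measurable_fun; apply/funext => w /=; congr (mu _).
by apply/seteqP; split => s; rewrite /xsection/= inE /=; tauto.
Qed.

End joint.

Lemma measurable_exceed_path (y : D) : measurable [set s : measurableTypeR R | 1 < N (y s)].
Proof.
have m : measurable [set p : unit * measurableTypeR R | 1 < N (y p.2)].
  apply: (@measurable_exceed _ unit (fun=> y)) => s c.
  have [h|h] := boolP (c < N (y s)); [rewrite (_ : mkset _ = setT)|rewrite (_ : mkset _ = set0)] => //.
  - by apply/seteqP; split.
  - by apply/seteqP; split.
have := @measurable_xsection _ _ unit (measurableTypeR R) _ tt m.
congr measurable.
by apply/seteqP; split => s; rewrite /xsection/= inE.
Qed.

Lemma measurable_exceed_path_itv (y : D) (a b : R) :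
  measurable ([set s : measurableTypeR R | 1 < N (y s)] `&` `[a, b[%classic).
Proof.
by apply: measurableI; [exact: measurable_exceed_path|exact: measurable_itv].
Qed.

Lemma exceedance_timeE y : exceedance_time N y = mu [set s | 1 < N (y s)].
Proof.
rewrite /exceedance_time integral_indic ?setIT//; exact: measurable_exceed_path.
Qed.

Lemma occ_le a b a' b' y : a' <= a -> b <= b' -> (occ a b y <= occ a' b' y)%E.
Proof.
move=> aa bb; apply: le_measure; rewrite ?inE; try exact: measurable_exceed_path_itv.
by apply: setIS => s /=; rewrite !in_itv/= => h; lra.
Qed.

Lemma occ_le_exceedance a b y : (occ a b y <= exceedance_time N y)%E.
Proof.
rewrite exceedance_timeE; apply: le_measure; rewrite ?inE.
- exact: measurable_exceed_path_itv.
- exact: measurable_exceed_path.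
exact: subIsetl.
Qed.

(** The translated measure has the right values on half-open intervals, which characterises Lebesgue
    measure. *)
Lemma lebesgue_measure_translate (s : R) (A : set (measurableTypeR R)) : measurable A ->
  mu ((fun x => x - s) @^-1` A) = mu A.
Proof.
move=> mA.
have ms : measurable_fun setT ((fun x => x - s) : measurableTypeR R -> measurableTypeR R).
  by apply: measurable_funB => //; exact: measurable_cst.
pose m2 := measure_function_pushforward__canonical__measure_function_Measure mu ms.
have := @lebesgue_measure_unique R m2 _ A mA; rewrite /m2/= /pushforward => -> //.
move=> _ [[a b] _ <-] /=.
rewrite (_ : _ @^-1` _ = `](a + s), (b + s)]%classic); last first.
  by apply/seteqP; split => x /=; rewrite !in_itv/= ltrBrDr lerBlDr.
by rewrite !lebesgue_measure_itv/= !lte_fin ltrD2r -EFinB -EFinB opprD addrACA subrr addr0.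
Qed.

Lemma occ_backshift s a b y : occ a b (backshift s y) = occ (a - s) (b - s) y.
Proof.
rewrite /occ -[RHS](lebesgue_measure_translate s); last exact: measurable_exceed_path_itv.
congr (mu _); apply/seteqP; split => u /=; rewrite !in_itv/=.
  by move=> [h1 h2]; split => //; lra.
by move=> [h1 h2]; split => //; lra.
Qed.

Lemma occ_fin a b y : occ a b y \is a fin_num.
Proof.
rewrite ge0_fin_numE//; apply: (@le_lt_trans _ _ (mu `[a, b[%classic)).
  apply: le_measure; rewrite ?inE; [exact: measurable_exceed_path_itv|exact: measurable_itv|].
  exact: subIsetr.
by rewrite lebesgue_measure_itv/=; case: ifPn => // _; rewrite -EFinB ltry.
Qed.

(** By right-continuity an exceedance inside the window lasts for a positive time. *)
Lemma occ_gt0 a b y : exc N a b 1 y -> (0 < occ a b y)%E.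
Proof.
move=> [s /andP[sa sb] ys].
have : [set y : D | 1 < N (y s)] y by [].
rewrite coord_excE//= => -[k _ H].
have /cvgrPdist_lt /(_ (N (y s) - 1)) := @skorokhod_right _ _ _ hN y s.
rewrite subr_gt0 => /(_ ys)[e /= e0 eH].
pose h := Num.min e (b - s).
have h0 : 0 < h by rewrite lt_min e0 subr_gt0.
apply: (@lt_le_trans _ _ (mu `]s, (s + h)[%classic)).
  by rewrite lebesgue_measure_itv/= lte_fin ltrDl h0 -EFinB lte_fin; lra.
apply: le_measure; rewrite ?inE; [exact: measurable_itv|exact: measurable_exceed_path_itv|].
move=> u /=; rewrite !in_itv/= => /andP[su]; rewrite -ltrBlDl /h lt_min => /andP[ue ub].
split; last by lra.
have := eH u; rewrite /ball_/= => /(_ _ su).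
have -> : `|s - u| < e by rewrite ltr_norml; lra.
by move=> /(_ isT); rewrite ltr_norml; lra.
Qed.

Lemma occ_exc0 a b y : ~ exc N a b 1 y -> occ a b y = 0%E.
Proof.
move=> h; rewrite /occ (_ : _ `&` _ = set0) ?measure0//.
rewrite -subset0 => s /= [ys]; rewrite in_itv/= => sab.
by apply: h; apply/(exc_left hN); exists s.
Qed.

(** Where no time is spent above level 1 the convention 0 * +oo = 0 gives 0; elsewhere [occ] is
    positive and finite. *)
Lemma occ_mulV a b y : (occ a b y * (occ a b y)^-1 = (\1_(exc N a b 1) y)%:E)%E.
Proof.
rewrite indicE; have [h|h] := pselect (exc N a b 1 y).
  have := occ_gt0 h; have := occ_fin a b y; case: (occ a b y) => // r _; rewrite lte_fin => r0.
  by rewrite mem_set// inver gt_eqF// -EFinM divff// gt_eqF.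
by rewrite memNset// occ_exc0// mul0e.
Qed.

End occupation.

Lemma inve_anti (R : realType) (x y : \bar R) :
  (0 <= x)%E -> (x <= y)%E -> (y^-1 <= x^-1)%E.
Proof.
case: x => [x| |]//; last by move=> _; rewrite leye_eq => /eqP ->.
case: y => [y| |]//; last by rewrite invey inve_ge0.
rewrite !lee_fin le_eqVlt => /predU1P[<-|x0]; first by rewrite inve0 leey.
move=> xy; have y0 : 0 < y by exact: lt_le_trans xy.
by rewrite !inver !gt_eqF// lee_fin lef_pV2.
Qed.

Lemma measurable_inve (d : measure_display) (T : measurableType d) (R : realType)
    (g : T -> \bar R) :
  measurable_fun setT g -> (forall x, 0 <= g x)%E ->
  measurable_fun setT (fun x => (g x)^-1)%E.
Proof.
move=> mg g0; apply: (measurability _ (ErealGenOInfty.measurableE R)).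
move=> _ [_ [r ->] <-]; rewrite setTI.
have [r0|r0] := ltP r 0.
  rewrite (_ : _ @^-1` _ = setT)//; apply/seteqP; split => // x _ /=.
  by rewrite in_itv/= andbT (@lt_le_trans _ _ 0%E) ?lte_fin// inve_ge0.
rewrite (_ : _ @^-1` _ = setT `&` [set x | g x < r%:E^-1])%E.
  exact: emeasurable_fun_infty_o.
apply/seteqP; split => x /=; rewrite in_itv/= andbT.
  move=> h; split => //; move: h (g0 x); case: (g x) => [s| |]//=; last first.
    by rewrite invey lte_fin ltNge r0.
  rewrite lee_fin => + s0; rewrite !inver; have [->|s1] := eqVneq s 0.
    move=> _; case: eqP => [_|/eqP r1]; first exact: ltry.
    by rewrite lte_fin invr_gt0 lt_def r1.
  have s2 : 0 < s by rewrite lt_def s1.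
  rewrite lte_fin; case: eqP => [_ _|/eqP r1]; first exact: ltry.
  have r2 : 0 < r by rewrite lt_def r1.
  by rewrite lte_fin => h; rewrite -[s]invrK ltf_pV2 ?posrE ?invr_gt0.
move=> [_]; move: (g0 x); case: (g x) => [s| |]//=; last first.
  by move=> _; rewrite ltNge leey.
rewrite lee_fin => s0; rewrite !inver; have [->|s1] := eqVneq s 0.
  by rewrite ltry.
have s2 : 0 < s by rewrite lt_def s1.
case: eqP => [-> _|/eqP r1]; first by rewrite lte_fin invr_gt0.
have r2 : 0 < r by rewrite lt_def r1.
by rewrite !lte_fin => h; rewrite -[r]invrK ltf_pV2 ?posrE ?invr_gt0.
Qed.

(** The lower bound [c] keeps inversion continuous along the sequence. The limit +oo, with inverse
    0, is allowed because a total exceedance time might be infinite. *)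
Lemma cvg_inve (R : realType) (u : nat -> \bar R) (x : \bar R) (c : R) : 0 < c ->
  (forall n, c%:E <= u n)%E -> (forall n, u n \is a fin_num) ->
  u n @[n --> \oo] --> x -> ((u n)^-1)%E @[n --> \oo] --> (x^-1)%E.
Proof.
move=> c0 cu fu ux.
have uE n : ((u n)^-1)%E = ((fine (u n))^-1)%:E.
  rewrite -{1}(fineK (fu n)) inver gt_eqF//.
  by rewrite (lt_le_trans c0)// -lee_fin fineK.
under eq_fun do rewrite uE.
case: x ux => [r| |] ux.
- have ur : fine (u n) @[n --> \oo] --> r by exact: fine_cvg.
  have cr : c <= r.
    apply: (ler_cvg_to (cvg_cst c) ur).
    by apply: nearW => n; rewrite -lee_fin fineK.
  have r0 : 0 < r by exact: lt_le_trans cr.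
  rewrite inver gt_eqF//; apply/fine_cvgP; split; first exact: nearW.
  by apply: cvgV => //; rewrite gt_eqF.
- rewrite invey; apply/fine_cvgP; split; first exact: nearW.
  apply/cvgrPdist_le => e e0; near=> n; rewrite /= sub0r normrN.
  have h : ((e^-1)%:E <= u n)%E by near: n; move/cvgeyPge: ux; exact.
  rewrite ger0_norm ?invr_ge0; last first.
    by rewrite -lee_fin fineK// (le_trans _ (cu n))// lee_fin ltW.
  rewrite -[leRHS]invrK lef_pV2 ?posrE ?invr_gt0//.
    by rewrite -lee_fin fineK.
  by rewrite (lt_le_trans c0)// -lee_fin fineK.
- move/cvgeNyPle : ux => /(_ 0) h.
  near \oo => n; have : (u n <= 0%:E)%E by near: n.
  by rewrite leNgt (lt_le_trans _ (cu n))// lte_fin.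
Unshelve. all: by end_near. Qed.

Section tonelli.
Context {R : realType} {d : nat} (N : 'rV[R]_d -> R) (hN : is_norm N).
Local Notation D := (skorokhod R d).
Local Notation mu := (@lebesgue_measure R).
Context (nu : {measure set D -> \bar R}).
Context (disp : measure_display) (Omega : measurableType disp)
  (P : probability Omega R) (X : {RV P >-> D}).
Hypotheses (hstat : stationary X) (hrv : regularly_varying N X nu).
Hypothesis tail_gt0 : forall x, 0 < tailR N X x.
Context (disp' : measure_display) (Omega' : measurableType disp')
  (P' : probability Omega' R) (Y : {RV P' >-> D}).
Hypothesis hY : tail_process N nu Y.

Let hnu : B0_bounded N nu. Proof. by case: hrv. Qed.

Definition mean_inv_occ (a b : R) : \bar R :=
  (\int[P']_w (occ N a b (Y w))^-1)%E.

(** Two orders of integration of 1{a <= s < b, N (y s) > 1} / occ a b y. Over [s] it gives the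
    indicator of [exc N a b 1]; over [y], moving time [s] to 0 turns it into an expectation in Y.
    Measurability in [s] is recorded for later comparisons of integrals. *)
Lemma nu_exc_tonelli (a b : R) :
  measurable_fun (`[a, b[%classic : set (measurableTypeR R))
     (fun s : R => mean_inv_occ (a - s) (b - s)) /\
  nu (exc N a b 1) =
    (\int[mu]_(s in `[a, b[%classic) mean_inv_occ (a - s) (b - s))%E.
Proof.
have mE : measurable (exc N a b 1) by exact: (measurable_exc hN).
(* Cutting [nu] down to [exc N a b 1], off which the integrand vanishes, provides a finite measure
   for Tonelli's theorem. *)
pose m1 := mfrestr mE (nu_exc_fin hN hnu a b ltr01).
have mcoord s c : measurable [set w : D | c < N (w s)] by exact: (measurable_coord hN).
pose A := [set p : D * measurableTypeR R | 1 < N (p.1 p.2)] `&` (setT `*` `[a, b[%classic).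
have mA : measurable A by exact: (@measurable_exceed_itv _ _ _ hN _ _ idfun mcoord).
have mocc : measurable_fun setT (occ N a b).
  exact: (@measurable_occ _ _ _ hN _ _ idfun mcoord).
have occ0 y : (0 <= occ N a b y)%E by exact: measure_ge0.
pose f (p : D * measurableTypeR R) : \bar R := ((\1_A p)%:E * (occ N a b p.1)^-1)%E.
have f0 p : (0 <= f p)%E by rewrite mule_ge0// inve_ge0.
have mf : measurable_fun setT f.
  apply: emeasurable_funM; first exact/measurable_EFinP/measurable_indic.
  by apply: measurable_inve => //; exact: measurableT_comp mocc measurable_fst.
have AE y s : (\1_A (y, s) : R) = \1_([set s | 1 < N (y s)] `&` `[a, b[%classic) s.
  rewrite !indicE; congr ((nat_of_bool _)%:R); apply/idP/idP; rewrite !inE /A/=; tauto.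
have L : (\int[m1]_y \int[mu]_s f (y, s) = nu (exc N a b 1))%E.
  transitivity (\int[m1]_y (\1_(exc N a b 1) y)%:E)%E.
    apply: eq_integral => y _; rewrite /f/=.
    under eq_integral do rewrite AE.
    rewrite ge0_integralZr//; last 2 first.
    - apply/measurable_EFinP; apply: measurable_indic.
      exact: (measurable_exceed_path_itv hN).
    - by rewrite inve_ge0.
    rewrite integral_indic//; last exact: (measurable_exceed_path_itv hN).
    by rewrite setIT -/(occ N a b y) (occ_mulV hN).
  by rewrite integral_indic// setIT /m1/= /mfrestr /mrestr setIid.
have Rt s : `[a, b[%classic s ->
    (\int[m1]_y f (y, s) = mean_inv_occ (a - s) (b - s))%E.
  move=> sab; have mC := measurable_coord hN s 1.
  transitivity (\int[m1]_(y in [set y | (1 < N (y s))%R]) (occ N a b y)^-1)%E.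
    rewrite [RHS]integral_mkcond; apply: eq_integral => y _; rewrite /f/= AE.
    rewrite patchE indicE; case: ifPn => h.
      by rewrite (mem_set (_ : (_ `&` _) s)) ?mul1e//; split => //; rewrite inE in h.
    rewrite memNset ?mul0e// => -[h1 _]; move: h; rewrite notin_setE; exact.
  transitivity (\int[nu]_(y in [set y | (1 < N (y s))%R]) (occ N a b y)^-1)%E.
    apply: eq_measure_integral => B mB Bs; rewrite /m1/= /mfrestr /mrestr setIidl//.
    by move=> y /Bs ys; apply/(exc_left hN); exists s; move: sab; rewrite //= in_itv.
  rewrite (nu_integral_shift hN hstat hrv tail_gt0 hY).
  - by apply: eq_integral => w _; rewrite occ_backshift.
  - apply: measurable_inve => //.
    apply: (@measurable_occ _ _ _ hN _ (g_sigma_algebraType (exc_system N)) id).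
    by move=> s' c; exact: measurable_coord_DG.
  - by move=> y; rewrite inve_ge0.
have FT := @fubini_tonelli _ _ _ _ _ m1 mu f mf f0.
split.
  have := @measurable_fun_fubini_tonelli_G _ _ _ _ _ m1 f mf f0.
  move=> /(@measurable_funTS _ _ _ _ `[a, b[%classic).
  by apply: eq_measurable_fun => s /[!inE] /Rt.
rewrite -L FT [RHS]integral_mkcond; apply: eq_integral => s _.
rewrite patchE; case: ifPn => h; first by apply: Rt; rewrite inE in h.
rewrite notin_setE in h; rewrite integral0_eq// => y _; rewrite /f AE indicE memNset ?mul0e//.
by move=> [_].
Qed.

End tonelli.

(** * Growth of [nu_sup] and the constant theta *)

Section extremal_index.
Context {R : realType} {d : nat} (N : 'rV[R]_d -> R) (hN : is_norm N).
Local Notation D := (skorokhod R d).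
Local Notation mu := (@lebesgue_measure R).
Context (nu : {measure set D -> \bar R}).
Context (disp : measure_display) (Omega : measurableType disp)
  (P : probability Omega R) (X : {RV P >-> D}).
Hypotheses (hstat : stationary X) (hrv : regularly_varying N X nu).
Hypothesis tail_gt0 : forall x, 0 < tailR N X x.
Context (alpha : R) (halpha : tail_index nu alpha).
Context (disp' : measure_display) (Omega' : measurableType disp')
  (P' : probability Omega' R) (Y : {RV P' >-> D}).
Hypothesis hY : tail_process N nu Y.

Let hnu : B0_bounded N nu. Proof. by case: hrv. Qed.

Definition nu_sup (b : R) : R := fine (nu (exc N 0 b 1)).

(** Homogeneity brings the level to 1, shift invariance brings the start of the window to 0. *)
Lemma nu_excE a b c : 0 < c ->
  nu (exc N a b c) = (c `^ (- alpha) * nu_sup (b - a))%:E.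
Proof.
move=> c0; rewrite -[c in LHS]mulr1 -scaleD_exc//.
rewrite (halpha.2 c _ c0 (measurable_exc hN _ _ _)) EFinM; congr (_ * _)%E.
rewrite /nu_sup fineK; last first.
  by rewrite ge0_fin_numE//; exact: (nu_exc_fin hN hnu).
have := @nu_excs_shift _ _ _ hN _ _ _ _ _ hstat hrv tail_gt0 a (a, b, 1) [::] ltr01.
rewrite excs_backshift /= !setIT /exc_family /shift3 /= !addr0 !subr0 subrr.
by move=> ->.
Qed.

Lemma nu_sup_exc b : nu (exc N 0 b 1) = (nu_sup b)%:E.
Proof. by rewrite nu_excE// powR1 mul1r subr0. Qed.

Lemma nu_sup_ge0 b : 0 <= nu_sup b.
Proof. exact/fine_ge0/measure_ge0. Qed.

Lemma nu_sup_le b b' : b <= b' -> nu_sup b <= nu_sup b'.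
Proof.
move=> bb; rewrite -lee_fin -!nu_sup_exc; apply: le_measure; rewrite ?inE.
- exact: (measurable_exc hN).
- exact: (measurable_exc hN).
- by move=> y [s hs cs]; exists s => //; lra.
Qed.

Lemma nu_sup0 : nu_sup 0 = 0.
Proof.
rewrite /nu_sup (_ : exc N 0 0 1 = set0) ?measure0//.
by rewrite -subset0 => y [s]; lra.
Qed.

(* Increments of nu_sup decrease, by stationarity of nu: what is counted is the
   paths exceeding in a window but not before it. *)
Lemma nu_sup_increment (b h k : R) : 0 <= h -> 0 <= k -> k <= b ->
  nu_sup (b + h) - nu_sup b <= nu_sup (k + h) - nu_sup k.
Proof.
move=> h0 k0 kb.
have mexc a c : measurable (exc N a c 1) by exact: (measurable_exc hN).
have sub a u v : u <= v -> exc N a u 1 `<=` exc N a v 1.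
  by move=> uv y [s hs cs]; exists s => //; lra.
have inc a u v : u <= v ->
    nu (exc N a v 1 `\` exc N a u 1) = (nu_sup (v - a) - nu_sup (u - a))%:E.
  move=> uv; rewrite measureD//; last by exact: (nu_exc_fin hN hnu).
  by rewrite setIidr ?EFinB; [rewrite /= !nu_excE// powR1 !mul1r|exact: sub].
have := inc 0 k (k + h); have := inc (k - b) k (k + h).
rewrite !subr0 opprB => /(_ ltac:(lra)) e1 /(_ ltac:(lra)) e2.
have -> : nu_sup (b + h) - nu_sup b = nu_sup (k + h + (b - k)) - nu_sup (k + (b - k)).
  by congr (nu_sup _ - nu_sup _); lra.
rewrite -lee_fin -e1 -e2; apply: le_measure; rewrite ?inE; try exact: measurableD.
move=> y [[s hs cs] ny]; have sk : k <= s.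
  by rewrite leNgt; apply/negP => sk; apply: ny; exists s => //; lra.
split; last by move=> [s' hs' cs']; apply: ny; exists s' => //; lra.
apply/(exc_left hN); exists s => //; lra.
Qed.

Lemma nu_sup_increments n (b h D : R) : 0 <= h -> n.+1%:R * h = b ->
  (forall k, 0 <= k -> k <= b - h -> D <= nu_sup (k + h) - nu_sup k) ->
  n.+1%:R * D <= nu_sup b.
Proof.
move=> h0 nh H.
apply: (@le_trans _ _ (\sum_(0 <= k < n.+1) (nu_sup (k.+1%:R * h) - nu_sup (k%:R * h)))).
  rewrite mulr_natl -[X in _ *+ X]subn0 -sumr_const_nat.
  rewrite !big_seq; apply: ler_sum => i; rewrite mem_index_iota => /andP[_ iN].
  rewrite -natr1 mulrDl mul1r; apply: H; first by rewrite mulr_ge0.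
  by rewrite lerBrDr -nh -{2}[h]mul1r -mulrDl natr1 ler_wpM2r// ler_nat.
by rewrite (telescope_sumr (fun k => nu_sup (k%:R * h)))// nh mul0r nu_sup0 subr0.
Qed.

(** Increments over steps of length b/(n+1) decrease, so the one just after [b] and the last one
    before [b] are at most the mean of the n + 1 increments that make up [nu_sup b]. This is the
    continuity behind the sandwich in [probX_exc_cvg]. *)
Lemma nu_sup_continuous n (b : R) : 0 <= b ->
  nu_sup (b * (1 + n.+1%:R^-1)) <= nu_sup b * (1 + n.+1%:R^-1) /\
  nu_sup b * (1 - n.+1%:R^-1) <= nu_sup (b * (1 - n.+1%:R^-1)).
Proof.
move=> b0.
have [q qE] : exists q : R, q = n.+1%:R^-1 by exists n.+1%:R^-1.
have [h hE] : exists h, h = b * q by exists (b * q).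
have q0 : 0 <= q by rewrite qE invr_ge0.
have nq : n.+1%:R * q = 1 by rewrite qE divff.
have h0 : 0 <= h by rewrite hE mulr_ge0.
have nh : n.+1%:R * h = b by rewrite hE mulrCA nq mulr1.
have q1 : q <= 1 by rewrite qE invf_le1// ler1n.
have hb : h <= b by rewrite hE -[leRHS]mulr1 ler_wpM2l.
rewrite -qE !(mulrDr b) mulrN mulr1 -hE; split.
  have H k : 0 <= k -> k <= b - h -> nu_sup (b + h) - nu_sup b <= nu_sup (k + h) - nu_sup k.
    by move=> k0 kb; apply: nu_sup_increment => //; lra.
  have /(ler_wpM2l q0) := nu_sup_increments h0 nh H.
  rewrite mulrA (mulrC q) nq mul1r; lra.
have H k : 0 <= k -> k <= b - h -> nu_sup b - nu_sup (b - h) <= nu_sup (k + h) - nu_sup k.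
  by move=> k0 kb; have := nu_sup_increment h0 k0 kb; rewrite subrK.
have /(ler_wpM2l q0) := nu_sup_increments h0 nh H.
rewrite mulrA (mulrC q) nq mul1r; lra.
Qed.

Local Notation theta := (\int[P']_w (exceedance_time N (Y w))^-1)%E.

Let mYc s c : measurable [set w | c < N (Y w s)].
Proof. exact: (@measurable_preimage _ _ _ _ P' Y _ (measurable_coord hN s c)). Qed.

Let minv a b : measurable_fun setT (fun w => ((occ N a b (Y w))^-1)%E).
Proof.
apply: measurable_inve; last by move=> w; exact: measure_ge0.
exact: (measurable_occ hN).
Qed.

Let mexceed : measurable_fun setT (fun w => ((exceedance_time N (Y w))^-1)%E).
Proof.
apply: measurable_inve; last by move=> w; rewrite exceedance_timeE//; exact: measure_ge0.
have := @measurable_fun_xsection _ _ _ _ _ mu _ (measurable_exceed hN mYc).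
congr measurable_fun; apply/funext => w /=; rewrite exceedance_timeE//; congr (mu _).
by apply/seteqP; split => s; rewrite /xsection/= inE.
Qed.

Lemma mean_inv_occ_ge0 a b : (0 <= mean_inv_occ N Y a b)%E.
Proof. by apply: integral_ge0 => w _; rewrite inve_ge0. Qed.

Lemma mean_inv_occ_le a b a' b' : a' <= a -> b <= b' ->
  (mean_inv_occ N Y a' b' <= mean_inv_occ N Y a b)%E.
Proof.
move=> aa bb; apply: ge0_le_integral => //.
- by move=> w _; rewrite inve_ge0.
- by move=> w _; apply: inve_anti => //; exact: (occ_le hN).
Qed.

Lemma theta_le_mean_inv_occ a b : (theta <= mean_inv_occ N Y a b)%E.
Proof.
apply: ge0_le_integral => //.
- by move=> w _; rewrite inve_ge0 exceedance_timeE.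
- by move=> w _; apply: inve_anti => //; exact: (occ_le_exceedance hN).
Qed.

Let mu_itv (a b : R) : a <= b -> mu `[a, b[%classic = (b - a)%:E.
Proof.
move=> ab; rewrite lebesgue_measure_itv/= lte_fin; case: ltP => [//|ba].
by rewrite (_ : b = a) ?subrr//; apply/eqP; rewrite eq_le ab ba.
Qed.

Let mitv (a b : R) : measurable (`[a, b[%classic : set (measurableTypeR R)).
Proof. exact: measurable_itv. Qed.

Lemma nu_sup_ge b : 0 <= b -> (theta * b%:E <= (nu_sup b)%:E)%E.
Proof.
move=> b0; rewrite -nu_sup_exc.
have [mm ->] := nu_exc_tonelli hN hstat hrv tail_gt0 hY 0 b.
have -> : (theta * b%:E = \int[mu]_(s in `[0%R, b[%classic) cst theta s)%E.
  by rewrite integral_cst//= mu_itv// subr0.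
apply: ge0_le_integral.
- exact: mitv.
- by move=> s _; apply: integral_ge0 => w _; rewrite inve_ge0 exceedance_timeE.
- exact: measurable_cst.
- exact: mm.
- by move=> s _; exact: theta_le_mean_inv_occ.
Qed.

(** For s in [0, 1) the window [-s, 1 - s) lies in [-1, 1). The resulting finiteness bounds theta
    and supplies a dominating function for [mean_inv_occ_cvg]. *)
Lemma mean_inv_occ1 : (mean_inv_occ N Y (-1) 1 <= (nu_sup 1)%:E)%E.
Proof.
rewrite -nu_sup_exc; have [mm ->] := nu_exc_tonelli hN hstat hrv tail_gt0 hY 0 1.
have -> : (mean_inv_occ N Y (-1) 1 =
    \int[mu]_(s in `[0%R, 1%R[%classic) cst (mean_inv_occ N Y (-1) 1) s)%E.
  by rewrite integral_cst//= mu_itv// subr0 mule1.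
apply: ge0_le_integral.
- exact: mitv.
- by move=> s _; exact: mean_inv_occ_ge0.
- exact: measurable_cst.
- exact: mm.
- by move=> s /=; rewrite in_itv/= => hs; apply: mean_inv_occ_le; lra.
Qed.

(** When s is at least [t] away from both ends of [0, b), the window [-s, b - s) contains [-t, t).
    The two end pieces are bounded by the Tonelli integrals of windows of length [t]. *)
Lemma nu_sup_le_split t b : 0 <= t -> t + t <= b ->
  ((nu_sup b)%:E <= (nu_sup t)%:E + (nu_sup t)%:E + mean_inv_occ N Y (- t) t * b%:E)%E.
Proof.
move=> t0 tb.
have part (u v : R) : 0 <= u -> u <= v -> v <= b ->
    measurable_fun (`[u, v[%classic : set (measurableTypeR R))
      (fun s : R => mean_inv_occ N Y (0 - s) (b - s)).
  move=> u0 uv vb; have [mm _] := nu_exc_tonelli hN hstat hrv tail_gt0 hY 0 b.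
  by apply: measurable_funS mm => // s /=; rewrite !in_itv/= => hs; lra.
rewrite -nu_sup_exc; have [mm ->] := nu_exc_tonelli hN hstat hrv tail_gt0 hY 0 b.
have itvE (u v w : R) : u <= v -> v <= w ->
    (`[u, w[%classic : set (measurableTypeR R)) = `[u, v[%classic `|` `[v, w[%classic.
  move=> uv vw; apply/seteqP; split => s /=; rewrite !in_itv/=.
    by move=> h; have [sv|vs] := ltP s v; [left|right]; lra.
  by move=> [] h; lra.
have dis (u v w : R) : [disjoint (`[u, v[%classic : set R) & `[v, w[%classic].
  by apply/disj_setPS => s /= []; rewrite !in_itv/= => h1 h2; lra.
have g0 (A : set R) s : A s -> (0 <= mean_inv_occ N Y (0 - s) (b - s))%E.
  by move=> _; exact: mean_inv_occ_ge0.
rewrite (itvE 0 t b t0 ltac:(lra)).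
rewrite ge0_integral_setU//; last first.
- by move=> s; rewrite -(itvE 0 t b t0 ltac:(lra)); exact: g0.
- by rewrite -(itvE 0 t b t0 ltac:(lra)).
rewrite (itvE t (b - t) b ltac:(lra) ltac:(lra)).
rewrite ge0_integral_setU//; last first.
- by move=> s; rewrite -(itvE t (b - t) b ltac:(lra) ltac:(lra)); exact: g0.
- by rewrite -(itvE t (b - t) b ltac:(lra) ltac:(lra)); apply: part; lra.
rewrite addeCA [leRHS]addeC; apply: leeD.
  apply: (@le_trans _ _ (\int[mu]_(s in `[t, (b - t)%R[%classic) cst (mean_inv_occ N Y (- t) t) s)%E).
    apply: ge0_le_integral.
    - exact: mitv.
    - exact: g0.
    - by apply: part; lra.
    - exact: measurable_cst.
    - by move=> s /=; rewrite in_itv/= => hs; apply: mean_inv_occ_le; lra.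
  rewrite integral_cst//= mu_itv; last lra.
  by apply: lee_wpmul2l; [exact: mean_inv_occ_ge0|rewrite lee_fin; lra].
apply: leeD.
  rewrite -nu_sup_exc; have [mm' ->] := nu_exc_tonelli hN hstat hrv tail_gt0 hY 0 t.
  apply: ge0_le_integral.
  - exact: mitv.
  - exact: g0.
  - by apply: part; lra.
  - exact: mm'.
  - by move=> s /=; rewrite in_itv/= => hs; apply: mean_inv_occ_le; lra.
have -> : (nu_sup t)%:E = nu (exc N (b - t) b 1).
  by rewrite nu_excE// powR1 mul1r opprB addrC subrK.
have [mm' ->] := nu_exc_tonelli hN hstat hrv tail_gt0 hY (b - t) b.
apply: ge0_le_integral.
- exact: mitv.
- exact: g0.
- by apply: part; lra.
- exact: mm'.
- by move=> s /=; rewrite in_itv/= => hs; apply: mean_inv_occ_le; lra.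
Qed.

Lemma theta_fin_num : theta \is a fin_num.
Proof.
rewrite ge0_fin_numE; last first.
  by apply: integral_ge0 => w _; rewrite inve_ge0 exceedance_timeE.
apply: le_lt_trans (theta_le_mean_inv_occ (-1) 1) _.
exact: le_lt_trans mean_inv_occ1 (ltry _).
Qed.

Lemma occ_cvg_exceedance y :
  occ N (- n.+1%:R) n.+1%:R y @[n --> \oo] --> exceedance_time N y.
Proof.
rewrite exceedance_timeE//.
have -> : [set s | 1 < N (y s)] =
    \bigcup_n ([set s | 1 < N (y s)] `&` `[- n.+1%:R, n.+1%:R[%classic).
  apply/seteqP; split => s /=; last by move=> [n _ []].
  move=> ys; have [n hn] : exists n, `|s| < n.+1%:R.
    by exists (Num.truncn `|s|); exact: truncnS_gt.
  exists n => //; split => //=; rewrite in_itv/=; move: hn.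
  by rewrite ltr_norml => /andP[/ltW -> ->].
apply: nondecreasing_cvg_mu.
- by move=> n; exact: (measurable_exceed_path_itv hN).
- by apply: bigcupT_measurable => n; exact: (measurable_exceed_path_itv hN).
- move=> m n mn; apply/subsetPset; apply: setIS => s /=; rewrite !in_itv/=.
  have mn' : m.+1%:R <= n.+1%:R :> R by rewrite ler_nat.
  by move=> h; lra.
Qed.

(** Dominated convergence. Almost surely Y exceeds level 1 at time 0, so the time spent above it
    during [-1, 1) is positive and bounds all the later occupation times from below, as [cvg_inve]
    asks. *)
Lemma mean_inv_occ_cvg :
  mean_inv_occ N Y (- n.+1%:R) n.+1%:R @[n --> \oo] --> theta.
Proof.
have mC0 := measurableC (mYc 0 1).
have null0 : P' (~` [set w | 1 < N (Y w 0)]) = 0%E.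
  have := hY (measurableC (measurable_coord hN 0 1)).
  by rewrite /distribution /pushforward setICl measure0.
have H1 : \forall w \ae P', setT w ->
    ((occ N (- n.+1%:R) n.+1%:R (Y w))^-1)%E @[n --> \oo] -->
    ((exceedance_time N (Y w))^-1)%E.
  exists (~` [set w | 1 < N (Y w 0)]); split => // w /= H h; apply: H => _.
  have e1 : exc N (-1) 1 1 (Y w) by exists 0 => //; lra.
  have c0 : 0 < fine (occ N (-1) 1 (Y w)).
    by rewrite -lte_fin fineK; [exact: (occ_gt0 hN)|exact: (occ_fin hN)].
  apply: (cvg_inve c0).
  - move=> n; rewrite fineK; last exact: (occ_fin hN).
    by apply: (occ_le hN); rewrite ?lerN2 ler1n.
  - by move=> n; exact: (occ_fin hN).
  - exact: occ_cvg_exceedance.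
have H2 : P'.-integrable setT (fun w => (occ N (-1) 1 (Y w))^-1)%E.
  apply/integrableP; split; first exact: minv.
  under eq_integral do rewrite gee0_abs ?inve_ge0//.
  exact: le_lt_trans mean_inv_occ1 (ltry _).
have H3 : \forall w \ae P', forall n, setT w ->
    (`| (occ N (- n.+1%:R) n.+1%:R (Y w))^-1 | <= (occ N (-1) 1 (Y w))^-1)%E.
  apply: aeW => w n _; rewrite gee0_abs ?inve_ge0//; apply: inve_anti => //.
  by apply: (occ_le hN); rewrite ?lerN2 ler1n.
by have [_ _] := dominated_convergence measurableT (fun n => minv _ _) mexceed H1 H2 H3.
Qed.

(** [t] is so large that E[1 / occ (- t) t Y] <= theta + e. The constant pays for the two ends of
    length [t] and for windows shorter than 2t. *)
Lemma nu_sup_affine (e : R) : 0 < e ->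
  exists2 C, 0 <= C & forall b, 0 <= b -> nu_sup b <= C + (fine theta + e) * b.
Proof.
move=> e0.
have thE : theta = (fine theta)%:E by rewrite fineK// theta_fin_num.
have [n hn] : exists n, (mean_inv_occ N Y (- n.+1%:R) n.+1%:R <= (fine theta + e)%:E)%E.
  apply: contrapT => H.
  have : ((fine theta + e)%:E <= theta)%E.
    apply: (cvge_to_ge mean_inv_occ_cvg); apply: nearW => n.
    by rewrite leNgt; apply/negP => h; apply: H; exists n; exact: ltW.
  by rewrite [leRHS]thE lee_fin gerDl leNgt e0.
set t : R := n.+1%:R in hn; have t0 : 0 <= t by [].
exists (nu_sup t + nu_sup t + nu_sup (t + t)).
  by rewrite !addr_ge0// nu_sup_ge0.
move=> b b0; have th0 : 0 <= fine theta.
  by apply/fine_ge0/integral_ge0 => w _; rewrite inve_ge0 exceedance_timeE.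
have [tb|bt] := leP (t + t) b.
  have := nu_sup_le_split t0 tb.
  move=> /le_trans /(_ (leeD (lexx _) (lee_wpmul2r _ hn))).
  rewrite lee_fin => /(_ b0); rewrite -EFinM -!EFinD lee_fin.
  by have := nu_sup_ge0 (t + t); lra.
have := nu_sup_le (ltW bt); have := nu_sup_ge0 t.
have : 0 <= (fine theta + e) * b by rewrite mulr_ge0// addr_ge0// ltW.
lra.
Qed.

End extremal_index.

Lemma cvg_powR (R : realType) (a x : R) : 0 < x -> y `^ a @[y --> x] --> x `^ a.
Proof.
move=> x0.
have H : expR (a * ln y) @[y --> x] --> expR (a * ln x).
  apply: continuous_cvg; first exact: continuous_expR.
  by apply: cvgM; [exact: cvg_cst|exact: continuous_ln].
rewrite [X in _ --> X]/powR gt_eqF//.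
apply: (@cvg_trans _ (expR (a * ln y) @[y --> x])); last exact: H.
apply: near_eq_cvg; near=> y.
by rewrite /powR gt_eqF//; near: y; exact: lt_nbhsr.
Unshelve. all: by end_near. Qed.

Lemma powRN_anti (R : realType) (a u v : R) : 0 < a -> 0 < u -> u <= v ->
  v `^ (- a) <= u `^ (- a).
Proof.
move=> a0 u0 uv; have v0 := lt_le_trans u0 uv.
rewrite !powRN lef_pV2 ?posrE ?powR_gt0//.
by apply: ge0_ler_powR => //; rewrite ?nnegrE; exact: ltW.
Qed.

(** The factors are the effect on the limit of a relative change q = 1/(n+2) of level and of window
    length. Since q < 1, the bases stay positive. *)
Lemma powR_perturb (R : realType) (a e : R) : 0 < e -> exists n,
  (1 - n.+2%:R^-1) `^ a * (1 + n.+2%:R^-1) < 1 + e /\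
  1 - e < (1 + n.+2%:R^-1) `^ a * (1 - n.+2%:R^-1).
Proof.
move=> e0.
have q0 : (n.+2%:R^-1 : R) @[n --> \oo] --> (0 : R).
  by have := @cvg_harmonic R; rewrite -cvg_shiftS.
have cB : (1 - n.+2%:R^-1 : R) @[n --> \oo] --> (1 : R).
  have := cvgB (cvg_cst (1 : R)) q0; rewrite subr0; exact.
have cD : (1 + n.+2%:R^-1 : R) @[n --> \oo] --> (1 : R).
  have := cvgD (cvg_cst (1 : R)) q0; rewrite addr0; exact.
have pw (u : nat -> R) : u n @[n --> \oo] --> (1 : R) ->
    (u n) `^ a @[n --> \oo] --> (1 : R).
  move=> u1; have := @cvg_comp _ _ _ u (fun y => y `^ a) _ _ _ u1 (@cvg_powR R a 1 ltr01).
  by rewrite powR1.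
have h1 : (1 - n.+2%:R^-1) `^ a * (1 + n.+2%:R^-1) @[n --> \oo] --> (1 : R).
  have := cvgM (pw _ cB) cD; rewrite mulr1; exact.
have h2 : (1 + n.+2%:R^-1) `^ a * (1 - n.+2%:R^-1) @[n --> \oo] --> (1 : R).
  have := cvgM (pw _ cD) cB; rewrite mulr1; exact.
near \oo => n; exists n; split; near: n.
- by apply: (cvgr_lt _ h1); rewrite ltrDl.
- by apply: (cvgr_gt _ h2); rewrite gtrBl.
Unshelve. all: by end_near. Qed.

(** * Exceedances in intervals and in blocks *)

Section tail_asymptotics.
Context {R : realType} {d : nat} (N : 'rV[R]_d -> R) (hN : is_norm N).
Local Notation D := (skorokhod R d).
Context (nu : {measure set D -> \bar R}).
Context (disp : measure_display) (Omega : measurableType disp)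
  (P : probability Omega R) (X : {RV P >-> D}).
Hypotheses (hstat : stationary X) (hrv : regularly_varying N X nu).
Hypothesis tail_gt0 : forall x, 0 < tailR N X x.
Context (alpha : R) (halpha : tail_index nu alpha).
Context (disp' : measure_display) (Omega' : measurableType disp')
  (P' : probability Omega' R) (Y : {RV P' >-> D}).
Hypothesis hY : tail_process N nu Y.

Let hnu : B0_bounded N nu. Proof. by case: hrv. Qed.
Let alpha0 : 0 < alpha. Proof. by case: halpha. Qed.

Local Notation G := (nu_sup N nu).
Local Notation p := (tailR N X).

Let Gle b b' : b <= b' -> G b <= G b'.
Proof. exact: (nu_sup_le hN hstat hrv tail_gt0 halpha). Qed.

Definition probX (A : set D) : R := fine (P (X @^-1` A)).

Lemma probX_le A B : measurable A -> measurable B -> A `<=` B -> probX A <= probX B.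
Proof.
move=> mA mB AB; apply: fine_le; rewrite ?fin_num_measure//; try exact: measurable_preimage.
apply: le_measure; rewrite ?inE; try exact: measurable_preimage.
by move=> w; exact: AB.
Qed.

Lemma probX_ge0 A : 0 <= probX A.
Proof. exact/fine_ge0/measure_ge0. Qed.

Lemma probX_le1 A : measurable A -> probX A <= 1.
Proof.
move=> mA; rewrite -lee_fin fineK; first exact/probability_le1/measurable_preimage.
by rewrite fin_num_measure//; exact: measurable_preimage.
Qed.

Lemma probX_shift t A : measurable A -> probX (backshift t @^-1` A) = probX A.
Proof. by move=> mA; rewrite /probX -(hstat t mA). Qed.

Lemma tailRE x : p x = probX [set y | x < N (y 0)].
Proof. by []. Qed.

Lemma probX_exc a b c : probX (exc N a b c) = probX (exc N 0 (b - a) c).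
Proof.
rewrite -(@probX_shift a (exc N a b c)) ?exc_backshift ?subrr//.
exact: (measurable_exc hN).
Qed.

(** A lower bound free of any frontier condition at [e2]: a good parameter e in (e2 / 2, e2) has
    [U e2] inside [U e]. *)
Lemma stable_ge (U : R -> set D) (V : R -> set D) (a b c e2 : R) : J1_stable U -> 0 < c ->
  (forall e, 0 < e -> measurable (U e)) -> (forall e, 0 < e -> U e `<=` exc N a b c) ->
  (forall u, 0 < u -> measurable (V u)) ->
  (forall e u, 0 < e -> 0 < u -> scaleD u @` U e `<=` V u) ->
  0 < e2 -> forall r, 0 < r ->
  \forall u \near +oo, fine (nu (U e2)) - r <= probX (V u) / p u.
Proof.
move=> sU c0 mU Uabc mV UV e20 r r0.
have e3 : 0 < e2 / 2 by lra.
have e4 : e2 / 2 < e2 by lra.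
have [e ee h] := stable_limit hN hrv tail_gt0 sU c0 mU Uabc e3 e4.
have e0 : 0 < e by lra.
have fU x : 0 < x -> nu (U x) \is a fin_num.
  move=> x0; rewrite ge0_fin_numE//; apply: le_lt_trans (nu_exc_fin hN hnu a b c0).
  by apply: le_measure; rewrite ?inE; [exact: mU|exact: (measurable_exc hN)|exact: Uabc].
have le2 : fine (nu (U e2)) <= fine (nu (U e)).
  apply: fine_le; rewrite ?fU//; apply: le_measure; rewrite ?inE; try exact: mU.
  by apply: (sU.1 e e2); lra.
near=> u.
have u0 : 0 < u by near: u; exact: nbhs_pinfty_gt.
apply: (@le_trans _ _ (probD X u (U e) / p u)).
  apply: ltW; apply: (@le_lt_trans _ _ (fine (nu (U e)) - r)); first by lra.
  by near: u; apply: (cvgr_gt _ h); rewrite gtrBl.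
rewrite ler_pM2r ?invr_gt0//; apply: probX_le; [|exact: mV|exact: UV].
by apply: measurable_scaleD_image; [rewrite gt_eqF|exact: mU].
Unshelve. all: by end_near. Qed.

(** The exact event need not have a null frontier. It is sandwiched between events of [exc_family]
    with slightly changed window and level, whose tail measures are close to the limit by
    [nu_sup_continuous] and [powR_perturb]. *)
Lemma probX_exc_cvg b x : 0 < b -> 0 < x ->
  probX (exc N 0 b (u * x)) / p u @[u --> +oo] --> x `^ (- alpha) * G b.
Proof.
move=> b0 x0; apply/cvgrPdist_le => r r0.
(* [K - 1] is the limit; the added 1 permits division by [K] whatever the limit. *)
pose K := x `^ (- alpha) * G b + 1.
have K0 : 0 < K by rewrite ltr_wpDl// mulr_ge0 ?powR_ge0// nu_sup_ge0.
have rK : 0 < r / 2 / K by rewrite !divr_gt0.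
have [n [nU nL]] := powR_perturb (- alpha) rK.
have [cU cL] := nu_sup_continuous hN hstat hrv tail_gt0 halpha n.+1 (ltW b0).
have [q qE] : exists q : R, q = n.+2%:R^-1 by exists n.+2%:R^-1.
rewrite -!qE in nU nL cU cL.
have q0 : 0 < q by rewrite qE invr_gt0.
have q1 : q < 1 by rewrite qE invf_lt1// ltr1n.
have xq0 : 0 < x * q by rewrite mulr_gt0.
have bq0 : 0 < b * q by rewrite mulr_gt0.
have xq1 : x * q < x by rewrite -[ltRHS]mulr1 ltr_pM2l.
have bq1 : b * q < b by rewrite -[ltRHS]mulr1 ltr_pM2l.
have KK : (K - 1) * (r / 2 / K) <= r / 2.
  rewrite mulrCA; apply: ler_piMr; first by rewrite divr_ge0// ltW.
  by rewrite ler_pdivrMr// mul1r; lra.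
have up : \forall u \near +oo, probX (exc N 0 b (u * x)) / p u <= K - 1 + r.
  (* The level moves by at most x * q, and moving both ends by [s] changes the window length by at
     most b * q. *)
  pose s := Num.min (x * q) (b * q / 2).
  have s0 : 0 < s by rewrite lt_min xq0 divr_gt0.
  have sx : s <= x * q by rewrite ge_min lexx.
  have sb : s <= b * q / 2 by rewrite ge_min lexx orbT.
  have [e ee h] := @stable_limit _ _ _ hN _ _ _ _ _ hrv tail_gt0
     (exc_family N (- s, b + s, x - s)) (- s) (b + s) (x - s) (stable_exc hN _) ltac:(lra)
     (fun e _ => measurable_exc_family hN _ e) ltac:(move=> e e0 y [t ht ct]; exists t; move: ht ct => /=; lra)
     (s / 4) (s / 2) ltac:(lra) ltac:(lra).
  have nuE : fine (nu (exc_family N (- s, b + s, x - s) e)) <= K - 1 + r / 2.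
    rewrite /exc_family/= (nu_excE hN hstat hrv tail_gt0 halpha)/=; last lra.
    apply: (@le_trans _ _ ((x * (1 - q)) `^ (- alpha) * G (b * (1 + q)))).
      apply: ler_pM; rewrite ?powR_ge0 ?nu_sup_ge0//.
        by apply: powRN_anti => //; [rewrite mulr_gt0// subr_gt0|lra].
      by apply: Gle; lra.
    apply: (@le_trans _ _ ((x * (1 - q)) `^ (- alpha) * (G b * (1 + q)))).
      by apply: ler_wpM2l => //; exact: powR_ge0.
    have -> : (x * (1 - q)) `^ (- alpha) = x `^ (- alpha) * (1 - q) `^ (- alpha).
      by apply: powRM; lra.
    rewrite mulrACA.
    apply: (@le_trans _ _ ((K - 1) * (1 + r / 2 / K))).
      by rewrite /K addrK; apply: ler_wpM2l; [rewrite mulr_ge0 ?powR_ge0 ?nu_sup_ge0|exact: ltW].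
    by rewrite mulrDr mulr1 lerD2l.
  near=> u.
  have u0 : 0 < u by near: u; exact: nbhs_pinfty_gt.
  apply: (@le_trans _ _ (probD X u (exc_family N (- s, b + s, x - s) e) / p u)); last first.
    apply: ltW; apply: (@lt_le_trans _ _ (fine (nu (exc_family N (- s, b + s, x - s) e)) + r / 2)).
      by near: u; apply: (cvgr_lt _ h); lra.
    by lra.
  rewrite ler_pM2r ?invr_gt0//; apply: probX_le.
  - exact: (measurable_exc hN).
  - by apply: measurable_scaleD_image; [rewrite gt_eqF|exact: measurable_exc_family].
  rewrite /exc_family scaleD_exc// => y [t ht ct]; exists t; first by move: ht => /=; lra.
  by apply: le_lt_trans ct => /=; apply: ler_wpM2l; [exact: ltW|lra].
have lo : \forall u \near +oo, K - 1 - r <= probX (exc N 0 b (u * x)) / p u.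
  pose s := Num.min (x * q) (b * q / 2).
  have s0 : 0 < s by rewrite lt_min xq0 divr_gt0.
  have sx : s <= x * q by rewrite ge_min lexx.
  have sb : s <= b * q / 2 by rewrite ge_min lexx orbT.
  have nuE : K - 1 - r / 2 <= fine (nu (exc_family N (0, b, x) s)).
    rewrite /exc_family/= (nu_excE hN hstat hrv tail_gt0 halpha)/=; last lra.
    apply: (@le_trans _ _ ((x * (1 + q)) `^ (- alpha) * G (b * (1 - q)))); last first.
      apply: ler_pM; rewrite ?powR_ge0 ?nu_sup_ge0//.
        by apply: powRN_anti => //; lra.
      by apply: Gle; lra.
    apply: (@le_trans _ _ ((x * (1 + q)) `^ (- alpha) * (G b * (1 - q)))); last first.
      by apply: ler_wpM2l => //; exact: powR_ge0.
    have -> : (x * (1 + q)) `^ (- alpha) = x `^ (- alpha) * (1 + q) `^ (- alpha).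
      by apply: powRM; lra.
    rewrite mulrACA.
    apply: (@le_trans _ _ ((K - 1) * (1 - r / 2 / K))).
      by rewrite mulrBr mulr1 lerD2l lerN2.
    by rewrite /K addrK; apply: ler_wpM2l; [rewrite mulr_ge0 ?powR_ge0 ?nu_sup_ge0|exact: ltW].
  have : \forall u \near +oo,
      fine (nu (exc_family N (0, b, x) s)) - r / 2 <= probX (exc N 0 b (u * x)) / p u.
    apply: (@stable_ge (exc_family N (0, b, x)) (fun u => exc N 0 b (u * x)) 0 b x) => //; last lra.
    - exact: (stable_exc hN).
    - by move=> e _; exact: measurable_exc_family.
    - by move=> e e0 y [t ht ct]; exists t; move: ht ct => /=; lra.
    - by move=> u _; exact: (measurable_exc hN).
    - move=> e u e0 u0; rewrite /exc_family scaleD_exc// => y [t ht ct].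
      exists t; first by move: ht => /=; lra.
      by apply: le_lt_trans ct => /=; apply: ler_wpM2l; [exact: ltW|lra].
  by apply: filterS => u; lra.
apply: filterS2 up lo => u; rewrite /K addrK => h1 h2.
by rewrite ler_norml; apply/andP; split; lra.
Unshelve. all: by end_near. Qed.

End tail_asymptotics.

(** * Marginal tails and discretization of a unit window *)

Section discretization.
Context {R : realType} {d : nat} (N : 'rV[R]_d -> R) (hN : is_norm N).
Local Notation D := (skorokhod R d).
Context (nu : {measure set D -> \bar R}).
Context (disp : measure_display) (Omega : measurableType disp)
  (P : probability Omega R) (X : {RV P >-> D}).
Hypotheses (hstat : stationary X) (hrv : regularly_varying N X nu).
Hypothesis tail_gt0 : forall x, 0 < tailR N X x.
Context (alpha : R) (halpha : tail_index nu alpha).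
Context (disp' : measure_display) (Omega' : measurableType disp')
  (P' : probability Omega' R) (Y : {RV P' >-> D}).
Hypothesis hY : tail_process N nu Y.

Local Notation G := (nu_sup N nu).
Local Notation p := (tailR N X).
Local Notation probX := (probX X).

Let mexc a b c : measurable (exc N a b c). Proof. exact: (measurable_exc hN). Qed.

Lemma probXI A B : measurable A -> measurable B ->
  probX (A `\` B) = probX A - probX (A `&` B).
Proof.
move=> mA mB; have mXA := @measurable_preimage _ _ _ _ P X _ mA.
have mXB := @measurable_preimage _ _ _ _ P X _ mB.
rewrite /probX -[_ @^-1` (A `\` B)]/((X @^-1` A) `\` (X @^-1` B)) measureD//; last first.
  by apply: (le_lt_trans (probability_le1 P mXA)); rewrite ltry.
by rewrite fineB//= ?fin_num_measure//; exact: measurableI.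
Qed.

Lemma probXD A B : measurable A -> measurable B -> B `<=` A ->
  probX (A `\` B) = probX A - probX B.
Proof. by move=> mA mB BA; rewrite probXI// setIidr. Qed.

Lemma probXU A B : measurable A -> measurable B -> probX (A `|` B) <= probX A + probX B.
Proof.
move=> mA mB; have mXA := @measurable_preimage _ _ _ _ P X _ mA.
have mXB := @measurable_preimage _ _ _ _ P X _ mB.
rewrite /probX -fineD ?fin_num_measure//; apply: fine_le.
- by rewrite fin_num_measure//; exact: (@measurable_preimage _ _ _ _ P X _ (measurableU _ _ mA mB)).
- by rewrite fin_numD !fin_num_measure.
- exact: measureU2.
Qed.

Lemma probXU_disj A B : measurable A -> measurable B -> A `&` B = set0 ->
  probX (A `|` B) = probX A + probX B.
Proof.
move=> mA mB AB; have mXA := @measurable_preimage _ _ _ _ P X _ mA.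
have mXB := @measurable_preimage _ _ _ _ P X _ mB.
rewrite /probX preimage_setU measureU//; last by rewrite -preimage_setI AB preimage_set0.
by rewrite fineD// fin_num_measure.
Qed.

(** The law of Y has mass 1 and is [nu] on {N (y 0) > 1}, an event contained in an exceedance during
    [0, 1). *)
Lemma nu_sup1_ge1 : 1 <= G 1.
Proof.
have := hY measurableT; rewrite /distribution /pushforward preimage_setT probability_setT setTI => h.
rewrite -lee_fin -(nu_sup_exc hN hstat hrv tail_gt0 halpha) h; apply: le_measure; rewrite ?inE//.
  exact: (measurable_coord hN).
by move=> y y0; apply/(exc_left hN); exists 0 => //; lra.
Qed.

(** The value at time 0 is not J1-continuous, so the maximum over a unit window is used instead: its
    probability at level u * x, divided by [p u] and by [p (u * x)], tends to x^(-alpha) * G 1 and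
    to G 1. In the quotient G 1 cancels. *)
Lemma tailR_cvg x : 0 < x -> p (u * x) / p u @[u --> +oo] --> x `^ (- alpha).
Proof.
move=> x0.
have G0 : G 1 != 0 by rewrite gt_eqF// (lt_le_trans _ nu_sup1_ge1).
have h1 := probX_exc_cvg hN hstat hrv tail_gt0 halpha ltr01 x0.
have := probX_exc_cvg hN hstat hrv tail_gt0 halpha ltr01 ltr01.
rewrite powR1 mul1r => h2.
have ux : u * x @[u --> +oo] --> +oo by apply: gt0_cvgMly => //; exact: cvg_id.
have h3 : probX (exc N 0 1 (u * x)) / p (u * x) @[u --> +oo] --> G 1.
  apply: cvg_trans (cvg_comp _ _ ux h2).
  by apply: near_eq_cvg; apply: nearW => u /=; rewrite mulr1.
have h4 := cvgM h1 (cvgV G0 h3); rewrite mulfK// in h4.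
apply: (cvg_trans _ (h4 _ _)); apply: near_eq_cvg; apply: nearW => u /=.
have Q0 : probX (exc N 0 1 (u * x)) != 0.
  rewrite gt_eqF//; apply: (lt_le_trans (tail_gt0 (u * x))).
  rewrite tailRE; apply: probX_le => //; first exact: (measurable_coord hN).
  by move=> y y0; apply/(exc_left hN); exists 0 => //; lra.
by rewrite invf_div mulrC mulrA divfK.
Qed.

Definition hit_at (l : seq R) (c : R) : set D :=
  [set y | exists2 q, q \in l & c < N (y q)].

Lemma hit_at_cons q l c :
  hit_at (q :: l) c = [set y : D | c < N (y q)] `|` hit_at l c.
Proof.
apply/seteqP; split => y /=.
  by move=> [s]; rewrite inE => /predU1P[->|sl] h; [left|right; exists s].
by move=> [h|[s sl h]]; [exists q => //; rewrite mem_head|exists s => //; rewrite inE sl orbT].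
Qed.

Lemma measurable_hit_at l c : measurable (hit_at l c).
Proof.
elim: l => [|q l IH]; last first.
  by rewrite hit_at_cons; apply: measurableU => //; exact: (measurable_coord hN).
by rewrite (_ : hit_at _ _ = set0) //; rewrite -subset0 => y [].
Qed.

(** A J1-stable surrogate of [hit_at]: the exceedance is required on a neighbourhood of a time of
    [l], with a margin. *)
Definition plateau (l : seq R) (x e : R) : set D :=
  foldr (fun q A => inf_family N q q x e `|` A) set0 l.

Lemma plateauP l x e y :
  plateau l x e y <-> exists2 q, q \in l & inf_family N q q x e y.
Proof.
elim: l => [|q l IH]; first by split => // -[].
split=> /= [[h|/IH[s sl h]]|[s]].
- by exists q => //; rewrite mem_head.
- by exists s => //; rewrite inE sl orbT.
by rewrite inE => /predU1P[->|sl] h; [left|right; apply/IH; exists s].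
Qed.

Lemma stable_plateau l x : J1_stable (plateau l x).
Proof.
elim: l => [|q l IH]; first exact: (stable_cst False).
exact: (stable_setU (stable_inf hN q q x) IH).
Qed.

Lemma measurable_plateau l x e : measurable (plateau l x e).
Proof.
elim: l => [|q l IH]; first exact: measurable0.
exact: (measurableU _ _ (measurable_inf_family hN q q x e) IH).
Qed.

Lemma plateau_exc l x e : {in l, forall q, 0 <= q < 1} -> 0 < e ->
  plateau l x e `<=` exc N 0 1 x.
Proof.
move=> l01 e0 y /plateauP[q ql H]; apply/(exc_left hN); exists q; first exact: l01.
by have := H q ltac:(lra); lra.
Qed.

(* By right-continuity an exceedance lasts for some time, so it is seen from
   finitely many rational times, up to small measure. *)
Lemma plateau_approx x r : 0 < x -> 0 < r -> exists l e,
  [/\ {in l, forall q, 0 <= q < 1}, 0 < e &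
      x `^ (- alpha) * G 1 - r < fine (nu (plateau l x e))].
Proof.
move=> x0 r0.
pose qs i : R := if @unpickle rat i is Some q then ratr q else 0.
pose l m := [seq q <- map qs (iota 0 m) | 0 <= q < 1].
have lP m : {in l m, forall q, 0 <= q < 1} by move=> q; rewrite mem_filter => /andP[].
pose W m := plateau (l m) x m.+1%:R^-1.
have mW m : measurable (W m) by exact: measurable_plateau.
have WE : \bigcup_m W m = exc N 0 1 x.
  apply/seteqP; split => [y [m _]|y [s s01 xs]].
    by apply: plateau_exc => //; rewrite invr_gt0.
  have [e e0 He] : exists2 e, 0 < e & forall t, s < t < s + e -> x + e <= N (y t).
    have /cvgrPdist_lt /(_ ((N (y s) - x) / 2)) := @skorokhod_right _ _ _ hN y s.
    move=> /(_ ltac:(lra)) [e /= e0 eH].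
    pose e' := Num.min e ((N (y s) - x) / 2).
    exists e'; first by rewrite lt_min e0; lra.
    move=> t /andP[st]; rewrite -ltrBlDl /e' lt_min => /andP[te _].
    have := eH t; rewrite /ball_/= => /(_ _ st).
    have -> : `|s - t| < e by rewrite ltr_norml; lra.
    have : Num.min e ((N (y s) - x) / 2) <= (N (y s) - x) / 2 by rewrite ge_min lexx orbT.
    by move=> h1 /(_ isT); rewrite ltr_norml => h2; lra.
  pose h := Num.min e (1 - s).
  have h0 : 0 < h by rewrite lt_min e0; lra.
  have he : h <= e by rewrite ge_min lexx.
  have hs : h <= 1 - s by rewrite ge_min lexx orbT.
  (* A rational time with room h / 3 on both sides inside (s, s + h), where the exceedance
     persists. *)
  have [q] : exists q, ratr q \in `](s + h / 3), (s + h / 2)[ by apply: rat_in_itvoo; lra.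
  rewrite in_itv/= => qE.
  have [m hm] : exists m, m.+1%:R^-1 < h / 3 by apply: natSinv_lt; lra.
  pose M := maxn m (pickle q).+1.
  have hM : M.+1%:R^-1 < h / 3.
    apply: le_lt_trans hm; rewrite lef_pV2 ?posrE// ler_nat.
    by rewrite ltnS leq_maxl.
  exists M => //; apply/plateauP; exists (ratr q).
    rewrite mem_filter; apply/andP; split; first by lra.
    apply/mapP; exists (pickle q); last by rewrite /qs pickleK.
    by rewrite mem_iota leq0n add0n leq_maxr.
  move: hM; move: (M.+1%:R^-1) => w hw t ht.
  by have := He t ltac:(lra); lra.
have ndW : nondecreasing_seq W.
  move=> m n mn; apply/subsetPset => y /plateauP[q ql H].
  apply/plateauP; exists q.
    move: ql; rewrite !mem_filter => /andP[->] /= /mapP[i]; rewrite mem_iota => /andP[_ im] ->.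
    by apply/mapP; exists i => //; rewrite mem_iota (leq_trans im)// leq_add2l.
  have : n.+1%:R^-1 <= m.+1%:R^-1 :> R by rewrite lef_pV2 ?posrE// ler_nat.
  move: (n.+1%:R^-1) (m.+1%:R^-1) H => v w H vw t ht.
  by have := H t ltac:(lra); lra.
have := @nondecreasing_cvg_mu _ _ _ nu W mW (bigcupT_measurable W mW) ndW.
rewrite WE (nu_excE hN hstat hrv tail_gt0 halpha)// subr0 => hh.
have h := @ge0_cvg_fine R _ \oo _ (nu \o W) (x `^ (- alpha) * G 1)%:E isT hh.
have {}h : fine (nu (W m)) @[m --> \oo] --> x `^ (- alpha) * G 1 by exact: h.
near \oo => m; exists (l m), m.+1%:R^-1; split; [exact: lP|by rewrite invr_gt0|].
by rewrite -/(W m); near: m; apply: (cvgr_gt _ h); rewrite gtrBl.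
Unshelve. all: by end_near. Qed.

(** Multiplied by [u], a path of the plateau set exceeds u * x at a time of [l]. Hence [stable_ge]
    bounds the hitting probability below by nearly the limit of the window probability. *)
Lemma hit_at_approx x r : 0 < x -> 0 < r ->
  exists2 l : seq R, {in l, forall q, 0 <= q < 1} &
    \forall u \near +oo,
      probX (exc N 0 1 (u * x)) - probX (hit_at l (u * x)) <= r * p u.
Proof.
move=> x0 r0.
have r3 : 0 < r / 3 by lra.
have [l [e [l01 e0 He]]] := plateau_approx x0 r3.
exists l => //.
have h1 : \forall u \near +oo,
    fine (nu (plateau l x e)) - r / 3 <= probX (hit_at l (u * x)) / p u.
  apply: (@stable_ge _ _ _ hN _ _ _ _ _ hrv tail_gt0 (plateau l x)
    (fun u => hit_at l (u * x)) 0 1 x) => //.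
  - exact: stable_plateau.
  - by move=> e' _; exact: measurable_plateau.
  - by move=> e' e'0; exact: plateau_exc.
  - by move=> u _; exact: measurable_hit_at.
  - move=> e' u e'0 u0 _ [z /plateauP[q ql H] <-]; exists q => //=.
    rewrite (is_normZ hN) gtr0_norm// ltr_pM2l//.
    by have := H q ltac:(lra); lra.
have h2 := probX_exc_cvg hN hstat hrv tail_gt0 halpha ltr01 x0.
near=> u.
have hu1 : fine (nu (plateau l x e)) - r / 3 <= probX (hit_at l (u * x)) / p u.
  by near: u.
have hu2 : probX (exc N 0 1 (u * x)) / p u < x `^ (- alpha) * G 1 + r / 3.
  by near: u; apply: (cvgr_lt _ h2); lra.
rewrite -ler_pdivrMr// mulrBl; lra.
Unshelve. all: by end_near. Qed.

End discretization.

(** * Union bounds and Bonferroni's inequality *)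

Section bonferroni.
Context {R : realType} {d : nat} (N : 'rV[R]_d -> R) (hN : is_norm N).
Local Notation D := (skorokhod R d).
Context (nu : {measure set D -> \bar R}).
Context (disp : measure_display) (Omega : measurableType disp)
  (P : probability Omega R) (X : {RV P >-> D}).
Hypotheses (hstat : stationary X) (hrv : regularly_varying N X nu).
Hypothesis tail_gt0 : forall x, 0 < tailR N X x.
Context (alpha : R) (halpha : tail_index nu alpha).
Context (disp' : measure_display) (Omega' : measurableType disp')
  (P' : probability Omega' R) (Y : {RV P' >-> D}).
Hypothesis hY : tail_process N nu Y.

Local Notation probX := (probX X).

Let mexc a b c : measurable (exc N a b c). Proof. exact: (measurable_exc hN). Qed.
Let mcoord s c : measurable [set y : D | c < N (y s)]. Proof. exact: (measurable_coord hN). Qed.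

Lemma exc_split a b e c : exc N a e c `<=` exc N a b c `|` exc N b e c.
Proof.
move=> y [s hs cs]; have [sb|bs] := ltP s b; first by left; exists s => //; lra.
by right; apply/(exc_left hN); exists s => //; lra.
Qed.

Lemma exc_sub a b a' b' c : a' <= a -> b <= b' -> exc N a b c `<=` exc N a' b' c.
Proof. by move=> aa bb y [s hs cs]; exists s => //; lra. Qed.

Lemma probX_subadditive b c (K : nat) :
  probX (exc N 0 (K%:R * b) c) <= K%:R * probX (exc N 0 b c).
Proof.
elim: K => [|K IH].
  rewrite !mul0r (_ : exc _ _ _ _ = set0) /probX ?preimage_set0 ?measure0//.
  by rewrite -subset0 => y [s]; lra.
rewrite -natr1 !mulrDl !mul1r.
apply: (@le_trans _ _ (probX (exc N 0 (K%:R * b) c) + probX (exc N (K%:R * b) (K%:R * b + b) c))).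
  apply: (le_trans _ (probXU X _ _)) => //; apply: probX_le => //.
    exact: measurableU.
  exact: exc_split.
by rewrite [probX (exc N (_ * _) _ _)](probX_exc hN hstat) addrAC subrr add0r lerD2r.
Qed.

Lemma probX_exc_le b rho c : 0 < b -> 0 <= rho ->
  probX (exc N 0 rho c) <= (rho / b + 1) * probX (exc N 0 b c).
Proof.
move=> b0 rho0; have rb0 : 0 <= rho / b by rewrite divr_ge0// ltW.
have /andP[h1 h2] := truncn_itv rb0.
apply: (@le_trans _ _ ((Num.truncn (rho / b)).+1%:R * probX (exc N 0 b c))); last first.
  by apply: ler_wpM2r; [exact: probX_ge0|rewrite -natr1 lerD2r].
apply: le_trans (probX_subadditive _ _ _); apply: probX_le => //.
by apply: exc_sub => //; rewrite -ler_pdivrMr// ltW.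
Qed.

Definition exc_pair (t rho c : R) : set D := exc N 0 1 c `&` exc N (1 + t) rho c.

Let mpair t rho c : measurable (exc_pair t rho c).
Proof. exact: measurableI. Qed.

(** Union bound over [l]. Shifting [q] to 0 leaves the second window inside (t, rho), since 0 <= q <
    1. *)
Lemma probX_hit_pair l t rho c : {in l, forall q, 0 <= q < 1} ->
  probX (hit_at N l c `&` exc N (1 + t) rho c) <=
  (size l)%:R * probX ([set y : D | c < N (y 0)] `&` exc N t rho c).
Proof.
elim: l => [_|q l IH l01].
  rewrite mul0r (_ : _ `&` _ = set0) /probX ?preimage_set0 ?measure0//.
  by rewrite -subset0 => y [[]].
have q01 : 0 <= q < 1 by apply: l01; rewrite mem_head.
rewrite hit_at_cons setIUl -[size _]/((size l).+1) -natr1 mulrDl mul1r [leRHS]addrC.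
have mh := measurable_hit_at hN l c.
apply: (le_trans (probXU X (measurableI _ _ (mcoord q c) (mexc _ _ _)) (measurableI _ _ mh (mexc _ _ _)))).
apply: lerD; last by apply: IH => q' q'l; apply: l01; rewrite inE q'l orbT.
rewrite -(probX_shift hstat q); last exact: measurableI.
have -> : backshift q @^-1` ([set y : D | c < N (y q)] `&` exc N (1 + t) rho c) =
    [set y : D | c < N (y 0)] `&` exc N (1 + t - q) (rho - q) c.
  rewrite preimage_setI exc_backshift; congr (_ `&` _).
  by apply/seteqP; split => y /=; rewrite subrr.
apply: probX_le; [exact: measurableI|exact: measurableI|].
by apply: setIS; apply: exc_sub; lra.
Qed.

(** Anticlustering speaks of an exceedance at time 0, not somewhere in (0, 1). Finitely many times
    carry the first exceedance, and the discretization error pays for the paths that miss them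
    all. *)
Lemma probX_pair_le l t rho c : {in l, forall q, 0 <= q < 1} ->
  probX (exc_pair t rho c) <=
  probX (exc N 0 1 c) - probX (hit_at N l c) +
  (size l)%:R * probX ([set y : D | c < N (y 0)] `&` exc N t rho c).
Proof.
move=> l01; have mh := measurable_hit_at hN l c.
rewrite -(probXD X (mexc 0 1 c) mh); last first.
  by move=> y [q ql cq]; apply/(exc_left hN); exists q => //; exact: l01.
apply: (@le_trans _ _ (probX (exc N 0 1 c `\` hit_at N l c) +
    probX (hit_at N l c `&` exc N (1 + t) rho c))); last first.
  by rewrite lerD2l; exact: probX_hit_pair.
have m1 : measurable (exc N 0 1 c `\` hit_at N l c) by exact: measurableD.
have m2 : measurable (hit_at N l c `&` exc N (1 + t) rho c) by exact: measurableI.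
apply: (le_trans _ (probXU X m1 m2)); apply: probX_le => //; first exact: measurableU.
by move=> y [h1 h2]; have [h|h] := pselect (hit_at N l c y); [right|left].
Qed.

(** (0, i) is cut into unit cells. A cell ends at [b] at the latest, so once it is shifted to (0, 1)
    the second exceedance lies in (1 + t, rho). *)
Lemma probX_block_pair (b i : nat) t rho c : (i <= b)%N ->
  probX (exc N 0 i%:R c `&` exc N (b%:R + t) rho c) <= i%:R * probX (exc_pair t rho c).
Proof.
elim: i => [_|i IH ib].
  rewrite mul0r (_ : _ `&` _ = set0) /probX ?preimage_set0 ?measure0//.
  by rewrite -subset0 => y [[s]]; lra.
have m1 : measurable (exc N 0 i%:R c `&` exc N (b%:R + t) rho c) by exact: measurableI.
have m2 : measurable (exc N i%:R i.+1%:R c `&` exc N (b%:R + t) rho c) by exact: measurableI.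
rewrite -[in leRHS]natr1 mulrDl mul1r.
apply: (@le_trans _ _ (probX (exc N 0 i%:R c `&` exc N (b%:R + t) rho c) +
    probX (exc N i%:R i.+1%:R c `&` exc N (b%:R + t) rho c))).
  apply: (le_trans _ (probXU X m1 m2)); apply: probX_le => //.
  - exact: measurableI.
  - exact: measurableU.
  by rewrite -setIUl; apply: setSI; exact: exc_split.
apply: lerD; first by apply: IH; exact: ltnW.
rewrite -(probX_shift hstat i%:R m2) preimage_setI !exc_backshift.
have ib' : i%:R + 1 <= b%:R :> R by rewrite natr1 ler_nat.
apply: probX_le => //; first exact: measurableI.
by rewrite -natr1; apply: setISS; apply: exc_sub; have := ler0n R i; lra.
Qed.

(** Induction on the pieces: [A] is the first one, [B] everything after the gap [t]. Removing from
    [A] its intersection with the whole remainder costs one term per piece instead of one per pair,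
    so the error stays linear in [K]. *)
Lemma probX_exc_ge (b K : nat) t rho c : 0 <= t -> K%:R * (b%:R + t) <= rho ->
  K%:R * (probX (exc N 0 b%:R c) - b%:R * probX (exc_pair t rho c)) <=
  probX (exc N 0 (K%:R * (b%:R + t)) c).
Proof.
move=> t0; set s := b%:R + t; have s0 : 0 <= s by rewrite addr_ge0.
elim: K => [|K IH] Ks; first by rewrite mul0r probX_ge0.
have Ks' : K%:R * s <= rho by apply: le_trans Ks; rewrite ler_wpM2r// ler_nat.
have {}IH := IH Ks'.
set A := exc N 0 b%:R c; set B := exc N s (K.+1%:R * s) c.
have mA : measurable A by exact: mexc.
have mB : measurable B by exact: mexc.
have Ks0 : 0 <= K%:R * s by rewrite mulr_ge0.
have KsE : K.+1%:R * s = K%:R * s + s by rewrite -natr1 mulrDl mul1r.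
have BE : probX B = probX (exc N 0 (K%:R * s) c).
  by rewrite /B (probX_exc hN hstat) KsE addrK.
have AB : probX (A `&` B) <= b%:R * probX (exc_pair t rho c).
  apply: le_trans (probX_block_pair _ _ _ (leqnn b)); apply: probX_le; [exact: measurableI|exact: measurableI|].
  by apply: setIS; exact: exc_sub.
have mAB : measurable (A `\` B) by exact: measurableD.
apply: (@le_trans _ _ (probX ((A `\` B) `|` B))); last first.
  apply: probX_le => //; first exact: measurableU.
  have bs : b%:R <= s by rewrite lerDl.
  move=> y [[h _]|h]; apply: exc_sub h => //.
  by rewrite KsE (le_trans bs)// lerDr.
rewrite probXU_disj//; last by rewrite setDKI.
rewrite probXI// BE -natr1 mulrDl mul1r; lra.
Qed.

End bonferroni.

Lemma scaling_cvg (R : realType) (a : R -> R) : scaling_function a ->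
  a T @[T --> +oo] --> +oo.
Proof.
move=> [a0 am au]; apply/cvgryPge => A; have [t t0 At] := au A.
near=> T; apply: (le_trans (ltW At)); apply: (am _ _ t0).
by near: T; apply: nbhs_pinfty_ge; rewrite num_real.
Unshelve. all: by end_near. Qed.

Lemma limf_esup_lt (R : realType) (f : R -> \bar R) (e : R) :
  (limf_esup f +oo%R < e%:E)%E -> \forall T \near +oo, (f T < e%:E)%E.
Proof.
rewrite limf_esupE => /ereal_inf_lt[_ [V FV <-] h].
apply: filterS FV => T VT; apply: le_lt_trans h.
by apply: ereal_sup_ubound; exists T.
Qed.

(** * Anticlustering and the probability of an exceedance in a block *)

Section cluster_asymptotics.
Context {R : realType} {d : nat} (N : 'rV[R]_d -> R) (hN : is_norm N).
Local Notation D := (skorokhod R d).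
Context (nu : {measure set D -> \bar R}).
Context (disp : measure_display) (Omega : measurableType disp)
  (P : probability Omega R) (X : {RV P >-> D}).
Hypotheses (hstat : stationary X) (hrv : regularly_varying N X nu).
Hypothesis tail_gt0 : forall x, 0 < tailR N X x.
Context (alpha : R) (halpha : tail_index nu alpha).
Context (disp' : measure_display) (Omega' : measurableType disp')
  (P' : probability Omega' R) (Y : {RV P' >-> D}).
Hypothesis hY : tail_process N nu Y.

Local Notation G := (nu_sup N nu).
Local Notation p := (tailR N X).
Local Notation probX := (probX X).

Context (a r : R -> R) (ha : scaling_function a) (hr : scaling_function r).
Hypothesis hscale : (T%:E * tail_prob N X (a T))%E @[T --> +oo] --> 1%E.
Hypothesis hAC : anticlustering N X a r.

Local Notation theta := (fine (\int[P']_w (exceedance_time N (Y w))^-1)%E).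

Let mexc b e c : measurable (exc N b e c). Proof. exact: (measurable_exc hN). Qed.
Let mcoord s c : measurable [set y : D | c < N (y s)]. Proof. exact: (measurable_coord hN). Qed.

Lemma sup_on_gt (S : set R) (y : D) c :
  (c%:E < sup_on N S y)%E <-> exists2 s, S s & c < N (y s).
Proof.
split=> [/ereal_sup_gt[_ [s Ss <-]]|[s Ss cs]]; first by rewrite lte_fin => cs; exists s.
apply: (@lt_le_trans _ _ (N (y s))%:E); first by rewrite lte_fin.
by apply: ereal_sup_ubound; exists s.
Qed.

Lemma measurable_exc_annulus (t rho c : R) : 0 <= t ->
  measurable [set y : D | exists2 s, t <= `|s| <= rho & c < N (y s)].
Proof.
move=> t0; have [tr|rt] := leP t rho; last first.
  rewrite (_ : mkset _ = set0) //; rewrite -subset0 => y [s].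
  by move=> /andP[h1 /(le_trans h1)]; rewrite leNgt rt.
have -> : [set y : D | exists2 s, t <= `|s| <= rho & c < N (y s)] =
    exc N t rho c `|` exc N (- rho) (- t) c `|` hit_at N [:: t; rho; - t; - rho] c.
  apply/seteqP; split => y /=.
    move=> [s hs cs]; have [st|] := boolP (s \in [:: t; rho; - t; - rho]).
      by right; exists s.
    rewrite !inE !negb_or => /and4P[/eqP n1 /eqP n2 /eqP n3 /eqP n4].
    left; have [s0|s0] := leP 0 s.
      left; exists s => //; move: hs; rewrite ger0_norm// !lt_neqAle => /andP[-> ->].
      rewrite !andbT; apply/andP; split; apply/eqP => e; [exact: n1|exact: n2].
    right; exists s => //; move: hs; rewrite ltr0_norm// => /andP[h1 h2].
    have {}h1 : s <= - t by lra.
    have {}h2 : - rho <= s by lra.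
    rewrite !lt_neqAle h1 h2 !andbT; apply/andP; split; apply/eqP => e.
      exact: n4.
    exact: n3.
  move=> [[[s hs cs]|[s hs cs]]|[s]].
  - by exists s => //; rewrite ger0_norm; lra.
  - by exists s => //; rewrite ler0_norm; lra.
  rewrite !inE => /or4P[] /eqP -> cs; eexists; try exact: cs; rewrite ?normrN ger0_norm; lra.
apply: measurableU; first exact: measurableU.
exact: measurable_hit_at.
Qed.

Lemma aT_cvg : a T @[T --> +oo] --> +oo. Proof. exact: scaling_cvg. Qed.
Lemma rT_cvg : r T @[T --> +oo] --> +oo. Proof. exact: scaling_cvg. Qed.

Lemma scale_cvg : T * p (a T) @[T --> +oo] --> (1 : R).
Proof.
have h : (T * p (a T))%:E @[T --> +oo] --> (1%:E : \bar R).
  apply: cvg_trans hscale; apply: near_eq_cvg; apply: nearW => T.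
  by rewrite tail_probE.
exact: (@ge0_cvg_fine R R (pinfty_nbhs R) _ _ 1%:E isT h).
Qed.

(** For x >= 1 an exceedance of a_T x at time 0 is one of a_T, the conditioning event. *)
Lemma anticlustering_near (x e : R) : 1 <= x -> 0 < e -> exists2 t, 0 < t &
  \forall T \near +oo,
    probX ([set y : D | a T * x < N (y 0)] `&` exc N t (r T) (a T * x)) <= e * p (a T).
Proof.
move=> x1 e0; have x0 : 0 < x by lra.
have h : \forall t \near +oo, (limf_esup (fun S : R =>
      cond_prob P
        [set w | ((a S * x)%:E <
                  sup_on N [set s | (t <= `|s| <= r S)%R] (X w))%E]
        [set w | (a S < N (X w 0))%R]) +oo%R < e%:E)%E.
  have := hAC x0; move=> /(_ [set z : \bar R | (z < e%:E)%E]); apply.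
  by apply: open_ereal_lt'; rewrite lte_fin.
near +oo_R => t.
have t0 : 0 < t by near: t; exact: nbhs_pinfty_gt.
exists t => //.
have /limf_esup_lt h2 : (limf_esup (fun S : R =>
      cond_prob P
        [set w | ((a S * x)%:E <
                  sup_on N [set s | (t <= `|s| <= r S)%R] (X w))%E]
        [set w | (a S < N (X w 0))%R]) +oo%R < e%:E)%E by near: t.
have aT0 : \forall T \near +oo, 0 <= a T by move/cvgryPge: aT_cvg; exact.
apply: filterS2 aT0 h2 => T {}aT0.
set A := [set w | _]; set B := [set w | _].
pose A' := [set y : D | exists2 s, t <= `|s| <= r T & a T * x < N (y s)].
have AE : A = X @^-1` A' by apply/seteqP; split => w /=; rewrite /A /= sup_on_gt.
have mA : measurable A by rewrite AE; apply: measurable_preimage; apply: measurable_exc_annulus; exact: ltW.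
have mB : measurable B by exact: (@measurable_preimage _ _ _ _ P X _ (mcoord 0 (a T))).
have PB : P B = (p (a T))%:E by exact: tail_probE.
have mAB : measurable (A `&` B) by exact: measurableI.
rewrite /cond_prob PB inver gt_eqF// -(fineK (fin_num_measure P _ mAB)) -EFinM lte_fin.
rewrite ltr_pdivrMr// => /ltW; apply: le_trans; apply: fine_le.
- by rewrite fin_num_measure//; apply: measurable_preimage; exact: measurableI.
- by rewrite fin_num_measure.
apply: le_measure; rewrite ?inE//; first by apply: measurable_preimage; exact: measurableI.
move=> w [/= h0 [s hs cs]]; split.
  by rewrite AE; exists s => //=; rewrite ger0_norm; lra.
by rewrite /B/=; apply: le_lt_trans h0; rewrite ler_peMr.
Unshelve. all: by end_near. Qed.

(** Half of [e] goes to the discretization, which fixes [l]; the other half is shared among the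
    times of [l], which fixes [t]. The successor of [size l] allows [l] to be empty. *)
Lemma pair_near (x e : R) : 1 <= x -> 0 < e -> exists2 t, 0 < t &
  \forall T \near +oo, probX (exc_pair N t (r T) (a T * x)) <= e * p (a T).
Proof.
move=> x1 e0; have x0 : 0 < x by lra.
have e2 : 0 < e / 2 by lra.
have [l l01 hl] := hit_at_approx hN hstat hrv tail_gt0 halpha x0 e2.
have e3 : 0 < e / 2 / (size l).+1%:R by rewrite divr_gt0.
have [t t0 ht] := anticlustering_near x1 e3.
exists t => //; have hl' := aT_cvg hl.
apply: filterS2 ht hl' => T h1 h2.
apply: (le_trans (probX_pair_le hN hstat _ _ _ l01)).
rewrite [e in leRHS](splitr e) mulrDl; apply: lerD => //.
apply: (@le_trans _ _ ((size l).+1%:R * (e / 2 / (size l).+1%:R * p (a T)))).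
  apply: ler_pM => //; last by rewrite ler_nat.
  exact: probX_ge0.
by rewrite mulrA mulrCA divff// mulr1.
Qed.

Lemma probX_exc_aT b x : 0 < b -> 0 < x ->
  probX (exc N 0 b (a T * x)) / p (a T) @[T --> +oo] --> x `^ (- alpha) * G b.
Proof.
move=> b0 x0.
exact: cvg_comp _ _ aT_cvg (probX_exc_cvg hN hstat hrv tail_gt0 halpha b0 x0).
Qed.

Let theta0 : 0 <= theta.
Proof. by apply/fine_ge0/integral_ge0 => w _; rewrite inve_ge0 exceedance_timeE. Qed.

Lemma nu_sup_theta b : 0 <= b -> theta * b <= G b.
Proof.
move=> b0; rewrite -lee_fin EFinM fineK; last first.
  exact: (theta_fin_num hN hstat hrv tail_gt0 halpha hY).
exact: (nu_sup_ge hN hstat hrv tail_gt0 halpha hY).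
Qed.

Lemma block_prob_le x e : 0 < x -> 0 < e -> \forall T \near +oo,
  probX (exc N 0 (r T) (a T * x)) <= (x `^ (- alpha) * theta + e) * (r T * p (a T)).
Proof.
move=> x0 e0; set L := x `^ (- alpha).
have L0 : 0 < L by exact: powR_gt0.
have eL : 0 < e / 4 / L by rewrite !divr_gt0.
have [C C0 HC] := nu_sup_affine hN hstat hrv tail_gt0 halpha hY eL.
(* With this length L * C <= e / 4 * b, so the constant of [nu_sup_affine] costs e / 4 per unit of
   time; the slope error e / 4 / L costs as much again. *)
pose b := 1 + L * C / (e / 4).
have e4 : 0 < e / 4 by lra.
have b0 : 0 < b.
  by rewrite ltr_pwDl//; apply: divr_ge0; [apply: mulr_ge0 => //|]; exact: ltW.
have LGb : L * G b / b <= L * theta + e / 2.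
  rewrite ler_pdivrMr//.
  apply: (@le_trans _ _ (L * (C + (theta + e / 4 / L) * b))).
    by apply: ler_wpM2l; [exact: ltW|apply: HC; exact: ltW].
  have LC : L * C <= e / 4 * b.
    have E : e / 4 * (L * C / (e / 4)) = L * C by rewrite mulrC divfK// gt_eqF//; lra.
    by rewrite /b mulrDr mulr1 E lerDr; lra.
  have Le : L * (e / 4 / L * b) = e / 4 * b by rewrite mulrA mulrCA divff ?mulr1// gt_eqF.
  by rewrite mulrDr mulrDl mulrDr Le; nra.
have h1 := probX_exc_aT b0 x0.
have rpos : \forall T \near +oo, 0 < r T by move/cvgryPgt : rT_cvg; exact.
have h2 : (r T)^-1 @[T --> +oo] --> (0 : R) by apply/(gtr0_cvgV0 rpos); exact: rT_cvg.
have h3 : (b^-1 + (r T)^-1) * (probX (exc N 0 b (a T * x)) / p (a T)) @[T --> +oo] -->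
    (b^-1 + 0) * (L * G b).
  by apply: cvgM h1; apply: cvgD h2; exact: cvg_cst.
have h4 : (b^-1 + 0) * (L * G b) < L * theta + e.
  by rewrite addr0 mulrC; lra.
near=> T.
have rT0 : 0 < r T by near: T; move/cvgryPgt : rT_cvg; exact.
have h5 : (b^-1 + (r T)^-1) * (probX (exc N 0 b (a T * x)) / p (a T)) < L * theta + e.
  by near: T; apply: (cvgr_lt _ h3).
apply: (le_trans (probX_exc_le hN hstat _ b0 (ltW rT0))).
rewrite -ler_pdivrMr; last by rewrite mulr_gt0.
apply: le_trans (ltW h5); rewrite le_eqVlt; apply/orP; left; apply/eqP.
rewrite invfM mulrACA; congr (_ * _).
by rewrite mulrDl mul1r mulrAC divff ?mul1r// gt_eqF.
Unshelve. all: by end_near. Qed.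

Lemma block_prob_ge x e : 1 <= x -> 0 < e -> \forall T \near +oo,
  (x `^ (- alpha) * theta - e) * (r T * p (a T)) <= probX (exc N 0 (r T) (a T * x)).
Proof.
move=> x1 e0; have x0 : 0 < x by lra.
set L := x `^ (- alpha) * theta.
have L0 : 0 <= L by rewrite mulr_ge0// powR_ge0.
have e4 : 0 < e / 4 by lra.
have [t t0 ht] := pair_near x1 e4.
have e8 : 0 < e / 8 by lra.
(* Pieces are so long compared with the gap [t] that L * t < e / 8 * b. *)
pose b := (Num.truncn (L * t / (e / 8))).+1.
have Lt0 : 0 <= L * t / (e / 8) by apply: divr_ge0; [apply: mulr_ge0 => //|]; exact: ltW.
have hb : L * t < e / 8 * b%:R.
  have /andP[_] := truncn_itv Lt0.
  by rewrite ltr_pdivrMr// [e / 8 * _]mulrC.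
have b0 : 0 < b%:R :> R by [].
pose s := b%:R + t; have s0 : 0 < s by rewrite addr_gt0.
have h1 := probX_exc_aT b0 x0.
have LG : L * b%:R <= x `^ (- alpha) * G b%:R.
  by rewrite /L -mulrA ler_wpM2l ?powR_ge0// nu_sup_theta.
near=> T.
have rT0 : 0 < r T by near: T; move/cvgryPgt : rT_cvg; exact.
have rTL : L * b%:R / (e / 8) <= r T by near: T; move/cvgryPge : rT_cvg; exact.
have rTb : b%:R <= r T by near: T; move/cvgryPge : rT_cvg; exact.
have hpair : probX (exc_pair N t (r T) (a T * x)) <= e / 4 * p (a T) by near: T.
have hQ : (L - e / 4) * b%:R < probX (exc N 0 b%:R (a T * x)) / p (a T).
  near: T; apply: (cvgr_gt _ h1); apply: lt_le_trans LG.
  by rewrite ltr_pM2r//; lra.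
(* If L <= e / 2 the left side is nonpositive; otherwise the estimates below may multiply by L - e /
   2 > 0. *)
have [Le|Le] := leP L (e / 2).
  apply: le_trans (probX_ge0 _ _); rewrite mulr_le0_ge0 ?mulr_ge0 ?ltW//; lra.
set K := Num.truncn (r T / s).
have rs0 : 0 <= r T / s by rewrite divr_ge0// ltW.
have /andP[K1 K2] := truncn_itv rs0; rewrite -/K in K1 K2.
have Ks : K%:R * s <= r T by rewrite -ler_pdivlMr.
have := probX_exc_ge hN hstat (a T * x) (ltW t0) Ks.
set Q := probX (exc N 0 b%:R (a T * x)) in hQ *.
set q := probX (exc_pair _ _ _ _) in hpair *.
move=> h2.
have {}h2 : K%:R * (Q - b%:R * q) <= probX (exc N 0 (r T) (a T * x)).
  by apply: (le_trans h2); apply: probX_le => //; exact: exc_sub.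
apply: le_trans h2.
have hQq : b%:R * (L - e / 2) * p (a T) <= Q - b%:R * q.
  rewrite ltr_pdivlMr// in hQ.
  have : b%:R * q <= b%:R * (e / 4 * p (a T)) by rewrite ler_wpM2l.
  move: hQ; rewrite mulrDl mulNr.
  set bp := (e / 4 * b%:R) * p (a T).
  have -> : b%:R * (e / 4 * p (a T)) = bp by rewrite /bp mulrCA mulrA.
  have -> : b%:R * (L - e / 2) * p (a T) = L * b%:R * p (a T) - bp - bp.
    by rewrite /bp; lra.
  rewrite mulrBl -/bp; lra.
apply: le_trans (ler_wpM2l _ hQq) => //.
rewrite !mulrA ler_pM2r//.
have rsK : r T <= K%:R * s + s.
  rewrite -natr1 in K2.
  by have := ltW K2; rewrite ler_pdivrMr// mulrDl mul1r.
rewrite ler_pdivrMr// in rTL.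
have rb : r T - K%:R * t - (b%:R + t) <= K%:R * b%:R by rewrite /s in rsK; lra.
have M0 : 0 < L - e / 2 by lra.
have Kb : K%:R * b%:R <= r T.
  by apply: le_trans Ks; rewrite /s mulrDr lerDl mulr_ge0// ltW.
have KtM : K%:R * t * (L - e / 2) <= r T * (e / 8).
  apply: (@le_trans _ _ (K%:R * (L * t))).
    rewrite -mulrA ler_wpM2l// mulrC ler_wpM2r//; [exact: ltW|lra].
  apply: (@le_trans _ _ (K%:R * b%:R * (e / 8))); last by rewrite ler_wpM2r// ltW.
  by rewrite -mulrA ler_wpM2l// [b%:R * _]mulrC ltW.
have btM : (b%:R + t) * (L - e / 2) <= r T * (e / 4).
  apply: (@le_trans _ _ ((b%:R + t) * L)); first by rewrite ler_wpM2l//; lra.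
  have : b%:R * (e / 8) <= r T * (e / 8) by rewrite ler_wpM2r// ltW.
  rewrite mulrDl; lra.
apply: (@le_trans _ _ ((r T - K%:R * t - (b%:R + t)) * (L - e / 2))); last first.
  by rewrite ler_wpM2r// ltW.
have : 0 <= r T * e by rewrite mulr_ge0// ltW.
rewrite !mulrBl !mulrBr; lra.
Unshelve. all: by end_near. Qed.

(** The Bonferroni lower bound is itself at most 1. Unit windows are used because [nu_sup1_ge1]
    gives them a definite probability, whereas a bound through [block_prob_ge] would be void for
    theta = 0. *)
Lemma block_rate_bounded : exists2 C, 0 < C &
  \forall T \near +oo, r T * p (a T) <= C.
Proof.
have q4 : 0 < 4^-1 :> R by rewrite invr_gt0.
have [t t0 ht] := pair_near (lexx 1) q4.
have h1 := probX_exc_aT ltr01 ltr01; rewrite powR1 mul1r in h1.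
have s0 : 0 < 1 + t by lra.
(* Each of the K windows contributes at least 3/4 - 1/4 = 1/2 of [p (a T)], so K * p (a T) <= 2;
   rounding r_T / (1 + t) adds at most 1. *)
exists (3 * (1 + t)); first by lra.
near=> T.
have rT0 : 0 < r T by near: T; move/cvgryPgt : rT_cvg; exact.
have hpair : probX (exc_pair N t (r T) (a T * 1)) <= 4^-1 * p (a T) by near: T.
have hQ : 3 / 4 < probX (exc N 0 1 (a T * 1)) / p (a T).
  near: T; apply: (cvgr_gt _ h1); apply: lt_le_trans (nu_sup1_ge1 hN hstat hrv tail_gt0 halpha hY).
  by lra.
set K := Num.truncn (r T / (1 + t)).
have rs0 : 0 <= r T / (1 + t) by rewrite divr_ge0// ltW.
have /andP[K1 K2] := truncn_itv rs0; rewrite -/K in K1 K2.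
have Ks : K%:R * (1%:R + t) <= r T by rewrite -ler_pdivlMr.
have := @probX_exc_ge _ _ _ hN _ _ _ _ hstat 1 K t (r T) (a T * 1) (ltW t0) Ks.
have m1 := measurable_exc hN 0 (K%:R * (1%:R + t)) (a T * 1).
move=> /le_trans /(_ (probX_le1 X m1)).
rewrite mul1r ltr_pdivlMr// in hQ *.
move=> h2.
have h3 : p (a T) / 2 <= probX (exc N 0 1 (a T * 1)) - probX (exc_pair N t (r T) (a T * 1)) by lra.
have h4 : K%:R * (p (a T) / 2) <= 1 by apply: le_trans h2; rewrite ler_wpM2l.
have p1 : p (a T) <= 1 by rewrite tailRE; apply: probX_le1; exact: mcoord.
rewrite -natr1 in K2; have {}K2 := ltW K2; rewrite ler_pdivrMr// in K2.
apply: (@le_trans _ _ ((K%:R + 1) * (1 + t) * p (a T))).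
  by rewrite ler_wpM2r// ltW.
rewrite mulrAC ler_pM2r//; lra.
Unshelve. all: by end_near. Qed.

End cluster_asymptotics.

(** * Test functions and the point process of blocks *)

Section clamp.
Context {R : realType}.

Definition clamp (z1 z2 : R) (s : \bar R) : R := fine (mine (maxe s z1%:E) z2%:E).

Lemma clampE z1 z2 (s : R) : clamp z1 z2 s%:E = Num.min (Num.max s z1) z2.
Proof. by rewrite /clamp -EFin_max -EFin_min. Qed.

Lemma clamp_le z1 z2 s : z1 <= z2 -> (s <= z1%:E)%E -> clamp z1 z2 s = z1.
Proof.
move=> z12 sz; rewrite /clamp (max_idPr sz) min_l//.
Qed.

Lemma clamp_ge z1 z2 s : z1 <= z2 -> (z2%:E <= s)%E -> clamp z1 z2 s = z2.
Proof.
move=> z12 sz; rewrite /clamp min_r//; apply: (le_trans sz).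
by rewrite le_max lexx.
Qed.

Lemma clamp_bounds z1 z2 s : z1 <= z2 -> z1 <= clamp z1 z2 s <= z2.
Proof.
move=> z12; case: s => [s| |].
- by rewrite clampE le_min le_max lexx orbT z12 ge_min lexx orbT.
- by rewrite clamp_ge// ?leey// z12 lexx.
- by rewrite clamp_le// ?leNye// z12 lexx.
Qed.

Lemma clamp_gt z1 z2 s c : z1 <= z2 -> z1 <= c -> c < z2 ->
  (c < clamp z1 z2 s) = (c%:E < s)%E.
Proof.
move=> z12 zc cz; case: s => [s| |].
- by rewrite clampE lt_min lt_max cz andbT lte_fin (ltNge c z1) zc orbF.
- by rewrite clamp_ge ?leey// cz ltry.
- by rewrite clamp_le ?leNye// ltNge zc.
Qed.

(** The two additive inequalities express a distance of at most [e] in a form that makes sense for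
    infinite values too. *)
Lemma clamp_lipschitz z1 z2 (s t : \bar R) (e : R) : z1 <= z2 -> 0 <= e ->
  (s <= t + e%:E)%E -> (t <= s + e%:E)%E -> `|clamp z1 z2 s - clamp z1 z2 t| <= e.
Proof.
move=> z12 e0; case: s => [s| |]; case: t => [t| |]//=; rewrite ?subrr ?normr0//.
rewrite -!EFinD !lee_fin => h1 h2.
have spec v : [\/ v <= z1 /\ clamp z1 z2 v%:E = z1, z2 <= v /\ clamp z1 z2 v%:E = z2 |
    z1 <= v <= z2 /\ clamp z1 z2 v%:E = v].
  have [vz|zv] := leP v z1; first by apply: Or31; rewrite clamp_le.
  have [zv'|vz] := leP z2 v; first by apply: Or32; rewrite clamp_ge.
  by apply: Or33; rewrite clampE max_l ?min_l ?ltW.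
by rewrite ler_norml; case: (spec s) => -[hs ->]; case: (spec t) => -[ht ->]; lra.
Qed.

End clamp.

Section test_functions.
Context {R : realType} {d : nat} (N : 'rV[R]_d -> R) (hN : is_norm N).

(** A time change is a bijection of the line, so it leaves the supremum unchanged and only the
    uniform distance counts. *)
Lemma d_infty_tilde_sup_norm (p q : shiftD0 N) (e : R) :
  (d_infty_tilde p q < e%:E)%E ->
  (sup_norm p <= sup_norm q + e%:E)%E /\ (sup_norm q <= sup_norm p + e%:E)%E.
Proof.
move=> /ereal_inf_lt[_ [f /= <- [g /= <- <-]]] /ereal_inf_lt[_ [u [_ _ [v uv vu]] <-]].
rewrite gt_max => /andP[He _]; rewrite !sup_norm_class.
have H t : N (f (u t) - g t) <= e.
  rewrite -lee_fin; apply: le_trans (ltW He); apply: ereal_sup_ubound.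
  by exists t.
split; apply: ge_ereal_sup => _ [t _ <-].
  rewrite -[t]vu; apply: (@le_trans _ _ (N (g (v t)) + e)%:E).
    rewrite lee_fin; have := is_normD hN (f (u (v t)) - g (v t)) (g (v t)).
    by rewrite subrK; have := H (v t); lra.
  rewrite EFinD leeD2r//; apply: ereal_sup_ubound; by exists (v t).
apply: (@le_trans _ _ (N (f (u t)) + e)%:E).
  rewrite lee_fin; have := is_normD hN (g t - f (u t)) (f (u t)).
  by rewrite subrK -opprB (is_normN hN); have := H t; lra.
rewrite EFinD leeD2r//; apply: ereal_sup_ubound; by exists (u t).
Qed.

Lemma clamp_sup_norm_continuous z1 z2 : z1 <= z2 ->
  continuous (fun q : shiftD0 N => clamp z1 z2 (sup_norm q)).
Proof.
move=> z12 q; apply/(@cvgrPdist_lt R R _ (nbhs q)) => e e0.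
set g := fun q : shiftD0 N => clamp z1 z2 (sup_norm q).
apply: open_nbhs_nbhs; split; last by rewrite /= subrr normr0.
suff : shiftD0_open (fun q' => `|g q - g q'| < e) by [].
move=> p gp; exists ((e - `|g q - g p|) / 2); first by rewrite /= in gp *; lra.
move=> q' /d_infty_tilde_sup_norm[h1 h2].
have e2 : 0 <= (e - `|g q - g p|) / 2 by rewrite /= in gp *; lra.
have := clamp_lipschitz z12 e2 h1 h2; rewrite -/(g p) -/(g q') => h3.
have := ler_distD (g p) (g q) (g q'); rewrite /= in gp *; lra.
Qed.

Definition cut (A1 A2 t : R) : R := Num.min 1 (Num.max 0 ((A2 - t) / (A2 - A1))).

Lemma cut_bounds A1 A2 t : 0 <= cut A1 A2 t <= 1.
Proof. by rewrite le_min ler01 le_max lexx ge_min lexx. Qed.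

Lemma cut_eq1 A1 A2 t : A1 < A2 -> t <= A1 -> cut A1 A2 t = 1.
Proof.
move=> A12 tA; apply/min_idPl; rewrite le_max; apply/orP; right.
by rewrite ler_pdivlMr ?subr_gt0// mul1r; lra.
Qed.

Lemma cut_eq0 A1 A2 t : A1 < A2 -> A2 <= t -> cut A1 A2 t = 0.
Proof.
move=> A12 tA; rewrite /cut (max_idPl _) ?min_r ?ler01//.
by rewrite ler_pdivrMr ?subr_gt0// mul0r; lra.
Qed.

Lemma cut_continuous A1 A2 : continuous (cut A1 A2).
Proof.
move=> t; have h : {for t, continuous (fun u => (A2 - u) / (A2 - A1))}.
  by apply: cvgMr_tmp; apply: cvgB; [exact: cvg_cst|exact: cvg_id].
have h1 : {for t, continuous (cst (0 : R) \max (fun u => (A2 - u) / (A2 - A1)))}.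
  by apply: continuous_max => //; exact: cst_continuous.
have h2 : {for t, continuous (cst (1 : R))} by exact: cst_continuous.
exact: (continuous_min h2 h1).
Qed.

Definition ramp (z1 z2 : R) (q : shiftD0 N) : R :=
  (clamp z1 z2 (sup_norm q) - z1) / (z2 - z1).

Lemma ramp_bounds z1 z2 q : z1 < z2 -> 0 <= ramp z1 z2 q <= 1.
Proof.
move=> z12; have /andP[h1 h2] := clamp_bounds (sup_norm q) (ltW z12).
rewrite /ramp; apply/andP; split; first by rewrite divr_ge0// subr_ge0// ltW.
by rewrite ler_pdivrMr ?subr_gt0// mul1r lerD2r.
Qed.

Lemma ramp_eq0 z1 z2 q : z1 < z2 -> (sup_norm q <= z1%:E)%E -> ramp z1 z2 q = 0.
Proof. by move=> z12 h; rewrite /ramp clamp_le ?subrr ?mul0r// ltW. Qed.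

Lemma ramp_eq1 z1 z2 q : z1 < z2 -> (z2%:E <= sup_norm q)%E -> ramp z1 z2 q = 1.
Proof.
by move=> z12 h; rewrite /ramp clamp_ge ?divff ?subr_eq0 ?gt_eqF// ltW.
Qed.

(** A continuous function between [k] times the indicators of {t <= A1, y^* >= z2} and of {t < A2,
    y^* > z1}; the first yields upper bounds on Laplace functionals, the second lower bounds. *)
Definition testf (k A1 A2 z1 z2 : R) (x : R * shiftD0 N) : R :=
  k * (cut A1 A2 x.1 * ramp z1 z2 x.2).

Lemma sup_norm_zero : sup_norm (shift_zero N) = 0%E.
Proof.
rewrite /shift_zero sup_norm_class /sup_on.
rewrite (_ : [set _ | _ in _] = [set 0%E]) ?ereal_sup1//.
apply/seteqP; split => [_ [t _ <-] /=|_ ->]; first by rewrite (is_norm0 hN).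
by exists 0 => //=; rewrite (is_norm0 hN).
Qed.

Lemma testf_test_function k A1 A2 z1 z2 : 0 <= k -> 0 < A2 -> A1 < A2 ->
  0 < z1 -> z1 < z2 -> test_function (testf k A1 A2 z1 z2).
Proof.
move=> k0 A20 A12 z10 z12; split.
- apply: continuous_subspaceT => x; rewrite /testf; apply: cvgM; first exact: cvg_cst.
  apply: cvgM.
    apply: (@cvg_comp _ _ _ fst (cut A1 A2) _ (nbhs x.1)); first exact: cvg_fst.
    exact: cut_continuous.
  apply: (@cvg_comp _ _ _ snd (ramp z1 z2) _ (nbhs x.2)); first exact: cvg_snd.
  rewrite /ramp; apply: cvgMr_tmp; apply: cvgB; last exact: cvg_cst.
  by apply: clamp_sup_norm_continuous; exact: ltW.
- move=> x _; have /andP[c0 _] := cut_bounds A1 A2 x.1.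
  have /andP[r0 _] := ramp_bounds x.2 z12; rewrite /testf.
  by apply: mulr_ge0 => //; exact: mulr_ge0.
- exists k => x _; have /andP[c0 c1] := cut_bounds A1 A2 x.1.
  have /andP[r0 r1] := ramp_bounds x.2 z12.
  by rewrite /testf; apply: ler_piMr => //; exact: mulr_ile1.
- exists A2, z1; split => // x [x0 _] [xA|xz]; rewrite /testf.
    by rewrite cut_eq0 ?mul0r ?mulr0//; move: xA; rewrite ger0_norm// => /ltW.
  by rewrite ramp_eq0// !mulr0.
- by move=> t; rewrite /testf /= ramp_eq0 ?mulr0// sup_norm_zero lee_fin ltW.
Qed.

End test_functions.

Section expectation_bounds.
Context (disp : measure_display) (Omega : measurableType disp) (R : realType)
  (P : probability Omega R).

Lemma expectation_le_split (g : Omega -> R) (A : set Omega) (c : R) :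
  measurable A -> measurable_fun setT g -> (forall w, 0 <= g w) -> 0 <= c ->
  (forall w, A w -> g w <= c) -> (forall w, ~ A w -> g w <= 1) ->
  fine 'E_P[g] <= c * fine (P A) + (1 - fine (P A)).
Proof.
move=> mA mg g0 c0 gA gAc; have mAC := measurableC mA.
have PA : P A \is a fin_num by exact: fin_num_measure.
have PAC : P (~` A) \is a fin_num by exact: fin_num_measure.
have mgE : measurable_fun setT (EFin \o g) by exact/measurable_EFinP.
have H : ('E_P[g] <= (c * fine (P A) + fine (P (~` A)))%:E)%E.
  rewrite unlock -(setUv A) ge0_integral_setU//; last 3 first.
  - by rewrite setUv.
  - by move=> w _; rewrite lee_fin.
  - by apply/disj_setPS => w [].
  rewrite EFinD EFinM !fineK//; apply: leeD.
    rewrite -integral_cst//; apply: ge0_le_integral => //.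
    - by move=> w _; rewrite lee_fin.
    - exact: measurable_funTS.
  rewrite -[leRHS]mul1e -integral_cst//; apply: ge0_le_integral => //.
  - by move=> w _; rewrite lee_fin.
  - exact: measurable_funTS.
have E0 : (0 <= 'E_P[g])%E by rewrite unlock; apply: integral_ge0 => w _; rewrite lee_fin.
have -> : 1 - fine (P A) = fine (P (~` A)).
  by rewrite probability_setC// fineB//.
by rewrite -lee_fin fineK// ge0_fin_numE// (le_lt_trans H)// ltry.
Qed.

Lemma expectation_ge_prob (g : Omega -> R) (A : set Omega) :
  measurable A -> measurable_fun setT g -> (forall w, 0 <= g w <= 1) ->
  (forall w, A w -> 1 <= g w) -> fine (P A) <= fine 'E_P[g].
Proof.
move=> mA mg g01 gA.
have mgE : measurable_fun setT (EFin \o g) by exact/measurable_EFinP.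
have E1 : ('E_P[g] <= 1)%E.
  rewrite unlock -(probability_setT P) -[leRHS]mul1e -integral_cst//; apply: ge0_le_integral => //.
  - by move=> w _; rewrite lee_fin; case/andP: (g01 w).
  - by move=> w _; rewrite lee_fin; case/andP: (g01 w).
have E0 : (0 <= 'E_P[g])%E.
  by rewrite unlock; apply: integral_ge0 => w _; rewrite lee_fin; case/andP: (g01 w).
apply: fine_le.
- exact: fin_num_measure.
- by rewrite ge0_fin_numE// (le_lt_trans E1)// ltry.
rewrite unlock -(setIT A) -integral_indic//; apply: ge0_le_integral => //.
- by apply/measurable_EFinP; exact: measurable_indic.
- move=> w _; rewrite lee_fin indicE; case: (boolP (w \in A)) => [/set_mem/gA//|_].
  by case/andP: (g01 w).
Qed.

End expectation_bounds.

Section sup_events.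
Context {R : realType} {d : nat} (N : 'rV[R]_d -> R) (hN : is_norm N).
Local Notation D := (skorokhod R d).

Lemma sup_on_le (A : set R) (y : D) c :
  (sup_on N A y <= c%:E)%E <-> forall s, A s -> N (y s) <= c.
Proof.
split=> [h s As|h]; last by apply: ge_ereal_sup => _ [s As <-]; rewrite lee_fin h.
by rewrite -lee_fin; apply: le_trans h; apply: ereal_sup_ubound; exists s.
Qed.

Lemma measurable_sup_on_le (L c : R) :
  measurable [set y : D | (sup_on N `[0%R, L] y <= c%:E)%E].
Proof.
have [L0|L0] := ltP L 0.
  rewrite (_ : [set _ | _] = setT)//; apply/seteqP; split => // y _.
  by apply/sup_on_le => s /=; rewrite in_itv/=; lra.
rewrite (_ : [set _ | _] = ~` (exc N 0 L c `|` [set y : D | c < N (y L)])).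
  apply: measurableC; apply: measurableU; first exact: (measurable_exc hN).
  exact: (measurable_coord hN).
apply/seteqP; split => y; first move=> /sup_on_le h.
  move=> [[s hs]|/=]; rewrite ltNge => /negP; apply; apply: h; rewrite /= in_itv/=; lra.
move=> h; apply/sup_on_le => s; rewrite /= in_itv/= => /andP[s0].
rewrite le_eqVlt leNgt => /orP[/eqP->|sL]; apply/negP => cs; apply: h; first by right.
by left; apply/(exc_left hN); exists s; rewrite ?s0.
Qed.

Context (disp : measure_display) (Omega : measurableType disp)
  (P : probability Omega R) (X : {RV P >-> D}).

Lemma measurable_sup_le (L c : R) :
  measurable [set w | (sup_on N `[0%R, L] (X w) <= c%:E)%E].
Proof. exact: (measurable_preimage X (measurable_sup_on_le L c)). Qed.

End sup_events.

(** * Laplace functionals of the blocks *)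

Section blocks.
Context {R : realType} {d : nat} (N : 'rV[R]_d -> R) (hN : is_norm N).
Local Notation D := (skorokhod R d).
Context (disp : measure_display) (Omega : measurableType disp)
  (P : probability Omega R) (X : {RV P >-> D}).
Hypotheses (hstat : stationary X).
Context (a r : R -> R) (S : R) (S0 : 0 < S) (aS0 : 0 < a S) (rS0 : 0 < r S).
Context (k A1 A2 z1 z2 : R) (k0 : 0 <= k) (A20 : 0 < A2) (A12 : A1 < A2)
  (z10 : 0 < z1) (z12 : z1 < z2).

Local Notation f := (testf k A1 A2 z1 z2 : R * shiftD0 N -> R).
Local Notation bv := (block_value X a r f S).

Definition block_exc (z : R) (i : nat) : set D :=
  exc N ((i%:R - 1) * r S) (i%:R * r S) (a S * z).

(** c >= 0 rules out the times outside the block, where the restricted path is 0; [exc_left] handles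
    the half-open block. *)
Lemma block_sup_gt i w c : 0 <= c ->
  (c%:E < sup_norm (shift_class N (block X a r S i w)))%E <-> block_exc c i (X w).
Proof.
move=> c0; rewrite sup_norm_class sup_on_gt; split=> [[s _ /=]|/(exc_left hN)[s hs cs]].
  case: ifP => hs; last by rewrite (is_norm0 hN) ltNge c0.
  rewrite (is_normZ hN) gtr0_norm ?invr_gt0// mulrC ltr_pdivlMr// mulrC => cs.
  by apply/(exc_left hN); exists s.
exists s => //=; rewrite hs (is_normZ hN) gtr0_norm ?invr_gt0//.
by rewrite mulrC ltr_pdivlMr// mulrC.
Qed.

Lemma block_value_bounds i w : 0 <= bv i w <= k.
Proof.
rewrite /block_value /testf /=; set q := shift_class _ _.
have /andP[c0 c1] := cut_bounds A1 A2 (i%:R * r S / S).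
have /andP[r0 r1] := ramp_bounds q z12.
apply/andP; split; first by apply: mulr_ge0 => //; exact: mulr_ge0.
by apply: ler_piMr => //; exact: mulr_ile1.
Qed.

Lemma block_value_late i w : A2 <= i%:R * r S / S -> bv i w = 0.
Proof. by move=> h; rewrite /block_value /testf /= cut_eq0// mul0r mulr0. Qed.

Lemma block_value_low i w : ~ block_exc z1 i (X w) -> bv i w = 0.
Proof.
move=> h; rewrite /block_value /testf /= ramp_eq0 ?mulr0// leNgt.
by apply/negP => /(block_sup_gt _ _ (ltW z10)).
Qed.

Lemma block_value_high i w : i%:R * r S / S <= A1 -> block_exc z2 i (X w) -> bv i w = k.
Proof.
move=> h1 h2; rewrite /block_value /testf /= cut_eq1// mul1r ramp_eq1 ?mulr1//.
by apply: ltW; apply/block_sup_gt => //; exact/ltW/(lt_trans z10).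
Qed.

Lemma measurable_block_exc z i : measurable (X @^-1` (block_exc z i)).
Proof. by apply: measurable_preimage; exact: (measurable_exc hN). Qed.

Lemma measurable_block_value i : measurable_fun setT (bv i).
Proof.
rewrite /block_value /testf /=; apply: measurable_funM; first exact: measurable_cst.
apply: measurable_funM; first exact: measurable_cst.
rewrite /ramp; apply: measurable_funM; last exact: measurable_cst.
apply: measurable_funB; last exact: measurable_cst.
apply: (measurability _ (RGenOInfty.measurableE R)).
move=> _ [_ [c ->] <-]; rewrite setTI.
have [cz|zc] := ltP c z1.
  rewrite (_ : _ @^-1` _ = setT)//; apply/seteqP; split => // w _ /=.
  rewrite in_itv/= andbT; apply: (lt_le_trans cz).
  by have /andP[] := clamp_bounds (sup_norm (shift_class N (block X a r S i w))) (ltW z12).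
have [zc2|cz2] := leP z2 c.
  rewrite (_ : _ @^-1` _ = set0)//; rewrite -subset0 => w /=.
  rewrite in_itv/= andbT ltNge; apply/negP; rewrite negbK; apply: le_trans zc2.
  by have /andP[] := clamp_bounds (sup_norm (shift_class N (block X a r S i w))) (ltW z12).
rewrite (_ : _ @^-1` _ = X @^-1` (block_exc c i)); first exact: measurable_block_exc.
have c0 : 0 <= c by exact: le_trans (ltW z10) zc.
apply/seteqP; split => w /=; rewrite in_itv/= andbT (clamp_gt _ (ltW z12) zc cz2).
  by move/(block_sup_gt _ _ c0).
by move=> h; apply/(block_sup_gt _ _ c0).
Qed.

(** From this index on the cut vanishes, which makes the infinite sum and the infinite product
    finite. *)
Definition nblocks := (Num.truncn (A2 * S / r S)).+1.

Lemma nblocks_late i : (nblocks <= i)%N -> A2 <= i%:R * r S / S.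
Proof.
move=> ni; have h : 0 <= A2 * S / r S by rewrite divr_ge0 ?mulr_ge0 ?ltW.
have /andP[_ h2] := truncn_itv h.
rewrite ler_pdivlMr// -ler_pdivrMr//; apply: (le_trans (ltW h2)).
by rewrite ler_nat.
Qed.

Lemma sum_stationary_tail (u : nat -> R) m n : (m <= n)%N ->
  (forall i, (m <= i)%N -> u i = 0) ->
  \sum_(1 <= i < n) u i = \sum_(1 <= i < m) u i.
Proof.
move=> mn u0; case: m mn u0 => [_ u0|m mn u0].
  by rewrite !big1_seq// => i; rewrite u0.
rewrite (@big_cat_nat _ _ _ m.+1)//= [X in _ + X]big_nat_cond.
by rewrite [X in _ + X]big1 ?addr0// => i /andP[/andP[mi _] _]; exact: u0.
Qed.

Lemma block_processE w :
  block_process X a r f S w = \sum_(1 <= i < nblocks) bv i w.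
Proof.
apply: lim_near_cst => //; near=> n.
apply: sum_stationary_tail; first by near: n; exact: nbhs_infty_ge.
by move=> i /nblocks_late; exact: block_value_late.
Unshelve. all: by end_near. Qed.

Local Notation q z := (probX X (exc N 0 (r S) (a S * z))).
Local Notation E g := (fine 'E_P[g]).

Lemma probX_block_exc z i : fine (P (X @^-1` block_exc z i)) = q z.
Proof.
rewrite /block_exc -[fine _]/(probX X _) (probX_exc hN hstat); congr probX.
by congr (exc N _ _ _); rewrite mulrBl mul1r; lra.
Qed.

Lemma measurable_expR_block_value i : measurable_fun setT (fun w => expR (- bv i w)).
Proof.
apply: measurableT_comp; first exact: measurable_expR.
by apply: measurableT_comp => //; exact: measurable_block_value.
Qed.

Lemma measurable_expR_block_process :
  measurable_fun setT (fun w => expR (- block_process X a r f S w)).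
Proof.
apply: measurableT_comp; first exact: measurable_expR.
apply: measurableT_comp => //.
rewrite (_ : block_process _ _ _ _ _ = fun w => \sum_(1 <= i < nblocks) bv i w); last first.
  by apply/funext => w; exact: block_processE.
by apply: measurable_sum => i; exact: measurable_block_value.
Qed.

Lemma expR_block_value_bounds i w : 0 <= expR (- bv i w) <= 1.
Proof.
have /andP[h _] := block_value_bounds i w.
by rewrite expR_ge0 -expR0 ler_expR oppr_le0.
Qed.

Lemma expectation_block_ge i : 1 - q z1 <= E (fun w => expR (- bv i w)).
Proof.
rewrite -(probX_block_exc z1 i).
rewrite (_ : 1 - _ = fine (P (~` (X @^-1` block_exc z1 i)))); last first.
  rewrite probability_setC; last exact: measurable_block_exc.
  by rewrite fineB// fin_num_measure//; exact: measurable_block_exc.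
apply: expectation_ge_prob.
- by apply: measurableC; exact: measurable_block_exc.
- exact: measurable_expR_block_value.
- exact: expR_block_value_bounds.
- by move=> w /block_value_low ->; rewrite oppr0 expR0.
Qed.

Lemma expectation_block_le i : i%:R * r S / S <= A1 ->
  E (fun w => expR (- bv i w)) <= 1 - (1 - expR (- k)) * q z2.
Proof.
move=> iA; rewrite -(probX_block_exc z2 i).
apply: (@le_trans _ _ (expR (- k) * fine (P (X @^-1` block_exc z2 i)) +
  (1 - fine (P (X @^-1` block_exc z2 i))))); last by lra.
apply: expectation_le_split.
- exact: measurable_block_exc.
- exact: measurable_expR_block_value.
- by move=> w; exact: expR_ge0.
- exact: expR_ge0.
- by move=> w /(block_value_high iA) ->.
- by move=> w _; case/andP: (expR_block_value_bounds i w).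
Qed.

Lemma expectation_block01 i : 0 <= E (fun w => expR (- bv i w)) <= 1.
Proof.
apply/andP; split.
  apply: fine_ge0; rewrite unlock; apply: integral_ge0 => w _; rewrite lee_fin; exact: expR_ge0.
have m0 : measurable (set0 : set Omega) by [].
have h0 w : 0 <= expR (- bv i w) by exact: expR_ge0.
have h1 w : ~ (set0 : set Omega) w -> expR (- bv i w) <= 1.
  by move=> _; case/andP: (expR_block_value_bounds i w).
have h2 w : (set0 : set Omega) w -> expR (- bv i w) <= 0 by [].
have := expectation_le_split P m0 (measurable_expR_block_value i) h0 (lexx 0) h2 h1.
by rewrite measure0 /= mul0r add0r subr0.
Qed.

Lemma expectation_block_late i : (nblocks <= i)%N -> E (fun w => expR (- bv i w)) = 1.
Proof.
move=> /nblocks_late iA; rewrite (_ : (fun _ => _) = cst 1).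
  by rewrite expectation_cst.
by apply/funext => w; rewrite block_value_late// oppr0 expR0.
Qed.

Definition block_prod := \prod_(1 <= i < nblocks) E (fun w => expR (- bv i w)).

Lemma block_prodE :
  limn (fun n => \prod_(1 <= i < n) E (fun w => expR (- bv i w))) = block_prod.
Proof.
apply: lim_near_cst => //; near=> n.
have ln : (nblocks <= n)%N by near: n; exact: nbhs_infty_ge.
rewrite (@big_cat_nat _ _ _ nblocks)//=.
rewrite [X in _ * X]big_nat_cond [X in _ * X]big1 ?mulr1// => i /andP[/andP[li _] _].
exact: expectation_block_late.
Unshelve. all: by end_near. Qed.

Let q01 z : 0 <= q z <= 1.
Proof.
by apply/andP; split; [exact: probX_ge0|apply: probX_le1; exact: (measurable_exc hN)].
Qed.

(** Only the blocks ending by A1 * S are kept, at least A1 * S / r S - 1 of them, with 1 - u <=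
    exp(-u) for each; the other factors are at most 1. *)
Lemma block_prod_le : block_prod <= expR (- ((1 - expR (- k)) * q z2 * (A1 * S / r S - 1))).
Proof.
set m := Num.truncn (A1 * S / r S).
have hm : A1 * S / r S - 1 <= m%:R.
  have [h0|h0] := leP 0 (A1 * S / r S).
    have /andP[_] := truncn_itv h0; rewrite -natr1 -/m; lra.
  by apply: le_trans (ler0n _ _); lra.
have im i : (0 < i)%N -> (i <= m)%N -> i%:R * r S / S <= A1.
  move=> i0 ilem; rewrite ler_pdivrMr// -ler_pdivlMr//.
  have [h0|h0] := leP 0 (A1 * S / r S); last first.
    move: (leq_trans i0 ilem); rewrite /m truncn_gt0; lra.
  have /andP[h1 _] := truncn_itv h0.
  by apply: le_trans h1; rewrite ler_nat.
have mn : (m.+1 <= nblocks)%N.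
  rewrite ltnS; apply: le_truncn; rewrite !ler_pM2r ?invr_gt0//; exact: ltW.
have /andP[q0 q1] := q01 z2.
have k1 : 0 <= 1 - expR (- k) by rewrite subr_ge0 -expR0 ler_expR oppr_le0.
rewrite /block_prod (@big_cat_nat _ _ _ m.+1)//=.
set u := (1 - expR (- k)) * q z2.
have u0 : 0 <= u by exact: mulr_ge0.
apply: (@le_trans _ _ (\prod_(1 <= i < m.+1) expR (- u) * 1)); last first.
  rewrite mulr1 prodr_const_nat subn1 /= -expRM_natl ler_expR mulrN lerN2 mulrC.
  exact: ler_wpM2r.
apply: ler_pM.
- by apply: prodr_ge0 => i _; case/andP: (expectation_block01 i).
- by apply: prodr_ge0 => i _; case/andP: (expectation_block01 i).
- rewrite !big_nat; apply: ler_prod => i /andP[i0 im1].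
  have /andP[-> _] /= := expectation_block01 i.
  apply: (le_trans (expectation_block_le (im i i0 im1))).
  exact: expR_ge1Dx.
- by apply: prodr_ile1 => i _; exact: expectation_block01.
Qed.

(** 1 / (1 - q) = 1 + q / (1 - q) <= exp(q / (1 - q)) bounds each factor below, and there are at
    most A2 * S / r S factors. *)
Lemma block_prod_ge : q z1 < 1 ->
  expR (- (A2 * S / r S * (q z1 / (1 - q z1)))) <= block_prod.
Proof.
move=> q1; have /andP[q0 _] := q01 z1.
have h1 : expR (- (q z1 / (1 - q z1))) <= 1 - q z1.
  have l0 : 0 < 1 - q z1 by rewrite subr_gt0.
  rewrite -[leRHS]invrK expRN lef_pV2 ?posrE ?invr_gt0 ?expR_gt0//.
  apply: le_trans (expR_ge1Dx _).
  by rewrite -lerBlDr -{1}[_^-1]div1r -mulrBl divff ?lexx// lt0r_neq0.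
have h0 : 0 <= A2 * S / r S by rewrite divr_ge0 ?mulr_ge0 ?ltW.
have /andP[h2 _] := truncn_itv h0.
apply: (@le_trans _ _ (\prod_(1 <= i < nblocks) expR (- (q z1 / (1 - q z1))))).
  rewrite prodr_const_nat /nblocks subn1 /= -expRM_natl ler_expR mulrN lerN2.
  by apply: ler_wpM2r => //; rewrite divr_ge0// subr_ge0 ltW.
apply: ler_prod => i _; rewrite expR_ge0/=; apply: (le_trans h1).
exact: expectation_block_ge.
Qed.

Lemma block_process_ge0 w : 0 <= block_process X a r f S w.
Proof.
rewrite block_processE; apply: sumr_ge0 => i _.
by case/andP: (block_value_bounds i w).
Qed.

Lemma block_process_eq0 w :
  (forall s, 0 <= s <= A2 * S -> N (X w s) <= a S * z1) ->
  block_process X a r f S w = 0.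
Proof.
move=> H; rewrite block_processE big_nat_cond big1// => i /andP[/andP[i0 _] _].
have [iA|Ai] := leP A2 (i%:R * r S / S); first exact: block_value_late.
apply: block_value_low => -[s /andP[s1 s2] cs].
rewrite ltNge in cs; move/negP : cs; apply; apply: H.
rewrite ltr_pdivrMr// in Ai; apply/andP; split; last exact/ltW/(lt_trans s2).
by apply: le_trans (ltW s1); rewrite mulr_ge0 ?subr_ge0 ?ler1n// ltW.
Qed.

(** The block containing [s] ends by L + r S <= A1 * S, where the cut still equals 1, so it
    contributes [k] alone. *)
Lemma block_process_ge L w s : L + r S <= A1 * S -> 0 <= s <= L ->
  a S * z2 < N (X w s) -> k <= block_process X a r f S w.
Proof.
move=> LA /andP[s0 sL] cs; set i := (Num.truncn (s / r S)).+1.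
have sr : 0 <= s / r S by rewrite divr_ge0// ltW.
have /andP[i1 i2] := truncn_itv sr; rewrite -/i in i2.
rewrite ler_pdivlMr// in i1; rewrite ltr_pdivrMr// in i2.
have iE : i%:R - 1 = (Num.truncn (s / r S))%:R :> R by rewrite /i -natr1 addrK.
have ir : i%:R * r S <= A1 * S by move: i1; rewrite -iE mulrBl mul1r; lra.
have iA : i%:R * r S / S <= A1 by rewrite ler_pdivrMr.
have il : (i < nblocks)%N.
  by rewrite ltnNge; apply/negP => /nblocks_late /le_trans /(_ iA); rewrite leNgt A12.
have ev : block_exc z2 i (X w).
  by apply/(exc_left hN); exists s => //; rewrite iE i1 i2.
rewrite block_processE (bigD1_seq i) ?iota_uniq ?mem_index_iota//=.
rewrite (block_value_high iA ev) lerDl; apply: sumr_ge0 => j _.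
by case/andP: (block_value_bounds j w).
Qed.

Let expR_bp w : 0 <= expR (- block_process X a r f S w) <= 1.
Proof. by rewrite expR_ge0 -expR0 ler_expR oppr_le0 block_process_ge0. Qed.

Lemma sup_le_expectation :
  fine (P [set w | (sup_on N `[0%R, (A2 * S)%R] (X w) <= (a S * z1)%:E)%E]) <=
  E (fun w => expR (- block_process X a r f S w)).
Proof.
apply: expectation_ge_prob.
- exact: (measurable_sup_le hN).
- exact: measurable_expR_block_process.
- exact: expR_bp.
- by move=> w /= /sup_on_le H; rewrite block_process_eq0 ?oppr0 ?expR0.
Qed.

Lemma expectation_le_sup L : 0 <= L -> L + r S <= A1 * S ->
  E (fun w => expR (- block_process X a r f S w)) <=
  fine (P [set w | (sup_on N `[0%R, L] (X w) <= (a S * z2)%:E)%E]) + expR (- k).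
Proof.
move=> L0 LA; set Ev := [set w | _].
have mEv : measurable Ev by exact: (measurable_sup_le hN).
have mEvC := measurableC mEv.
have h0 w : 0 <= expR (- block_process X a r f S w) by exact: expR_ge0.
have h1 w : ~ (~` Ev) w -> expR (- block_process X a r f S w) <= 1.
  by move=> _; case/andP: (expR_bp w).
have h2 w : (~` Ev) w -> expR (- block_process X a r f S w) <= expR (- k).
  move=> h; rewrite ler_expR lerN2; apply: contrapT => hk; apply: h.
  apply/sup_on_le => s; rewrite /= in_itv /= => hs; rewrite leNgt; apply/negP => cs.
  by apply: hk; exact: (block_process_ge LA hs).
have := expectation_le_split P mEvC measurable_expR_block_process h0 (expR_ge0 _) h2 h1.
move/le_trans; apply; rewrite probability_setC// fineB ?fin_num_measure//=.
have : 0 <= fine (P Ev) by exact/fine_ge0/measure_ge0.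
have : 0 <= expR (- k) by exact: expR_ge0.
have : fine (P Ev) <= 1 by rewrite -lee_fin fineK ?fin_num_measure//; exact: probability_le1.
by nra.
Qed.

End blocks.

(** * The limit of the maximum *)

Section cluster_limit.
Context {R : realType} {d : nat} (N : 'rV[R]_d -> R) (hN : is_norm N).
Local Notation D := (skorokhod R d).
Context (nu : {measure set D -> \bar R}).
Context (disp : measure_display) (Omega : measurableType disp)
  (P : probability Omega R) (X : {RV P >-> D}).
Hypotheses (hstat : stationary X) (hrv : regularly_varying N X nu).
Hypothesis tail_gt0 : forall x, 0 < tailR N X x.
Context (alpha : R) (halpha : tail_index nu alpha).
Context (disp' : measure_display) (Omega' : measurableType disp')
  (P' : probability Omega' R) (Y : {RV P' >-> D}).
Hypothesis hY : tail_process N nu Y.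

Local Notation p := (tailR N X).
Local Notation probX := (probX X).

Context (a r : R -> R) (ha : scaling_function a) (hr : scaling_function r).
Hypothesis hscale : (T%:E * tail_prob N X (a T))%E @[T --> +oo] --> 1%E.
Hypothesis hAC : anticlustering N X a r.
Hypothesis hmix : block_independence N X a r.

Local Notation theta := (fine (\int[P']_w (exceedance_time N (Y w))^-1)%E).
Local Notation psup L c :=
  (fine (P [set w | (sup_on N `[0%R, L%R] (X w) <= (c%R)%:E)%E])).

Let aT_cvg : a T @[T --> +oo] --> +oo. Proof. exact: scaling_cvg. Qed.
Let rT_cvg : r T @[T --> +oo] --> +oo. Proof. exact: scaling_cvg. Qed.
Let Sp_cvg : T * p (a T) @[T --> +oo] --> (1 : R). Proof. exact: scale_cvg hscale. Qed.

Let theta_ge0 : 0 <= theta.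
Proof. by apply/fine_ge0/integral_ge0 => w _; rewrite inve_ge0 exceedance_timeE. Qed.

Lemma mixing_near (k A1 A2 z1 z2 e : R) : 0 <= k -> 0 < A2 -> A1 < A2 ->
  0 < z1 -> z1 < z2 -> 0 < e ->
  \forall S \near +oo,
    `| fine 'E_P[fun w => expR (- block_process X a r
           (testf k A1 A2 z1 z2 : R * shiftD0 N -> R) S w)]
       - block_prod N X a r S k A1 A2 z1 z2 | < e.
Proof.
move=> k0 A20 A12 z10 z12 e0.
have := hmix (testf_test_function hN k0 A20 A12 z10 z12).
set F := (F in limf_esup F _) => h.
have /limf_esup_lt h2 : (limf_esup F +oo%R < e%:E)%E by rewrite h lte_fin.
near=> S.
have S0 : 0 < S by near: S; apply: nbhs_pinfty_gt; rewrite num_real.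
have rS0 : 0 < r S by near: S; move/cvgryPgt : rT_cvg; exact.
rewrite -(block_prodE N X a S0 rS0 k z1 z2 A20 A12) -lte_fin.
by near: S.
Unshelve. all: by end_near. Qed.

Lemma scale_near h : 0 < h ->
  \forall S \near +oo, 1 - h <= S * p (a S) <= 1 + h.
Proof.
move=> h0; near=> S; apply/andP; split; apply: ltW; near: S.
  by apply: (cvgr_gt _ Sp_cvg); lra.
by apply: (cvgr_lt _ Sp_cvg); lra.
Unshelve. all: by end_near. Qed.

(** The leading [h] is the mixing error. In the exponent, S * p (a S) >= 1 - h turns the number of
    blocks times r S * p (a S) into A * (1 - h) ^+ 2, and the block lost by rounding costs at most
    [C]. *)
Lemma sup_le_upper C h z e A : (\forall S \near +oo, r S * p (a S) <= C) ->
  0 < h < 1 -> 1 <= z -> 0 < e -> 0 < A -> C <= A * (1 - h) ^+ 2 ->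
  \forall S \near +oo, psup (A * S) (a S * z) <=
    h + expR (- ((1 - h) * ((z * (1 + h)) `^ (- alpha) * theta - e) *
      (A * (1 - h) ^+ 2 - C))).
Proof.
move=> hC /andP[h0 h1] z1 e0 A0 CA.
have z0 : 0 < z by lra.
have z2 : 1 <= z * (1 + h) by nra.
have z12 : z < z * (1 + h) by nra.
have A12 : A * (1 - h) < A by nra.
(* k = - ln h makes expR (- k) equal to [h]. *)
have k0 : 0 <= - ln h.
  by rewrite oppr_ge0 -ln1 ler_ln ?posrE ?ltr01// ltW.
have mixS := mixing_near k0 A0 A12 z0 z12 h0.
have geS := block_prob_ge hN hstat hrv tail_gt0 halpha hY ha hr hAC z2 e0.
have pS := scale_near h0.
near=> S.
have S0 : 0 < S by near: S; apply: nbhs_pinfty_gt; rewrite num_real.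
have rS0 : 0 < r S by near: S; move/cvgryPgt : rT_cvg; exact.
have aS0 : 0 < a S by near: S; move/cvgryPgt : aT_cvg; exact.
have mx := sup_le_expectation hN X S0 aS0 rS0 k0 A0 A12 z0 z12.
have pr := block_prod_le hN hstat S0 aS0 rS0 k0 A12 z0 z12.
have : psup (A * S) (a S * z) < h + block_prod N X a r S (- ln h) (A * (1 - h)) A z (z * (1 + h)).
  have : `| fine 'E_P[fun w => expR (- block_process X a r
           (testf (- ln h) (A * (1 - h)) A z (z * (1 + h)) : R * shiftD0 N -> R) S w)]
       - block_prod N X a r S (- ln h) (A * (1 - h)) A z (z * (1 + h)) | < h by near: S.
  by rewrite ltr_norml => /andP[_]; lra.
move=> /ltW/le_trans; apply; rewrite lerD2l; apply: (le_trans pr).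
rewrite ler_expR lerN2 opprK lnK ?posrE//.
have rpC : r S * p (a S) <= C by near: S.
have /andP[pS1 _] : 1 - h <= S * p (a S) <= 1 + h by near: S.
have ge : ((z * (1 + h)) `^ (- alpha) * theta - e) * (r S * p (a S)) <=
  probX (exc N 0 (r S) (a S * (z * (1 + h)))) by near: S.
set q := probX _ in ge *; set c := _ - e in ge *.
have p0 := tail_gt0 (a S); set pa := p (a S) in rpC pS1 ge p0 *.
rewrite -!mulrA ler_pM2l ?subr_gt0//.
set g := A * (1 - h) ^+ 2 - C.
have g0 : 0 <= g by rewrite subr_ge0.
have gE : g <= r S * pa * ((A * ((1 - h) * (S / r S))) - 1).
  rewrite mulrBr mulr1.
  have -> : r S * pa * (A * ((1 - h) * (S / r S))) = A * (1 - h) * (S * pa).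
    have : r S / r S = 1 by rewrite divff// gt_eqF.
    move: ((r S)^-1) => ri hri.
    have -> : r S * pa * (A * ((1 - h) * (S * ri))) = (r S * ri) * (A * (1 - h) * (S * pa)) by lra.
    by rewrite hri mul1r.
  have : A * (1 - h) * (1 - h) <= A * (1 - h) * (S * pa).
    by apply: ler_wpM2l => //; rewrite mulr_ge0 ?subr_ge0// ltW.
  rewrite /g expr2 mulrA; lra.
have rp0 : 0 < r S * pa by rewrite mulr_gt0.
set B := _ - 1 in gE *.
have B0 : 0 <= B.
  by rewrite -(pmulr_rge0 _ rp0); apply: le_trans gE.
have q0 : 0 <= q by exact: probX_ge0.
have [c0|c0] := leP c 0.
  by apply: (@le_trans _ _ 0); [exact: mulr_le0_ge0|exact: mulr_ge0].
apply: (@le_trans _ _ (c * (r S * pa * B))); first by apply: ler_wpM2l => //; exact: ltW.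
by rewrite mulrA; apply: ler_wpM2r.
Unshelve. all: by end_near. Qed.

(** Widening [A] to A + C * 2 lets the block that straddles A * S keep full weight, as r S <= 2 C S
    follows from r S * p (a S) <= C and S * p (a S) >= 1/2. The condition c * C < 1 keeps the block
    probability below 1. Mixing and expR (- k) cost [h] each. *)
Lemma sup_le_lower C h z e A : (\forall S \near +oo, r S * p (a S) <= C) -> 0 < C ->
  0 < h < 1 -> 0 < z -> 0 < e -> 0 < A ->
  let c := (z * (1 - h)) `^ (- alpha) * theta + e in c * C < 1 ->
  \forall S \near +oo,
    expR (- ((A + C * 2) * (1 + h) ^+ 2 * c / (1 - c * C))) - h * 2 <=
    psup (A * S) (a S * z).
Proof.
move=> hC C0 /andP[h0 h1] z0 e0 A0 c cC.
have z10 : 0 < z * (1 - h) by nra.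
have z12 : z * (1 - h) < z by nra.
set A1 := A + C * 2; have A10 : 0 < A1 by rewrite /A1; lra.
have A12 : A1 < A1 * (1 + h) by nra.
have A20 : 0 < A1 * (1 + h) by nra.
have k0 : 0 <= - ln h.
  by rewrite oppr_ge0 -ln1 ler_ln ?posrE ?ltr01// ltW.
have mixS := mixing_near k0 A20 A12 z10 z12 h0.
have leS := block_prob_le hN hstat hrv tail_gt0 halpha hY ha hr z10 e0.
have pS := scale_near h0.
have h20 : 0 < 2^-1 :> R by lra.
have pS2 := scale_near h20.
near=> S.
have S0 : 0 < S by near: S; apply: nbhs_pinfty_gt; rewrite num_real.
have rS0 : 0 < r S by near: S; move/cvgryPgt : rT_cvg; exact.
have aS0 : 0 < a S by near: S; move/cvgryPgt : aT_cvg; exact.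
have rpC : r S * p (a S) <= C by near: S.
have /andP[_ pS1] : 1 - h <= S * p (a S) <= 1 + h by near: S.
have /andP[pS3 _] : 1 - 2^-1 <= S * p (a S) <= 1 + 2^-1 by near: S.
have le1 : probX (exc N 0 (r S) (a S * (z * (1 - h)))) <= c * (r S * p (a S)) by near: S.
have p0 := tail_gt0 (a S); set pa := p (a S) in rpC pS1 pS3 le1 p0 *.
have rSC : r S <= C * 2 * S.
  by rewrite -(ler_pM2r p0); apply: (le_trans rpC); rewrite -mulrA; nra.
have LA : A * S + r S <= A1 * S by rewrite /A1 mulrDl lerD2l.
have L0 : 0 <= A * S by rewrite mulr_ge0// ltW.
have mx := expectation_le_sup hN X S0 aS0 rS0 k0 A20 A12 z10 z12 L0 LA.
have c0 : 0 < c.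
  by rewrite /c ltr_wpDl// mulr_ge0 ?powR_ge0//; exact: theta_ge0.
have q0 : 0 <= probX (exc N 0 (r S) (a S * (z * (1 - h)))) by exact: probX_ge0.
have qC : probX (exc N 0 (r S) (a S * (z * (1 - h)))) <= c * C.
  by apply: (le_trans le1); rewrite ler_pM2l.
have q1 := le_lt_trans qC cC.
have pr := block_prod_ge hN hstat S0 aS0 rS0 A1 k0 A20 z10 z12 q1.
rewrite opprK lnK ?posrE// in mx.
have mx2 : block_prod N X a r S (- ln h) A1 (A1 * (1 + h)) (z * (1 - h)) z - h <
   fine 'E_P[fun w => expR (- block_process X a r
           (testf (- ln h) A1 (A1 * (1 + h)) (z * (1 - h)) z : R * shiftD0 N -> R) S w)].
  have : `| fine 'E_P[fun w => expR (- block_process X a r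
           (testf (- ln h) A1 (A1 * (1 + h)) (z * (1 - h)) z : R * shiftD0 N -> R) S w)]
       - block_prod N X a r S (- ln h) A1 (A1 * (1 + h)) (z * (1 - h)) z | < h by near: S.
  by rewrite ltr_norml => /andP[]; lra.
suff : expR (- (A1 * (1 + h) ^+ 2 * c / (1 - c * C))) <=
   block_prod N X a r S (- ln h) A1 (A1 * (1 + h)) (z * (1 - h)) z by lra.
apply: le_trans pr; rewrite ler_expR lerN2.
set q := probX _ in le1 q0 qC q1 *.
have d0 : 0 < 1 - c * C by rewrite subr_gt0.
have d1 : 0 < 1 - q by rewrite subr_gt0.
rewrite mulrA ler_pdivlMr// mulrAC ler_pdivrMr//.
have h3 : A1 * (1 + h) * S / r S * q <= A1 * (1 + h) ^+ 2 * c.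
  rewrite mulrAC ler_pdivrMr//.
  apply: (@le_trans _ _ (A1 * (1 + h) * S * (c * (r S * pa)))).
    by apply: ler_wpM2l le1; rewrite mulr_ge0// ltW.
  have -> : A1 * (1 + h) * S * (c * (r S * pa)) = A1 * (1 + h) * c * r S * (S * pa) by lra.
  have -> : A1 * (1 + h) ^+ 2 * c * r S = A1 * (1 + h) * c * r S * (1 + h) by lra.
  by apply: ler_wpM2l => //; rewrite ltW// !mulr_gt0//; lra.
apply: ler_pM => //.
- by rewrite mulr_ge0// divr_ge0 ?ltW// mulr_gt0.
- exact: ltW.
- by rewrite lerD2l lerN2.
Unshelve. all: by end_near. Qed.

End cluster_limit.

(** * Change of time scale and conclusion *)

Section final_limit.
Context {R : realType} {d : nat} (N : 'rV[R]_d -> R) (hN : is_norm N).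
Local Notation D := (skorokhod R d).
Context (nu : {measure set D -> \bar R}).
Context (disp : measure_display) (Omega : measurableType disp)
  (P : probability Omega R) (X : {RV P >-> D}).
Hypotheses (hstat : stationary X) (hrv : regularly_varying N X nu).
Hypothesis tail_gt0 : forall x, 0 < tailR N X x.
Context (alpha : R) (halpha : tail_index nu alpha).
Context (disp' : measure_display) (Omega' : measurableType disp')
  (P' : probability Omega' R) (Y : {RV P' >-> D}).
Hypothesis hY : tail_process N nu Y.

Let alpha0 : 0 < alpha. Proof. by case: halpha. Qed.

Local Notation p := (tailR N X).
Local Notation probX := (probX X).

Context (a r : R -> R) (ha : scaling_function a) (hr : scaling_function r).
Hypothesis hscale : (T%:E * tail_prob N X (a T))%E @[T --> +oo] --> 1%E.
Hypothesis hAC : anticlustering N X a r.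
Hypothesis hmix : block_independence N X a r.

Local Notation theta := (fine (\int[P']_w (exceedance_time N (Y w))^-1)%E).
Local Notation psup L c :=
  (fine (P [set w | (sup_on N `[0%R, L%R] (X w) <= (c%R)%:E)%E])).

Let aT_cvg : a T @[T --> +oo] --> +oo. Proof. exact: scaling_cvg. Qed.
Let Sp_cvg : T * p (a T) @[T --> +oo] --> (1 : R). Proof. exact: scale_cvg hscale. Qed.

Lemma tailR_anti u v : u <= v -> p v <= p u.
Proof.
move=> uv; rewrite !tailRE; apply: probX_le; try exact: (measurable_coord hN).
by move=> y /=; exact: le_lt_trans.
Qed.

Lemma cvg_dilation A : 0 < A -> A * S @[S --> +oo] --> (+oo : set_system R).
Proof.
move=> A0; apply/cvgryPge => M; near=> S.
have h : M / A <= S by near: S; apply: nbhs_pinfty_ge; rewrite num_real.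
by rewrite mulrC -ler_pdivrMr.
Unshelve. all: by end_near. Qed.

(** p (a (A * S)) and p (a S) behave as 1/(A S) and 1/S; the tail ratio at level a (A * S) supplies
    x^(-alpha). *)
Lemma tail_level_cvg A x : 0 < A -> 0 < x ->
  p (a (A * S) * x) / p (a S) @[S --> +oo] --> x `^ (- alpha) / A.
Proof.
move=> A0 x0.
have h1 : p (a (A * S) * x) / p (a (A * S)) @[S --> +oo] --> x `^ (- alpha).
  have h := tailR_cvg hN hstat hrv tail_gt0 halpha hY x0.
  have h2 : a (A * S) @[S --> +oo] --> +oo by apply: cvg_comp aT_cvg; exact: cvg_dilation.
  exact: cvg_comp h2 h.
have h2 : A * S * p (a (A * S)) @[S --> +oo] --> (1 : R).
  exact: cvg_comp (cvg_dilation A0) Sp_cvg.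
have h3 : (S * p (a S))^-1 @[S --> +oo] --> (1^-1 : R) by apply: cvgV => //; exact: oner_neq0.
have h4 : (p (a (A * S) * x) / p (a (A * S))) *
    (A * S * p (a (A * S)) * (S * p (a S))^-1) / A @[S --> +oo] -->
  x `^ (- alpha) * (1 * 1^-1) / A.
  by apply: cvgMr_tmp; apply: cvgM h1 (cvgM h2 h3).
rewrite invr1 !mulr1 in h4.
apply: cvg_trans h4; apply: near_eq_cvg; near=> S.
have S0 : 0 < S by near: S; apply: nbhs_pinfty_gt; rewrite num_real.
have := tail_gt0 (a (A * S)); have := tail_gt0 (a S).
move: (p (a (A * S))) (p (a S)) (p (a (A * S) * x)) => u v w v0 u0.
have hu : u / u = 1 by rewrite divff// gt_eqF.
have hS : S / S = 1 by rewrite divff// gt_eqF.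
have hA : A / A = 1 by rewrite divff// gt_eqF.
rewrite invfM; move: u^-1 S^-1 A^-1 v^-1 hu hS hA => ui Si Ai vi hu hS hA.
have -> : w * ui * (A * S * u * (Si * vi)) * Ai = w * vi * ((u * ui) * (S * Si) * (A * Ai)) by lra.
by rewrite hu hS hA !mulr1.
Unshelve. all: by end_near. Qed.

(** The levels are ordered through their tails: relative to [p (a S)] the three tails have strictly
    ordered limits, separated by [b1] and [b2], and [p] is nonincreasing. *)
Lemma level_near A x z h : 0 < A -> 0 < x -> 0 < z -> 0 < h < 1 ->
  A * z `^ (- alpha) = x `^ (- alpha) ->
  \forall S \near +oo,
    a S * (z * (1 - h)) <= a (A * S) * x <= a S * (z * (1 + h)).
Proof.
move=> A0 x0 z0 /andP[h0 h1] Az.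
have zh0 : 0 < z * (1 - h) by nra.
have zh1 : 0 < z * (1 + h) by nra.
have l1 := tailR_cvg hN hstat hrv tail_gt0 halpha hY zh0.
have l2 := tailR_cvg hN hstat hrv tail_gt0 halpha hY zh1.
have l3 := tail_level_cvg A0 x0.
have zE : x `^ (- alpha) / A = z `^ (- alpha) by rewrite -Az mulrAC divff ?mul1r// gt_eqF.
rewrite zE in l3.
have m1 : z `^ (- alpha) < (z * (1 - h)) `^ (- alpha).
  rewrite !powRN ltf_pV2 ?posrE ?powR_gt0//.
  by apply: gt0_ltr_powR => //; rewrite ?nnegrE ?ltW//; nra.
have m2 : (z * (1 + h)) `^ (- alpha) < z `^ (- alpha).
  rewrite !powRN ltf_pV2 ?posrE ?powR_gt0//.
  by apply: gt0_ltr_powR => //; rewrite ?nnegrE ?ltW//; nra.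
have [b1 b11 b12] : exists2 b, z `^ (- alpha) < b & b < (z * (1 - h)) `^ (- alpha).
  by exists ((z `^ (- alpha) + (z * (1 - h)) `^ (- alpha)) / 2); lra.
have [b2 b21 b22] : exists2 b, (z * (1 + h)) `^ (- alpha) < b & b < z `^ (- alpha).
  by exists ((z `^ (- alpha) + (z * (1 + h)) `^ (- alpha)) / 2); lra.
have l1' := cvg_comp _ _ aT_cvg l1.
have l2' := cvg_comp _ _ aT_cvg l2.
near=> S.
have e1 : b1 < p (a S * (z * (1 - h))) / p (a S) by near: S; exact: (cvgr_gt _ l1').
have e2 : p (a S * (z * (1 + h))) / p (a S) < b2 by near: S; exact: (cvgr_lt _ l2').
have e3 : p (a (A * S) * x) / p (a S) < b1 by near: S; exact: (cvgr_lt _ l3).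
have e4 : b2 < p (a (A * S) * x) / p (a S) by near: S; exact: (cvgr_gt _ l3).
have := lt_trans e3 e1; rewrite ltr_pM2r ?invr_gt0// => f1.
have := lt_trans e2 e4; rewrite ltr_pM2r ?invr_gt0// => f2.
apply/andP; split; rewrite leNgt; apply/negP => /ltW/tailR_anti; lra.
Unshelve. all: by end_near. Qed.

Lemma dilation_near A (Q : R -> Prop) : 0 < A ->
  (\forall S \near +oo, Q (A * S)) -> \forall T \near +oo, Q T.
Proof.
move=> A0 H; have Ai0 : 0 < A^-1 by rewrite invr_gt0.
have h : \forall T \near +oo, Q (A * (A^-1 * T)) by exact: (cvg_dilation Ai0 H).
by apply: filterS h => T; rewrite mulrA divff ?mul1r// gt_eqF.
Qed.

Lemma psup_mono L c c' : c <= c' -> psup L c <= psup L c'.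
Proof.
move=> cc; apply: fine_le; rewrite ?fin_num_measure//; try exact: (measurable_sup_le hN).
apply: le_measure; rewrite ?inE; try exact: (measurable_sup_le hN).
by move=> w /= /le_trans; apply; rewrite lee_fin.
Qed.

Let scale_powR h : 0 < h -> (h `^ (- alpha^-1)) `^ (- alpha) = h.
Proof. by move=> h0; rewrite -powRrM mulrNN mulVf ?gt_eqF// powRr1// ltW. Qed.

(** The level reaches the range of [block_prob_ge], whatever the value of [x]. *)
Let scale_ge1 h : 0 < h < 1 -> 1 <= h `^ (- alpha^-1).
Proof.
move=> /andP[h0 h1]; rewrite powRN -[leLHS]invr1 lef_pV2 ?posrE ?powR_gt0//.
by rewrite -[leRHS](powRr0 h); apply: ger_powR; [rewrite h0 ltW|rewrite invr_ge0 ltW].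
Qed.

(* The rates obtained at level [z = h^(-1/alpha)] on the window
   [A = x^(-alpha) / h], for an error parameter [h] tending to 0. *)
Definition upper_rate C x h := (1 - h) * ((1 + h) `^ (- alpha) ^+ 2 * theta - h) *
  (x `^ (- alpha) * (1 - h) ^+ 2 - C * h).

Definition lower_rate C x h :=
  let c := (1 - h) `^ (- alpha) ^+ 2 * theta + h in
  (x `^ (- alpha) + C * 2 * h) * (1 + h) ^+ 2 * c / (1 - h * c * C).

Lemma sup_upper C x h : (\forall S \near +oo, r S * p (a S) <= C) ->
  0 < x -> 0 < h < 1 -> C * h <= x `^ (- alpha) * (1 - h) ^+ 2 ->
  \forall T \near +oo, psup T (a T * x) <= h + expR (- upper_rate C x h).
Proof.
move=> hC x0 h01 Ch; have /andP[h0 h1] := h01.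
set z := h `^ (- alpha^-1); have z1 : 1 <= z by exact: scale_ge1.
have zE : z `^ (- alpha) = h by exact: scale_powR.
have z0 : 0 < z by lra.
have X0 : 0 < x `^ (- alpha) by exact: powR_gt0.
pose A := x `^ (- alpha) / h; have A0 : 0 < A by exact: divr_gt0.
have hA : h * A = x `^ (- alpha) by rewrite /A mulrCA divff ?mulr1// gt_eqF.
have AE : A * z `^ (- alpha) = x `^ (- alpha) by rewrite zE mulrC.
have CA : C <= A * (1 - h) ^+ 2 by rewrite -(ler_pM2r h0) mulrAC [A * h]mulrC hA.
have z1' : 1 <= z * (1 + h) by nra.
(* The error in the block probability must be small against z^(-alpha) = h; once [h] is factored out
   of the rate, an error [h] remains. *)
have h2 : 0 < h * h by exact: mulr_gt0.
apply: (dilation_near A0).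
have up := sup_le_upper hN hstat hrv tail_gt0 halpha hY ha hr hscale hAC hmix hC h01 z1' h2 A0 CA.
have lv := level_near A0 x0 z0 h01 AE.
near=> S.
have /andP[_ lS] : a S * (z * (1 - h)) <= a (A * S) * x <= a S * (z * (1 + h)) by near: S.
apply: (le_trans (psup_mono _ lS)).
have uS : psup (A * S) (a S * (z * (1 + h))) <=
    h + expR (- ((1 - h) * ((z * (1 + h) * (1 + h)) `^ (- alpha) * theta - h * h) *
      (A * (1 - h) ^+ 2 - C))) by near: S.
apply: (le_trans uS); rewrite lerD2l ler_expR lerN2 /upper_rate.
have h10 : 0 <= 1 + h by lra.
have -> : (z * (1 + h) * (1 + h)) `^ (- alpha) = h * (1 + h) `^ (- alpha) ^+ 2.
  by rewrite !powRM ?mulr_ge0 ?(ltW z0)// zE expr2 mulrA.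
rewrite -hA le_eqVlt; apply/orP; left; apply/eqP.
by move: theta (_ `^ _) => th m; lra.
Unshelve. all: by end_near. Qed.

(** At level [z] a block exceeds with probability at most about h * c * C. The denominator 1 - h * c
    * C of the rate therefore tends to 1, which is what the change of scale is for. *)
Lemma sup_lower C x h : (\forall S \near +oo, r S * p (a S) <= C) -> 0 < C ->
  0 < x -> 0 < h < 1 ->
  h * ((1 - h) `^ (- alpha) ^+ 2 * theta + h) * C < 1 ->
  \forall T \near +oo, expR (- lower_rate C x h) - h * 2 <= psup T (a T * x).
Proof.
move=> hC C0 x0 h01 Ch; have /andP[h0 h1] := h01.
set z := h `^ (- alpha^-1); have z1 : 1 <= z by exact: scale_ge1.
have zE : z `^ (- alpha) = h by exact: scale_powR.
have z0 : 0 < z by lra.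
have X0 : 0 < x `^ (- alpha) by exact: powR_gt0.
pose A := x `^ (- alpha) / h; have A0 : 0 < A by exact: divr_gt0.
have hA : h * A = x `^ (- alpha) by rewrite /A mulrCA divff ?mulr1// gt_eqF.
have AE : A * z `^ (- alpha) = x `^ (- alpha) by rewrite zE mulrC.
have z0' : 0 < z * (1 - h) by nra.
have h2 : 0 < h * h by exact: mulr_gt0.
have cE : (z * (1 - h) * (1 - h)) `^ (- alpha) * theta + h * h =
    h * ((1 - h) `^ (- alpha) ^+ 2 * theta + h).
  have h10 : 0 <= 1 - h by lra.
  rewrite !powRM ?mulr_ge0 ?(ltW z0)// zE; move: theta (_ `^ _) => th m; lra.
apply: (dilation_near A0).
have lo := sup_le_lower hN hstat hrv tail_gt0 halpha hY ha hr hscale hmix hC C0 h01 z0' h2 A0.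
rewrite /= cE in lo; have {}lo := lo Ch.
have lv := level_near A0 x0 z0 h01 AE.
set c := _ * theta + h in lo.
near=> S.
have /andP[lS _] : a S * (z * (1 - h)) <= a (A * S) * x <= a S * (z * (1 + h)) by near: S.
apply: le_trans (psup_mono _ lS).
have uS : expR (- ((A + C * 2) * (1 + h) ^+ 2 * (h * c) / (1 - h * c * C))) - h * 2 <=
  psup (A * S) (a S * (z * (1 - h))) by near: S.
apply: le_trans uS; rewrite lerD2r ler_expR lerN2 /lower_rate -/c -hA.
rewrite le_eqVlt; apply/orP; left; apply/eqP; congr (_ / _).
lra.
Unshelve. all: by end_near. Qed.

Let h0_cvg : h @[h --> (0:R)^'+] --> (0 : R).
Proof. exact/cvg_at_right_filter/cvg_id. Qed.

Let sub_cvg : 1 - h @[h --> (0:R)^'+] --> (1 : R).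
Proof. by rewrite -[X in _ --> X]subr0; apply: cvgB h0_cvg; exact: cvg_cst. Qed.

Let add_cvg : 1 + h @[h --> (0:R)^'+] --> (1 : R).
Proof. by rewrite -[X in _ --> X]addr0; apply: cvgD h0_cvg; exact: cvg_cst. Qed.

Let cst_cvg (c : R) : c @[h --> (0:R)^'+] --> c. Proof. exact: cvg_cst. Qed.

Let sqr_cvg (g : R -> R) (l : R) : g h @[h --> (0:R)^'+] --> l ->
  g h ^+ 2 @[h --> (0:R)^'+] --> l ^+ 2.
Proof. by move=> gl; rewrite expr2; under eq_fun do rewrite expr2; exact: cvgM. Qed.

Let powR1_cvg (g : R -> R) : g h @[h --> (0:R)^'+] --> (1 : R) ->
  g h `^ (- alpha) @[h --> (0:R)^'+] --> (1 : R).
Proof.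
move=> g1; have h2 := @cvg_powR R (- alpha) 1 ltr01; rewrite powR1 in h2.
exact: cvg_comp g1 h2.
Qed.

Lemma upper_rate_cvg C x :
  upper_rate C x h @[h --> (0:R)^'+] --> theta * x `^ (- alpha).
Proof.
have h1 : upper_rate C x h @[h --> (0:R)^'+] -->
   1 * (1 ^+ 2 * theta - 0) * (x `^ (- alpha) * 1 ^+ 2 - C * 0).
  apply: cvgM; first apply: cvgM => //.
    apply: cvgB h0_cvg; apply: cvgM => //; exact/sqr_cvg/powR1_cvg.
  by apply: cvgB; apply: cvgM => //; exact: sqr_cvg.
by rewrite expr1n !mul1r mulr1 mulr0 !subr0 in h1.
Qed.

Let lower_const_cvg : (1 - h) `^ (- alpha) ^+ 2 * theta + h @[h --> (0:R)^'+] --> theta.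
Proof.
have h1 : (1 - h) `^ (- alpha) ^+ 2 * theta + h @[h --> (0:R)^'+] --> 1 ^+ 2 * theta + 0.
  by apply: cvgD h0_cvg; apply: cvgM => //; exact/sqr_cvg/powR1_cvg.
by rewrite expr1n mul1r addr0 in h1.
Qed.

Let lower_den_cvg C :
  h * ((1 - h) `^ (- alpha) ^+ 2 * theta + h) * C @[h --> (0:R)^'+] --> (0 : R).
Proof.
have h1 : h * ((1 - h) `^ (- alpha) ^+ 2 * theta + h) * C @[h --> (0:R)^'+] --> 0 * theta * C.
  by apply: cvgM => //; apply: cvgM.
by rewrite !mul0r in h1.
Qed.

Lemma lower_rate_cvg C x :
  lower_rate C x h @[h --> (0:R)^'+] --> theta * x `^ (- alpha).
Proof.
have h1 : lower_rate C x h @[h --> (0:R)^'+] -->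
   (x `^ (- alpha) + C * 2 * 0) * 1 ^+ 2 * theta / (1 - 0).
  rewrite /lower_rate /=; apply: cvgM.
    apply: cvgM => //; apply: cvgM; last exact: sqr_cvg.
    by apply: cvgD => //; apply: cvgM.
  apply: cvgV; first by rewrite subr0 oner_neq0.
  exact: cvgB.
by rewrite expr1n mulr0 addr0 mulr1 subr0 invr1 mulr1 mulrC in h1.
Qed.

Lemma sup_cvg x : 0 < x ->
  psup T (a T * x) @[T --> +oo] --> expR (- (theta * x `^ (- alpha))).
Proof.
move=> x0; have X0 : 0 < x `^ (- alpha) by exact: powR_gt0.
have [C C0 hC] := block_rate_bounded hN hstat hrv tail_gt0 halpha hY ha hr hAC.
set l := expR _; apply/cvgrPdist_le => e e0.
have up : h + expR (- upper_rate C x h) @[h --> (0:R)^'+] --> 0 + l.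
  apply: cvgD => //; apply: continuous_cvg; first exact: continuous_expR.
  apply: cvgN; exact: upper_rate_cvg C x.
have lo : expR (- lower_rate C x h) - h * 2 @[h --> (0:R)^'+] --> l - 0 * 2.
  apply: cvgB; last exact: cvgM.
  apply: continuous_cvg; first exact: continuous_expR.
  apply: cvgN; exact: lower_rate_cvg C x.
rewrite add0r in up; rewrite mul0r subr0 in lo.
have c1 : x `^ (- alpha) * (1 - h) ^+ 2 - C * h @[h --> (0:R)^'+] -->
    x `^ (- alpha) * 1 ^+ 2 - C * 0.
  by apply: cvgB; apply: cvgM => //; exact: sqr_cvg.
rewrite expr1n mulr1 mulr0 subr0 in c1.
(* [h] is fixed before T, since the ranges of T in [sup_upper] and [sup_lower] depend on it. *)
near (0:R)^'+ => h.
have h0 : 0 < h by near: h; exact: nbhs_right_gt.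
have h1 : h < 1 by near: h; exact: nbhs_right_lt.
have h01 : 0 < h < 1 by rewrite h0.
have hup : h + expR (- upper_rate C x h) < l + e.
  by near: h; apply: (cvgr_lt _ up); lra.
have hlo : l - e < expR (- lower_rate C x h) - h * 2.
  by near: h; apply: (cvgr_gt _ lo); lra.
have c1' : 0 < x `^ (- alpha) * (1 - h) ^+ 2 - C * h.
  by near: h; exact: (cvgr_gt _ c1).
have c2 : h * ((1 - h) `^ (- alpha) ^+ 2 * theta + h) * C < 1.
  by near: h; apply: (cvgr_lt _ (lower_den_cvg C)).
have c1'' : C * h <= x `^ (- alpha) * (1 - h) ^+ 2 by lra.
have U := sup_upper hC x0 h01 c1''.
have L := sup_lower hC C0 x0 h01 c2.
near=> T.
have HU : psup T (a T * x) <= h + expR (- upper_rate C x h) by near: T.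
have HL : expR (- lower_rate C x h) - h * 2 <= psup T (a T * x) by near: T.
by rewrite ler_norml; apply/andP; split; lra.
Unshelve. all: by end_near. Qed.

End final_limit.

(** T * p (a T) tends to 1, so the nonincreasing tail [p] is positive at arbitrarily high levels
    a_T. This discharges the positivity assumed in the sections above. *)
Lemma tailR_gt0 (R : realType) (d : nat) (N : 'rV[R]_d -> R) (hN : is_norm N)
  (disp : measure_display) (Omega : measurableType disp)
  (P : probability Omega R) (X : {RV P >-> skorokhod R d}) (a : R -> R) :
  scaling_function a ->
  (T%:E * tail_prob N X (a T))%E @[T --> +oo] --> 1%E ->
  forall x, 0 < tailR N X x.
Proof.
move=> ha hscale x; have Sp := scale_cvg hN hscale.
have aT := scaling_cvg ha.
near (+oo : set_system R) => T.
have T0 : 0 < T by near: T; apply: nbhs_pinfty_gt; rewrite num_real.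
have xa : x <= a T by near: T; move/cvgryPge : aT; exact.
have Tp : 0 < T * tailR N X (a T) by near: T; apply: (cvgr_gt _ Sp).
apply: (@lt_le_trans _ _ (tailR N X (a T))); last exact: tailR_anti.
by rewrite pmulr_rgt0 in Tp.
Unshelve. all: by end_near. Qed.

Theorem corollary3p11 (R : realType) (d : nat) (hd : (0 < d)%N)
  (N : 'rV[R]_d -> R) (hN : is_norm N)
  (disp : measure_display) (Omega : measurableType disp)
  (P : probability Omega R) (X : {RV P >-> skorokhod R d})
  (hstat : stationary X)
  (nu : {measure set (skorokhod R d) -> \bar R})
  (hrv : regularly_varying N X nu)
  (alpha : R) (halpha : tail_index nu alpha)
  (disp' : measure_display) (Omega' : measurableType disp')
  (P' : probability Omega' R) (Y : {RV P' >-> skorokhod R d})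
  (hY : tail_process N nu Y)
  (a r : R -> R) (ha : scaling_function a) (hr : scaling_function r)
  (hscale : (T%:E * tail_prob N X (a T))%E @[T --> +oo] --> 1%E)
  (hAC : anticlustering N X a r)
  (hmix : block_independence N X a r)
  (x : R) (hx : 0 < x) :
  let theta := (\int[P']_w (exceedance_time N (Y w))^-1)%E in
  P [set w | (sup_on N `[0%R, T] (X w) <= (a T * x)%:E)%E]
    @[T --> +oo] --> expeR (- (theta * (x `^ (- alpha))%:E))%E.
Proof.
move=> theta.
have tail_gt0 := tailR_gt0 hN ha hscale.
have th : theta \is a fin_num by exact: (theta_fin_num hN hstat hrv tail_gt0 halpha hY).
rewrite -(fineK th) -EFinM -EFinN /=.
have h := sup_cvg hN hstat hrv tail_gt0 halpha hY ha hr hscale hAC hmix hx.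
apply: cvg_EFin => //; apply: nearW => T.
by rewrite fin_num_measure//; exact: (measurable_sup_le hN).
Qed.
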